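(* Assume that $\gamma\in(0,1/3]$, $\delta(\varepsilon)=\varepsilon^{\frac{1-\gamma}{1+\gamma}}$, and let $n\ge1$ be an integer. (1) For any $x_0\neq0$, $d_{n,\varepsilon}(\cdot,x_0)$ exhibits profile cut-off as $\varepsilon\to0$, where for sufficiently small $\varepsilon>0$ the cut-off time $t_\varepsilon$ is the unique solution to $$e^{-2\lambda_{n,\varepsilon}t_\varepsilon}\left(\int_{\mathbb R}\varrho_{\varepsilon,0}(x)\psi_{n,\varepsilon}(x)\,dx\right)^2=1,$$ equivalently $$t_\varepsilon=\frac{1}{\lambda_{n,\varepsilon}}\log\left(\left|\int_{\mathbb R}\varrho_{\varepsilon,0}(x)\psi_{n,\varepsilon}(x)\,dx\right|\right),$$ the time window is $w_\varepsilon:=\varepsilon^{\frac{1-\gamma}{1+\gamma}}$, and the profile function is $\mathfrak p(r)=e^{-\lambda_n r}$, $r\in\mathbb R$. (2) For $x_0=0$, let $E_n:=\{1\le j\le n:\ \psi_j(0)\neq0\}$. If $E_n=\emptyset$, then $d_{n,\varepsilon}(t,0)=0$ for all $t\ge0$. Otherwise, letting $m:=\max E_n$, $d_{n,\varepsilon}(\cdot,0)$ exhibits profile cut-off with cut-off time $t_\varepsilon$ determined (for sufficiently small $\varepsilon>0$) by $$e^{-2\lambda_{m,\varepsilon}t_\varepsilon}\left(\int_{\mathbb R}\varrho_{\varepsilon,0}(x)\psi_{m,\varepsilon}(x)\,dx\right)^2=1,$$ the same time window $w_\varepsilon:=\varepsilon^{\frac{1-\gamma}{1+\gamma}}$, and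 profile function $\mathfrak p(r)=e^{-\lambda_m r}$, $r\in\mathbb R$.
   Context: Let $V(x)=\frac{1}{\gamma+1}|x|^{\gamma+1}$, $x\in\mathbb R$, with $\gamma>0$. For $\varepsilon\in(0,1]$ let $\mathcal L_\varepsilon u=\varepsilon u''-V'u'$ and let $\varrho_{\varepsilon,\infty}(x)=C_\varepsilon e^{-V(x)/\varepsilon}$, where $C_\varepsilon$ makes it a probability density. The operator $-\mathcal L_\varepsilon$ on $L^2(\varrho_{\varepsilon,\infty}dx)$ has discrete simple spectrum $0=\lambda_{0,\varepsilon}<\lambda_{1,\varepsilon}<\lambda_{2,\varepsilon}<\cdots$ with eigenfunctions $\psi_{0,\varepsilon}=1,\psi_{1,\varepsilon},\psi_{2,\varepsilon},\dots$ forming an orthonormal basis of $L^2(\varrho_{\varepsilon,\infty}dx)$. When $\varepsilon=1$ write $\lambda_k,\psi_k$ for $\lambda_{k,1},\psi_{k,1}$. The initial density is $\varrho_{\varepsilon,0}=\frac{1}{2\delta(\varepsilon)}\mathbf 1_{(x_0-\delta(\varepsilon),x_0+\delta(\varepsilon))}$, with $x_0\in\mathbb R$, and $\varrho_{\varepsilon,t}$ denotes the solution at time $t$ of the Fokker–Planck equation $\partial_t\varrho=(\varrho V'+\varepsilon\varrho')'$ with initial datum $\varrho_{\varepsilon,0}$. Let $\Pi_{n,\varepsilon}f=\sum_{k=0}^n\langle f,\psi_{k,\varepsilon}\rangle_{L^2(\varrho_{\varepsilon,\infty}dx)}\psi_{k,\varepsilon}$. The truncated $\chi^2$-distance is $$d_{n,\varepsilon}(t,x_0)=\left(\int_{\mathbb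 R}\left|\Pi_{n,\varepsilon}\left[\frac{\varrho_{\varepsilon,t}}{\varrho_{\varepsilon,\infty}}\right](x)-1\right|^2\varrho_{\varepsilon,\infty}(x)\,dx\right)^{1/2},\quad t\ge0,$$ equivalently $$d_{n,\varepsilon}(t,x_0)=\left(\sum_{k=1}^n e^{-2\lambda_{k,\varepsilon}t}\left(\int_{\mathbb R}\varrho_{\varepsilon,0}(x)\psi_{k,\varepsilon}(x)\,dx\right)^2\right)^{1/2}.$$ Profile cut-off with cut-off time $t_\varepsilon>0$, time window $w_\varepsilon>0$ and profile function $\mathfrak p$ means: $w_\varepsilon/t_\varepsilon\to0$ as $\varepsilon\to0$, $\lim_{\varepsilon\to0}d_{n,\varepsilon}(t_\varepsilon+rw_\varepsilon,x_0)=\mathfrak p(r)$ for all $r\in\mathbb R$, $\lim_{r\to-\infty}\mathfrak p(r)=\infty$ and $\lim_{r\to\infty}\mathfrak p(r)=0$. *)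

(* Defs.v *)
(* MathComp-Analysis; the real line is an arbitrary R : realType. *)
From HB Require Import structures.
From mathcomp Require Export all_boot all_order all_algebra.
From mathcomp Require Export all_classical all_reals all_analysis.
Export Order.TTheory GRing.Theory Num.Theory.
Export numFieldNormedType.Exports.

Set Implicit Arguments.
Unset Strict Implicit.
Unset Printing Implicit Defensive.

#[global] Open Scope ring_scope.
#[global] Open Scope classical_set_scope.

Definition potential (R : realType) (gamma x : R) : R :=
  (gamma + 1)^-1 * `|x| `^ (gamma + 1).

Definition generator (R : realType) (gamma eps : R) (u : R -> R) (x : R) : R :=
  eps * derive1 (derive1 u) x - derive1 (potential gamma) x * derive1 u x.

Definition partition_constant (R : realType) (gamma eps : R) : R :=
  \int[@lebesgue_measure R]_x expR (- (potential gamma x / eps)).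

Definition rho_inf (R : realType) (gamma eps x : R) : R :=
  (partition_constant gamma eps)^-1 * expR (- (potential gamma x / eps)).

(* Elements of L^2(rho_inf dx) are represented by functions R -> R; the
   function is required to be Borel measurable. *)
Definition in_L2 (R : realType) (gamma eps : R) (f : R -> R) : Prop :=
  measurable_fun [set: R] f /\
  (@lebesgue_measure R).-integrable [set: R]
    (fun x => (f x ^+ 2 * rho_inf gamma eps x)%:E).

Definition inner (R : realType) (gamma eps : R) (f g : R -> R) : R :=
  \int[@lebesgue_measure R]_x (f x * g x * rho_inf gamma eps x).

Definition norm2 (R : realType) (gamma eps : R) (f : R -> R) : R :=
  Num.sqrt (inner gamma eps f f).

(* Since V' is continuous, an L^2 eigenfunction has a twice differentiable
   representative satisfying the equation at every point. *)
Definition eigenfunction (R : realType) (gamma eps lambda : R) (u : R -> R)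
    : Prop :=
  [/\ in_L2 gamma eps u, u <> cst 0,
      forall x : R, derivable u x 1,
      forall x : R, derivable (derive1 u) x 1 &
      forall x : R, - generator gamma eps u x = lambda * u x].

Definition projection (R : realType) (gamma eps : R) (psi : nat -> R -> R)
    (n : nat) (f : R -> R) (x : R) : R :=
  \sum_(0 <= k < n.+1) inner gamma eps f (psi k) * psi k x.

(* [lambda] enumerates the (discrete, simple) spectrum of -L_eps, and [psi]
   is an orthonormal basis of corresponding eigenfunctions.  Discreteness is
   the divergence of [lambda]; the completeness of [psi] makes [lambda] exhaust
   the spectrum, each eigenvalue being simple as the [lambda k] are distinct. *)
Record spectral_basis (R : realType) (gamma eps : R)
    (lambda : nat -> R) (psi : nat -> R -> R) : Prop := SpectralBasis {
  eigenvalue0 : lambda 0%N = 0;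
  eigenvalue_lt : forall j k : nat, (j < k)%N -> lambda j < lambda k;
  eigenvalue_cvg : lambda k @[k --> \oo] --> +oo;
  eigenfunction0 : psi 0%N = cst 1;
  eigenfunctionP : forall k, eigenfunction gamma eps (lambda k) (psi k);
  psi_orthonormal :
    forall j k : nat, inner gamma eps (psi j) (psi k) = (j == k)%:R;
  psi_complete : forall f : R -> R, in_L2 gamma eps f ->
    norm2 gamma eps (f \- projection gamma eps psi n f) @[n --> \oo] --> 0
}.

Definition initial_density (R : realType) (delta x0 x : R) : R :=
  (2 * delta)^-1 * \1_(`]x0 - delta, x0 + delta[) x.

Definition density_ratio (R : realType) (gamma eps : R) (rho : R -> R) (x : R)
    : R :=
  rho x / rho_inf gamma eps x.

(* [rho t x] solves the Fokker-Planck equation classically for t > 0.  As the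
   initial datum is discontinuous, it is attained in L^2(rho_inf dx), which is
   also the class in which the solution is unique.  The equation is written
   with the flux rho V' + eps rho', since its two terms need not be
   differentiable separately at 0. *)
Record fokker_planck_solution (R : realType) (gamma eps : R) (rho0 : R -> R)
    (rho : R -> R -> R) : Prop := FokkerPlanckSolution {
  fp_initial : rho 0 = rho0;
  fp_L2 : forall t : R, 0 <= t -> in_L2 gamma eps (density_ratio gamma eps (rho t));
  fp_continuous : forall t : R, 0 <= t ->
    norm2 gamma eps (density_ratio gamma eps (rho s) \-
                     density_ratio gamma eps (rho t))
      @[s --> within [set s | 0 <= s] (nbhs t)] --> 0;
  fp_derivable_t : forall t x : R, 0 < t -> derivable (rho^~ x) t 1;
  fp_continuous_t : forall t x : R, 0 < t ->
    {for (t, x), continuous (fun p : R * R => derive1 (rho^~ p.2) p.1)};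
  fp_derivable_x : forall t x : R, 0 < t -> derivable (rho t) x 1;
  fp_derivable_flux : forall t x : R, 0 < t ->
    derivable (fun y : R => rho t y * derive1 (potential gamma) y
                        + eps * derive1 (rho t) y) x 1;
  fp_equation : forall t x : R, 0 < t ->
    derive1 (rho^~ x) t =
    derive1 (fun y : R => rho t y * derive1 (potential gamma) y
                      + eps * derive1 (rho t) y) x
}.

Definition truncated_chi2 (R : realType) (gamma eps : R) (psi : nat -> R -> R)
    (n : nat) (rho : R -> R -> R) (t : R) : R :=
  Num.sqrt (\int[@lebesgue_measure R]_x
    (`|projection gamma eps psi n (density_ratio gamma eps (rho t)) x - 1| ^+ 2
     * rho_inf gamma eps x)).

Definition initial_moment (R : realType) (delta x0 : R) (psi : R -> R) : R :=
  \int[@lebesgue_measure R]_x (initial_density delta x0 x * psi x).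

(* [d eps t] is the distance.  For fixed r the time t_eps + r w_eps is
   nonnegative for small eps, so the values of [d eps] at negative times are
   irrelevant. *)
Definition profile_cutoff (R : realType) (d : R -> R -> R) (tc w p : R -> R)
    : Prop :=
  [/\ \forall eps \near 0^'+, 0 < tc eps /\ 0 < w eps,
      w eps / tc eps @[eps --> 0^'+] --> 0,
      forall r : R, d eps (tc eps + r * w eps) @[eps --> 0^'+] --> p r,
      p r @[r --> -oo] --> +oo &
      p r @[r --> +oo] --> 0].

Definition nonvanishing_at0 (R : realType) (psi : nat -> R -> R) (n : nat)
    : seq nat :=
  [seq j <- iota 1 n | psi j 0 != 0].

(* Main.v *)
Require Import Defs.
From mathcomp Require Import ring lra measurable_realfun.

(** Why the theorem holds.

    V is homogeneous of degree gamma + 1.  With s = eps^(1/(gamma + 1)) the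
    dilation x -> s x turns the problem at noise eps into the one at unit noise:
    the window is w = delta = s^(1 - gamma), the eigenvalues are lambda_k / w,
    and psi_(k,eps)(s x) = +- psi_k(x), because a spectral basis is unique up to
    signs ([spectral_uniqueness], [basis_scaling]).  The initial moment of
    psi_(k,eps) is therefore, up to sign, the mean M_k of psi_k over the interval
    of centre x0 / s and half-length s^(-gamma), both of which may be large.

    Every spectral coefficient of the solution decays like exp (- lambda_(k,eps) t)
    ([moment_evolution], [chi2_formula]).  At time t_eps + r w the square of the
    distance is thus the sum over k of
      exp (- 2 lambda_k r) M_k^2 |M_m|^(- 2 lambda_k / lambda_m),
    where m is the mode that defines t_eps.  The mode m gives the square of the
    profile, so that it remains to show, for the other modes that do not vanish,
      M_k^2 |M_m|^(- 2 lambda_k / lambda_m) -> 0 and |M_m| -> oo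
    ([cutoff_core]).  At first order psi_k behaves like
    exp (lambda_k x^(1 - gamma) / (1 - gamma)), for which that product is of
    order 1: the decision is made by the next order.

    The next order is obtained by a comparison.  For lambda_k < lambda_m the
    power |psi_m|^(lambda_k / lambda_m) is a strict subsolution of the equation
    of psi_k, with a defect proportional to (psi_m' / psi_m)^2, that is
    x^(-2 gamma).  If gamma <= 1/3 this defect is large enough for
    (lambda_k / lambda_m) psi_m' / psi_m - c / x still to bound psi_k' / psi_k
    from above, whence psi_k^2 |psi_m|^(- 2 lambda_k / lambda_m) = O(x^(- 2 c))
    ([ln_sqr_ratio]).  The bounds for logarithmic derivatives rest on
    [upper_barrier] and [lower_barrier]: a solution that crosses an upper barrier
    grows like exp V and is not square integrable, one that crosses a lower
    barrier vanishes further on.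

    If x0 is not 0, the half-length s^(-gamma) is exactly such that psi_k varies
    by a bounded factor over the interval ([edge_variation]), so that pointwise
    bounds carry over to means.  If x0 = 0, the modes with psi_k(0) = 0 are odd
    and have mean 0, the others are even, and integration multiplies psi_k by
    x^gamma up to constants ([primitive_bounds]).

    No decay of eigenfunctions or solutions is given beyond square
    integrability.  Orthogonality of eigenfunctions and the evolution of the
    coefficients are both derived from Green's identity with a cutoff on [-r, r]
    ([cutoff_bound]); its error is of order r^(gamma - 1) as soon as the
    derivatives of the eigenfunctions are square integrable, which the bounds on
    logarithmic derivatives provide ([derive1_in_L2]). *)

Set Implicit Arguments.
Unset Strict Implicit.
Unset Printing Implicit Defensive.

(** * Calculus on the line *)

Section calculus.
Context {R : realType}.
Implicit Types (f g : R -> R) (x y a b c : R).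

Lemma eq_ler a b : a = b -> a <= b.
Proof. by move=> ->. Qed.

Lemma derD f g x a b : is_derive x 1 f a -> is_derive x 1 g b ->
  is_derive x 1 (fun y => f y + g y) (a + b).
Proof. exact: is_deriveD. Qed.

Lemma derN f x a : is_derive x 1 f a -> is_derive x 1 (fun y => - f y) (- a).
Proof. exact: is_deriveN. Qed.

Lemma derB f g x a b : is_derive x 1 f a -> is_derive x 1 g b ->
  is_derive x 1 (fun y => f y - g y) (a - b).
Proof. exact: is_deriveB. Qed.

Lemma derM f g x a b : is_derive x 1 f a -> is_derive x 1 g b ->
  is_derive x 1 (fun y => f y * g y) (a * g x + f x * b).
Proof.
move=> df dg; apply: is_derive_eq (is_deriveM df dg) _.
by rewrite /GRing.scale /= addrC mulrC.
Qed.

Lemma derC c x : is_derive x 1 (fun=> c) 0.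
Proof. exact: is_derive_cst. Qed.

Lemma derX x : is_derive x 1 (fun y => y) 1.
Proof. exact: is_derive_id. Qed.

Lemma derV f x a : f x != 0 -> is_derive x 1 f a ->
  is_derive x 1 (fun y => (f y)^-1) (- a / f x ^+ 2).
Proof.
move=> f0 df; apply: is_derive_eq (is_deriveV f0 df) _.
by rewrite /GRing.scale /= mulNr mulNr mulrC.
Qed.

Lemma der_expR f x a : is_derive x 1 f a ->
  is_derive x 1 (fun y => expR (f y)) (expR (f x) * a).
Proof. by move=> df; exact: (is_derive1_comp (f := expR)). Qed.

Lemma der_ln f x a : 0 < f x -> is_derive x 1 f a ->
  is_derive x 1 (fun y => ln (f y)) ((f x)^-1 * a).
Proof.
move=> f0 df; apply: (is_derive1_comp (f := @ln R)).
exact: is_derive1_ln.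
Qed.

Lemma der_powR p x : 0 < x -> is_derive x 1 (fun y => y `^ p) (p * x `^ (p - 1)).
Proof. exact: is_derive1_powR. Qed.

Lemma der_sqr f x a : is_derive x 1 f a ->
  is_derive x 1 (fun y => f y ^+ 2) (2 * f x * a).
Proof.
move=> df; rewrite (_ : (fun _ => _) = fun y => f y * f y); last first.
  by apply/funext => y; rewrite expr2.
apply: (is_derive_eq (derM df df)); ring.
Qed.

Lemma der_comp f g x a b : is_derive (g x) 1 f a -> is_derive x 1 g b ->
  is_derive x 1 (fun y => f (g y)) (a * b).
Proof. exact: is_derive1_comp. Qed.

Lemma der_cont f x a : is_derive x 1 f a -> {for x, continuous f}.
Proof.
by move=> df; apply/differentiable_continuous/derivable1_diffP; exact: ex_derive.
Qed.

Lemma der_derivable f x a : is_derive x 1 f a -> derivable f x 1.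
Proof. by case. Qed.

Lemma der_unique f x a b : is_derive x 1 f a -> is_derive x 1 f b -> a = b.
Proof. by move=> [_ <-] [_ <-]. Qed.

Lemma mvt f (df : R -> R) a b : a <= b ->
  (forall x, a <= x <= b -> is_derive x 1 f (df x)) ->
  exists2 c, a <= c <= b & f b - f a = df c * (b - a).
Proof.
move=> ab d.
have [x|x|c] := @MVT_segment R f df a b ab.
- by rewrite in_itv/= => /andP[/ltW ax /ltW xb]; apply: d; rewrite ax.
- apply: continuous_in_subspaceT => {}x; rewrite inE/= in_itv/= => xab.
  by apply: der_cont; exact: d.
- by rewrite in_itv/= => cab e; exists c.
Qed.

Lemma der_ge0_le f (df : R -> R) a b : a <= b ->
  (forall x, a <= x <= b -> is_derive x 1 f (df x)) ->
  (forall x, a <= x <= b -> 0 <= df x) -> f a <= f b.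
Proof.
move=> ab d df0; have [c cab e] := mvt ab d.
by rewrite -subr_ge0 e mulr_ge0 ?subr_ge0// df0.
Qed.

Lemma der_le0_ge f (df : R -> R) a b : a <= b ->
  (forall x, a <= x <= b -> is_derive x 1 f (df x)) ->
  (forall x, a <= x <= b -> df x <= 0) -> f b <= f a.
Proof.
move=> ab d df0; have [c cab e] := mvt ab d.
by rewrite -subr_le0 e mulr_le0_ge0 ?subr_ge0// df0.
Qed.

Lemma powR_large p c : 0 < p -> exists2 a : R, 1 <= a &
  forall x, a <= x -> c <= x `^ p.
Proof.
move=> p0; exists (Num.max 1 (`|c| `^ p^-1)); first by rewrite le_max lexx.
move=> x; rewrite ge_max => /andP[x1 cx].
apply: (le_trans (ler_norm c)).
rewrite -[leLHS]powRr1// -(@mulVf _ p) ?gt_eqF// powRrM.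
by apply: ge0_ler_powR; rewrite ?nnegrE ?powR_ge0// ?(ltW p0)// (le_trans _ x1).
Qed.

Lemma powR_le1 p x : 1 <= x -> p <= 0 -> x `^ p <= 1.
Proof. by move=> x1 p0; rewrite -(powRr0 x); exact: ler_powR. Qed.

Lemma powR_Dgt0 x p q : 0 < x -> x `^ (p + q) = x `^ p * x `^ q.
Proof. by move=> x0; rewrite powRD// (gt_eqF x0) implybT. Qed.

End calculus.

(** Differentiates an expression by structural recursion, leaving the value of
    the derivative as an equation and the side conditions of the quotient,
    logarithm and power rules as further goals.  Instance resolution is kept
    off, as it would answer with unfolded pointwise operations. *)
Ltac der_step := first
  [ eassumption
  | notypeclasses refine (derC _ _) | notypeclasses refine (derX _)
  | notypeclasses refine (derD _ _) | notypeclasses refine (derB _ _)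
  | notypeclasses refine (derN _)
  | notypeclasses refine (der_expR _) | notypeclasses refine (der_sqr _)
  | notypeclasses refine (der_ln _ _) | notypeclasses refine (derV _ _)
  | notypeclasses refine (der_powR _ _) | notypeclasses refine (derM _ _) ].

Ltac der := notypeclasses refine (is_derive_eq _ _); [ repeat der_step | cbv beta ].

(** * The potential and the eigenvalue equation *)

Section potential.
Context {R : realType}.
Variable gamma : R.
Hypothesis gamma0 : 0 < gamma.
Implicit Types (x y a : R) (u : R -> R).

Let gamma10 : 0 < gamma + 1.
Proof. by rewrite addr_gt0. Qed.

(** The derivative V' of the potential, in closed form. *)
Definition force (x : R) : R := Num.sg x * `|x| `^ gamma.

Lemma force_gt0 x : 0 < x -> force x = x `^ gamma.
Proof. by move=> x0; rewrite /force gtr0_sg// mul1r gtr0_norm. Qed.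

Lemma forceN x : force (- x) = - force x.
Proof. by rewrite /force sgrN normrN mulNr. Qed.

Lemma norm_force x : `|force x| = `|x| `^ gamma.
Proof.
rewrite /force normrM normr_sg ger0_norm ?powR_ge0//.
have [->|x0] := eqVneq x 0; last by rewrite mul1r.
by rewrite normr0 powR0 ?gt_eqF// mul0r.
Qed.

Lemma potentialN x : potential gamma (- x) = potential gamma x.
Proof. by rewrite /potential normrN. Qed.

Lemma potential_gt0E x : 0 < x ->
  potential gamma x = (gamma + 1)^-1 * x `^ (gamma + 1).
Proof. by move=> x0; rewrite /potential gtr0_norm. Qed.

Lemma powR_cvg_at0 : `|x| `^ gamma @[x --> (0 : R)] --> (0 : R).
Proof.
apply/cvgrPdist_lt => e e0; near=> x.
rewrite sub0r normrN ger0_norm ?powR_ge0//.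
have -> : e = (e `^ gamma^-1) `^ gamma.
  by rewrite -powRrM mulVf ?gt_eqF// powRr1// ltW.
apply: gt0_ltr_powR => //; rewrite ?nnegrE ?powR_ge0//.
near: x; apply: (@cvgr0_norm_lt _ _ _ _ _ id) => //; exact: powR_gt0.
Unshelve. all: by end_near. Qed.

Lemma der_potential_gt0 x : 0 < x ->
  is_derive x 1 (potential gamma) (force x).
Proof.
move=> x0; apply: (@near_eq_is_derive _ _ _
    (fun y => (gamma + 1)^-1 * y `^ (gamma + 1))).
  near=> y; rewrite potential_gt0E//.
  by near: y; exact: lt_nbhsr.
der => //; rewrite force_gt0// mul0r add0r addrK mulrA mulVf ?mul1r//.
by rewrite gt_eqF.
Unshelve. all: by end_near. Qed.

Lemma der_potential x : is_derive x 1 (potential gamma) (force x).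
Proof.
have [x0|x0|->] := ltgtP x 0.
- have /der_potential_gt0 d : 0 < - x by rewrite oppr_gt0.
  rewrite (_ : potential gamma = fun y => potential gamma (- y)); last first.
    by apply/funext => y; rewrite potentialN.
  apply: is_derive_eq (der_comp d (derN (derX x))) _.
  by rewrite forceN mulrN1 opprK.
- exact: der_potential_gt0.
- have -> : force 0 = 0 by rewrite /force sgr0 mul0r.
  (* at the origin the difference quotient is of order |h|^gamma *)
  have cv : h^-1 *: ((potential gamma \o shift 0) (h *: 1) - potential gamma 0)
      @[h --> 0^'] --> (0 : R).
    apply/cvgrPdist_lt => e e0; near=> h.
    have h0 : h != 0 by near: h; exact: nbhs_dnbhs_neq.
    rewrite sub0r normrN /= addr0 /GRing.scale/= mulr1.
    rewrite /potential normr0 powR0 ?gt_eqF// mulr0 subr0.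
    rewrite powR_Dgt0 ?normr_gt0// powRr1// !normrM normfV normr_id.
    rewrite (ger0_norm (powR_ge0 _ _)).
    rewrite [ltLHS](_ : _ = `|(gamma + 1)^-1| * `|h| `^ gamma); last first.
      by field; rewrite normr_eq0.
    apply: (@le_lt_trans _ _ (`|h| `^ gamma)).
      rewrite ler_piMl ?powR_ge0// ger0_norm; last by rewrite invr_ge0 ltW.
      by rewrite invf_le1// lerDr ltW.
    near: h; apply: cvg_within.
    have /cvgrPdist_lt/(_ _ e0) := powR_cvg_at0.
    apply: filterS => h; rewrite sub0r normrN ger0_norm// powR_ge0//.
  apply: DeriveDef; first by apply/cvg_ex; exists 0.
  exact: cvg_lim cv.
Unshelve. all: by end_near. Qed.

Lemma derive1_potential : derive1 (potential gamma) = force.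
Proof.
by apply/funext => x; rewrite derive1E; have [_ ->] := der_potential x.
Qed.

Lemma continuous_force : continuous force.
Proof.
have pos x : 0 < x -> {for x, continuous force}.
  move=> x0; have c : {for x, continuous (fun y => y `^ gamma)}.
    by apply: der_cont; exact: der_powR.
  rewrite /prop_for /continuous_at force_gt0//.
  apply: cvg_trans c; apply: near_eq_cvg.
  near=> y; rewrite force_gt0//; near: y; exact: lt_nbhsr.
move=> x; have [x0|/pos//|->] := ltgtP x 0.
- have /pos c : 0 < - x by rewrite oppr_gt0.
  rewrite /continuous_at -[force x]opprK -forceN.
  rewrite [X in X @ _](_ : _ = fun y => - force (- y)); last first.
    by apply/funext => y; rewrite forceN opprK.
  apply: cvgN; apply: (@cvg_comp _ _ _ -%R force _ _ _ _ c); exact: opp_continuous.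
- rewrite /continuous_at (_ : force 0 = 0); last by rewrite /force sgr0 mul0r.
  apply: norm_cvg0.
  under eq_fun do rewrite norm_force.
  exact: powR_cvg_at0.
Unshelve. all: by end_near. Qed.

Lemma potentialZ a x :
  potential gamma (a * x) = `|a| `^ (gamma + 1) * potential gamma x.
Proof. by rewrite /potential normrM powRM// mulrCA. Qed.

Lemma forceZ a x : force (a * x) = Num.sg a * `|a| `^ gamma * force x.
Proof. by rewrite /force normrM powRM// sgrM; ring. Qed.

(** The equation eps u'' - V' u' + lambda u = 0 as a first order system, [u1]
    being the derivative of [u]. *)
Definition solves (eps lambda : R) (u u1 : R -> R) : Prop :=
  (forall x, is_derive x 1 u (u1 x)) /\
  (forall x, is_derive x 1 u1 (eps^-1 * (force x * u1 x - lambda * u x))).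

Lemma eigenfunction_solves eps lambda u : 0 < eps ->
  eigenfunction gamma eps lambda u -> solves eps lambda u (derive1 u).
Proof.
move=> eps0 [_ _ d1 d2 e]; split=> x.
  by rewrite derive1E; exact: derivableP.
apply: DeriveDef => //; rewrite -derive1E; move: (e x).
rewrite /generator derive1_potential => <-.
by field; rewrite gt_eqF.
Qed.

Lemma solves_cont eps lambda u u1 : solves eps lambda u u1 ->
  continuous u /\ continuous u1.
Proof.
move=> [d1 d2]; split=> x; first exact: der_cont (d1 x).
exact: der_cont (d2 x).
Qed.

Lemma solves_reflect eps lambda u u1 : solves eps lambda u u1 ->
  solves eps lambda (fun x => u (- x)) (fun x => - u1 (- x)).
Proof.
move=> [d1 d2]; split=> x.
  apply: (is_derive_eq (der_comp (d1 _) (derN (derX x)))); by rewrite mulrN1.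
apply: is_derive_eq (derN (der_comp (d2 _) (derN (derX x)))) _.
by rewrite forceN; ring.
Qed.

(** Cauchy uniqueness to the right of a point: the energy u^2 + u'^2 grows at
    most exponentially on bounded intervals, since V' is bounded there. *)
Lemma solves_unique_right eps lambda u u1 a b : solves eps lambda u u1 ->
  u a = 0 -> u1 a = 0 -> a <= b -> u b = 0.
Proof.
move=> [d1 d2] ua u1a ab.
have [M M0 HM] : exists2 M : R, 0 <= M & forall x, a <= x <= b -> `|force x| <= M.
  have [c _ hc] := @EVT_max R (fun x => `|force x|) a b ab (fun x =>
    @continuous_subspaceT _ _ _ (fun x => `|force x|) (fun x =>
      @continuous_comp _ _ _ force Num.norm x (@continuous_force x)
       (@norm_continuous _ _ _)) x).
  by exists `|force c| => // x xab; apply: hc; rewrite in_itv.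
pose e : R := `|eps^-1|; pose L : R := `|lambda|.
pose K := 1 + e * (2 * M + L).
have e0 : 0 <= e by exact: normr_ge0.
have L0 : 0 <= L by exact: normr_ge0.
pose E x := (u x ^+ 2 + u1 x ^+ 2) * expR (- (K * x)).
have EC : E b <= E a.
  apply: (@der_le0_ge _ _ (fun x => (2 * u x * u1 x +
      2 * u1 x * (eps^-1 * (force x * u1 x - lambda * u x)) -
      K * (u x ^+ 2 + u1 x ^+ 2)) * expR (- (K * x)))) => // x xab.
    have ? := d1 x; have ? := d2 x.
    by rewrite /E; der; ring.
  apply: mulr_le0_ge0; last exact: expR_ge0.
  rewrite subr_le0 /K.
  have Hf : `|force x| <= M by exact: HM.
  set S := u x ^+ 2 + u1 x ^+ 2.
  have uu : 2 * (`|u x| * `|u1 x|) <= S.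
    rewrite /S -(real_normK (num_real (u x))) -(real_normK (num_real (u1 x))).
    have := sqr_ge0 (`|u x| - `|u1 x|); lra.
  have H1 : 2 * u x * u1 x <= S.
    by apply: le_trans uu; rewrite -mulrA ler_pM2l// -normrM ler_norm.
  have H2 : `|u1 x * (force x * u1 x)| <= M * S.
    rewrite normrM (normrM (force x)) mulrCA; apply: ler_pM; rewrite ?normr_ge0//;
      rewrite ?mulr_ge0//.
    by rewrite -expr2 real_normK ?num_real// lerDr sqr_ge0.
  have H3 : `|2 * (u1 x * (lambda * u x))| <= L * S.
    apply: le_trans (ler_wpM2l L0 uu).
    by rewrite !normrM (@gtr0_norm _ 2)// /L; apply: eq_ler; ring.
  have H4 : `|2 * (u1 x * (force x * u1 x)) - 2 * (u1 x * (lambda * u x))| <=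
      (2 * M + L) * S.
    apply: (le_trans (ler_normB _ _)); rewrite [leRHS]mulrDl.
    apply: lerD => //.
    by rewrite normrM gtr0_norm// -mulrA ler_pM2l.
  have H5 : 2 * u1 x * (eps^-1 * (force x * u1 x - lambda * u x)) <=
      e * ((2 * M + L) * S).
    apply: (le_trans (ler_norm _)); apply: le_trans (ler_wpM2l e0 H4).
    by rewrite /e -normrM; apply: eq_ler; congr (`| _ |); ring.
  rewrite mulrDl mul1r -mulrA; lra.
have : E b = 0.
  apply/eqP; rewrite eq_le (le_trans EC) ?mulr_ge0 ?addr_ge0 ?sqr_ge0 ?expR_ge0//.
  by rewrite /E ua u1a expr0n/= addr0 mul0r.
move/eqP; rewrite mulf_eq0 (gt_eqF (expR_gt0 _)) orbF.
by rewrite paddr_eq0 ?sqr_ge0// sqrf_eq0 => /andP[/eqP].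
Qed.

Lemma solves_unique eps lambda u u1 a : solves eps lambda u u1 ->
  u a = 0 -> u1 a = 0 -> forall x, u x = 0.
Proof.
move=> s ua u1a x; have [ax|/ltW xa] := leP a x.
  exact: solves_unique_right s ua u1a ax.
have := @solves_unique_right _ _ _ _ (- a) (- x) (solves_reflect s).
by rewrite !opprK lerN2 u1a oppr0; apply.
Qed.

End potential.

(** * Barriers for the logarithmic derivative *)

Section half_line.
Context {R : realType}.
Variables (gamma lambda : R) (u u1 : R -> R).
Implicit Types x y : R.
Hypothesis gamma0 : 0 < gamma.
Hypothesis gamma1 : gamma < 1.
Hypothesis lambda0 : 0 < lambda.
Hypothesis sol : solves gamma 1 lambda u u1.
Hypothesis nontriv : exists x, u x != 0.

Local Notation V := (potential gamma).

(** Solutions of the eigenvalue equation either grow slowly or like e^V up to a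
    power of x; the latter fail to be square integrable already because
    x^(-gamma) is not integrable at infinity. *)
Definition slow_growth (v : R -> R) : Prop := forall c a : R, 0 < c -> 1 <= a ->
  ~ (forall x, a <= x -> c * x `^ (- gamma) * expR (V x) <= v x ^+ 2).

Hypothesis slow : slow_growth u.

Let d1 x : is_derive x 1 u (u1 x). Proof. exact: sol.1. Qed.

Let d2 x : 0 < x -> is_derive x 1 u1 (x `^ gamma * u1 x - lambda * u x).
Proof.
by move=> x0; have := sol.2 x; rewrite invr1 mul1r force_gt0.
Qed.

Let dV x : 0 < x -> is_derive x 1 V (x `^ gamma).
Proof. by move=> x0; have := der_potential_gt0 gamma0 x0; rewrite force_gt0. Qed.

(** Where [beta] satisfies beta' + beta^2 <= V' beta - lambda, the quantity
    P = u u' - beta u^2 satisfies P' >= V' P.  If P were positive somewhere it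
    would grow like e^V, and so would u^2, up to a power of x. *)
Lemma upper_barrier (beta dbeta : R -> R) A : 1 <= A ->
  (forall x, A <= x -> is_derive x 1 beta (dbeta x)) ->
  (forall x, A <= x -> 0 <= beta x) ->
  (forall x, A <= x ->
     dbeta x + beta x ^+ 2 <= x `^ gamma * beta x - lambda) ->
  forall x, A <= x -> u x * u1 x <= beta x * u x ^+ 2.
Proof.
move=> A1 db b0 Hb x1 Ax1; rewrite leNgt; apply/negP => H.
have x10 : 0 < x1 by lra.
pose P x := u x * u1 x - beta x * u x ^+ 2.
have P1 : 0 < P x1 by rewrite subr_gt0.
pose E x := P x * expR (- V x).
have EP x : x1 <= x -> P x1 * expR (- V x1) * expR (V x) <= P x.
  move=> x1x.
  suff : E x1 <= E x by rewrite -(ler_pM2r (expR_gt0 (V x))) /E -(mulrA (P x))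
    -expRD addNr expR0 mulr1.
  pose dE y := (u1 y * u1 y + u y * (y `^ gamma * u1 y - lambda * u y)
    - (dbeta y * u y ^+ 2 + beta y * (2 * u y * u1 y))
    - y `^ gamma * P y) * expR (- V y).
  apply: (@der_ge0_le _ _ dE) => // y /andP[x1y _].
    have y0 : 0 < y by lra.
    have ? := d1 y; have ? := d2 y0; have ? := dV y0.
    have ? := db y (le_trans Ax1 x1y).
    by rewrite /E /P; der; rewrite /dE /P; ring.
  rewrite mulr_ge0 ?expR_ge0//.
  have := Hb _ (le_trans Ax1 x1y) => /(ler_wpM2r (sqr_ge0 (u y))).
  by have := sqr_ge0 (u1 y - beta y * u y); rewrite /P; lra.
pose c := P x1 * expR (- V x1).
have c0 : 0 < c by rewrite mulr_gt0 ?expR_gt0.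
have ux1 : 0 < u x1 ^+ 2.
  rewrite lt0r sqr_ge0 andbT sqrf_eq0; apply/eqP => u0.
  by move: P1; rewrite /P u0 expr0n mul0r mulr0 subr0 ltxx.
pose k := Num.min (2 * c) (u x1 ^+ 2 / (x1 `^ (- gamma) * expR (V x1))).
have k0 : 0 < k.
  rewrite lt_min mulr_gt0//= divr_gt0// mulr_gt0 ?expR_gt0//.
  exact: powR_gt0.
apply: (slow k0 (le_trans A1 Ax1)) => x x1x.
suff : u x1 ^+ 2 - k * (x1 `^ (- gamma) * expR (V x1)) <=
    u x ^+ 2 - k * (x `^ (- gamma) * expR (V x)).
  rewrite -mulrA -[_ <= u x ^+ 2]subr_ge0; apply: le_trans.
  rewrite subr_ge0 -ler_pdivlMr ?ge_min ?lexx ?orbT//.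
  by rewrite mulr_gt0 ?expR_gt0//; exact: powR_gt0.
pose dG y := 2 * u y * u1 y - k * (- gamma * y `^ (- gamma - 1) * expR (V y)
  + y `^ (- gamma) * (expR (V y) * y `^ gamma)).
apply: (@der_ge0_le _ (fun y => u y ^+ 2 - k * (y `^ (- gamma) * expR (V y))) dG)
  => // y /andP[x1y _].
  have y0 : 0 < y by lra.
  have ? := d1 y; have ? := dV y0.
  by der => //; rewrite /dG; ring.
have y0 : 0 < y by lra.
have e0 := expR_gt0 (V y).
have yy : y `^ (- gamma) * y `^ gamma = 1.
  by rewrite -powR_Dgt0// addNr powRr0.
have kc : k <= 2 * c by rewrite ge_min lexx.
have bu : 0 <= beta y * u y ^+ 2.
  by rewrite mulr_ge0 ?sqr_ge0// b0// (le_trans Ax1).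
have := EP y x1y; rewrite -/c /P => EPy.
have kce : k * expR (V y) <= 2 * c * expR (V y) by rewrite ler_pM2r.
have kg : 0 <= k * (gamma * y `^ (- gamma - 1) * expR (V y)).
  by rewrite !mulr_ge0 ?powR_ge0 ?expR_ge0// ltW.
rewrite /dG (mulrCA _ (expR _)) yy; lra.
Qed.

Lemma upper_crude : exists2 A, 1 <= A & forall x, A <= x ->
  u x * u1 x <= 2 * lambda * x `^ (- gamma) * u x ^+ 2.
Proof.
have [A A1 HA] := @powR_large R (2 * gamma) (4 * lambda) (mulr_gt0 (ltr0Sn R 1) gamma0).
exists A => // x Ax; apply: (@upper_barrier (fun x => 2 * lambda * x `^ (- gamma))
  (fun x => 2 * lambda * (- gamma * x `^ (- gamma - 1))) A) => // {Ax}x Ax.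
- have x0 : 0 < x by lra.
  by der => //; ring.
- by rewrite !mulr_ge0 ?powR_ge0// ltW.
- have x0 : 0 < x by lra.
  have yy : x `^ gamma * x `^ (- gamma) = 1 by rewrite -powR_Dgt0// addrN powRr0.
  have y2 : x `^ (2 * gamma) * x `^ (- gamma) ^+ 2 = 1.
    by rewrite mulrDl mul1r powR_Dgt0// expr2 mulrACA yy mulr1.
  have H := HA _ Ax.
  have : 4 * lambda * x `^ (- gamma) ^+ 2 <= 1.
    by rewrite -[leRHS]y2 ler_wpM2r// sqr_ge0.
  move=> /(ler_wpM2l (ltW lambda0)).
  have : 0 <= lambda * (gamma * x `^ (- gamma - 1)).
    by rewrite !mulr_ge0 ?powR_ge0// ltW.
  by rewrite (mulrCA (x `^ gamma)) yy; lra.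
Qed.

(** With an admissible barrier, P = u u' - beta u^2 is nonpositive far out and
    vanishes at the zeros of u, where P' = u'^2.  At such a maximum of P both u
    and u' are 0, which Cauchy uniqueness forbids. *)
Lemma eventually_nonzero : exists2 A, 1 <= A & forall x, A <= x -> u x != 0.
Proof.
have [A A1 HA] := upper_crude.
exists (A + 1); first lra.
move=> x Ax; apply/eqP => ux0.
have x0 : 0 < x by lra.
pose P y := u y * u1 y - 2 * lambda * y `^ (- gamma) * u y ^+ 2.
have dP y : 0 < y -> is_derive y 1 P
   (u1 y * u1 y + u y * (y `^ gamma * u1 y - lambda * u y)
    - (2 * lambda * (- gamma * y `^ (- gamma - 1)) * u y ^+ 2
       + 2 * lambda * y `^ (- gamma) * (2 * u y * u1 y))).
  move=> y0; have ? := d1 y; have ? := d2 y0.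
  by rewrite /P; der => //; ring.
have : is_derive x 1 P 0.
  apply: (@derive1_at_max _ _ A (x + 1)).
  - lra.
  - move=> y; rewrite in_itv/= => /andP[Ay _].
    have y0 : 0 < y by lra.
    exact: der_derivable (dP y y0).
  - by rewrite in_itv/=; apply/andP; split; lra.
  - move=> y; rewrite in_itv/= => /andP[/ltW Ay _].
    rewrite /P ux0 expr0n/= mul0r mulr0 subr0 subr_le0; exact: HA.
have dPx := dP x x0.
move=> dPx0; have : u1 x = 0.
  have := der_unique dPx dPx0.
  rewrite ux0 expr0n/= !(mul0r, mulr0) !addr0 subr0 => /eqP.
  by rewrite mulf_eq0 orbb => /eqP.
move=> u10; have [z] := nontriv.
by rewrite (solves_unique gamma0 sol ux0 u10) eqxx.
Qed.

(** With alpha = lambda / V' and S' = alpha, the function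
    q = e^(2S - V) (u'/u - alpha) satisfies q' <= - q^2 far out; if q were
    negative somewhere, 1/q would reach 0 in finite time. *)
Lemma lower_barrier : exists2 A, 1 <= A & forall x, A <= x ->
  lambda * x `^ (- gamma) * u x ^+ 2 <= u x * u1 x.
Proof.
have [A0 A01 HA0] := eventually_nonzero.
have g1 : 0 < 1 - gamma by rewrite subr_gt0.
have [B B1 HB] := @powR_large R (1 - gamma) (gamma / lambda) g1.
have [D D1 HD] := @powR_large R (2 * gamma)
  (2 * lambda * (gamma + 1) / (1 - gamma)) (mulr_gt0 (ltr0Sn R 1) gamma0).
pose A := Num.max A0 (Num.max B D).
exists A; first by rewrite le_max A01.
move=> x1; rewrite !ge_max => /and3P[A0x1 Bx1 Dx1].
pose al (x : R) := lambda * x `^ (- gamma).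
pose S (x : R) := lambda / (1 - gamma) * x `^ (1 - gamma).
pose W x := 2 * S x - V x.
have xpos x : x1 <= x -> 0 < x by move=> ?; lra.
have dS x : x1 <= x -> is_derive x 1 S (al x).
  move=> /xpos x0; rewrite /S; der => //; rewrite mul0r add0r /al.
  rewrite (_ : 1 - gamma - 1 = - gamma); last by ring.
  by field; rewrite gt_eqF.
have dW x : x1 <= x -> is_derive x 1 W (2 * al x - x `^ gamma).
  move=> x1x; have ? := dS _ x1x; have ? := dV (xpos _ x1x).
  by rewrite /W; der; ring.
have W0 x : x1 <= x -> W x <= 0.
  move=> x1x; have x0 := xpos _ x1x; rewrite /W subr_le0 potential_gt0E//.
  rewrite (_ : gamma + 1 = 1 - gamma + 2 * gamma); last by ring.
  rewrite powR_Dgt0// /S.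
  have h := HD x (le_trans Dx1 x1x).
  have gp : 0 < gamma + 1 by have := gamma0; lra.
  have h2 : 2 * lambda * (gamma + 1) <= x `^ (2 * gamma) * (1 - gamma).
    by rewrite -ler_pdivrMr.
  set a := x `^ (1 - gamma); set b := x `^ (2 * gamma).
  have -> : 2 * (lambda / (1 - gamma) * a) =
      (gamma + 1)^-1 / (1 - gamma) * (a * (2 * lambda * (gamma + 1))).
    by field; rewrite !gt_eqF.
  rewrite (_ : 1 - gamma + 2 * gamma = gamma + 1); last by ring.
  have -> : (gamma + 1)^-1 * (a * b) =
      (gamma + 1)^-1 / (1 - gamma) * (a * (b * (1 - gamma))).
    by field; rewrite !gt_eqF.
  rewrite ler_wpM2l ?divr_ge0 ?invr_ge0 ?(ltW gp) ?(ltW g1)//.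
  by rewrite ler_wpM2l// powR_ge0.
rewrite -subr_ge0 leNgt; apply/negP => neg.
have u0 x : x1 <= x -> u x != 0 by move=> ?; apply: HA0; lra.
pose q x := expR (W x) * (u1 x / u x - al x).
pose dq x := expR (W x) * ((2 * al x - x `^ gamma) * (u1 x / u x - al x)
  + (x `^ gamma * u1 x - lambda * u x) / u x - (u1 x / u x) ^+ 2
  - lambda * (- gamma * x `^ (- gamma - 1))).
have der_q x : x1 <= x -> is_derive x 1 q (dq x).
  move=> x1x; have x0 := xpos _ x1x; have ? := dW _ x1x.
  have ? := d1 x; have ? := d2 x0; have ux0 := u0 _ x1x.
  rewrite /q /al; der => //; rewrite /dq /al; field.
  by rewrite ux0.
have dq_le x : x1 <= x -> dq x <= - q x ^+ 2.
  move=> x1x; have x0 := xpos _ x1x; have ux0 := u0 _ x1x.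
  set r := u1 x / u x - al x.
  have yy : x `^ gamma * x `^ (- gamma) = 1 by rewrite -powR_Dgt0// addrN powRr0.
  have -> : dq x = expR (W x) * (- r ^+ 2 - al x ^+ 2 + x `^ gamma * al x - lambda +
     lambda * (gamma * x `^ (- gamma - 1))).
    by rewrite /dq /r; field; rewrite ux0.
  have -> : x `^ gamma * al x = lambda by rewrite /al mulrCA yy mulr1.
  have h : lambda * (gamma * x `^ (- gamma - 1)) <= al x ^+ 2.
    have hb := HB x (le_trans Bx1 x1x).
    have e : x `^ (- gamma) ^+ 2 = x `^ (1 - gamma) * x `^ (- gamma - 1).
      by rewrite expr2 -!powR_Dgt0//; congr (_ `^ _); ring.
    rewrite /al exprMn e expr2 -mulrA ler_pM2l// mulrA ler_wpM2r ?powR_ge0//.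
    by rewrite mulrC -ler_pdivrMr.
  rewrite /q -/r.
  apply: (@le_trans _ _ (expR (W x) * - r ^+ 2)).
    by rewrite ler_pM2l ?expR_gt0//; lra.
  rewrite exprMn mulrN lerN2 ler_wpM2r ?sqr_ge0// expr2 ler_piMl ?expR_ge0//.
  by rewrite -expR0 ler_expR W0.
have q1 : q x1 < 0.
  rewrite /q pmulr_rlt0 ?expR_gt0//.
  have ux0 := u0 _ (lexx x1).
  have : 0 < u x1 ^+ 2 by rewrite lt0r sqr_ge0 sqrf_eq0 ux0.
  move=> h; rewrite -(pmulr_llt0 _ h).
  have -> : (u1 x1 / u x1 - al x1) * u x1 ^+ 2 =
      u x1 * u1 x1 - lambda * x1 `^ (- gamma) * u x1 ^+ 2.
    by rewrite /al; field.
  by [].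
have qn x : x1 <= x -> q x < 0.
  move=> x1x; apply: le_lt_trans q1.
  apply: (@der_le0_ge _ q dq x1 x x1x) => y /andP[x1y _]; first exact: der_q.
  by apply: (le_trans (dq_le _ x1y)); rewrite oppr_le0 sqr_ge0.
pose x2 := x1 - (q x1)^-1.
have iq1 : (q x1)^-1 < 0 by rewrite invr_lt0.
have x12 : x1 <= x2 by rewrite /x2; lra.
have : (q x1)^-1 - x1 <= (q x2)^-1 - x2.
  apply: (@der_ge0_le _ (fun x => (q x)^-1 - x) (fun x => - dq x / q x ^+ 2 - 1))
    => // y /andP[x1y _]; have qy := qn _ x1y; have ? := der_q _ x1y.
    by der => //; rewrite lt_eqF.
  rewrite subr_ge0 ler_pdivlMr; last by rewrite lt0r sqr_ge0 sqrf_eq0 lt_eqF.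
  by rewrite mul1r lerNr dq_le.
have : (q x2)^-1 < 0 by rewrite invr_lt0 qn.
rewrite {1 3}/x2; lra.
Qed.

End half_line.

(** * Growth of square integrable eigenfunctions *)

Section slow_solutions.
Context {R : realType}.
Variable gamma : R.
Implicit Types (x y : R) (u v : R -> R).
Hypothesis gamma0 : 0 < gamma.
Hypothesis gamma1 : gamma < 1.

Definition slow_solution (lambda : R) u u1 : Prop :=
  [/\ solves gamma 1 lambda u u1, exists x, u x != 0 & slow_growth gamma u].

Lemma log_derivative_bounds lambda u u1 : 0 < lambda ->
  slow_solution lambda u u1 ->
  exists2 A, 1 <= A & forall x, A <= x ->
    [/\ u x != 0, lambda * x `^ (- gamma) <= u1 x / u x &
        u1 x / u x <= 2 * lambda * x `^ (- gamma)].
Proof.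
move=> l0 [s nt sl].
have [A A1 HA] := eventually_nonzero gamma0 l0 s nt sl.
have [B B1 HB] := lower_barrier gamma0 gamma1 l0 s nt sl.
have [D D1 HD] := upper_crude gamma0 l0 s sl.
exists (Num.max A (Num.max B D)); first by rewrite le_max A1.
move=> x; rewrite !ge_max => /and3P[Ax Bx Dx].
have ux := HA _ Ax; have u2 : 0 < u x ^+ 2 by rewrite lt0r sqr_ge0 sqrf_eq0 ux.
have e : u1 x / u x = u x * u1 x / u x ^+ 2 by field.
split=> //; first by rewrite e ler_pdivlMr// HB.
by rewrite e ler_pdivrMr// HD.
Qed.

Lemma der_ln_sqr u (a : R) x : u x != 0 -> is_derive x 1 u a ->
  is_derive x 1 (fun y => ln (u y ^+ 2)) (2 * (a / u x)).
Proof.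
move=> ux d; have u2 : 0 < u x ^+ 2 by rewrite lt0r sqr_ge0 sqrf_eq0 ux.
by der => //; field.
Qed.

Lemma ln_sqr_variation lambda u u1 : 0 < lambda -> slow_solution lambda u u1 ->
  exists2 A, 1 <= A & (forall x, A <= x -> u x != 0) /\
    forall x y, A <= x -> x <= y ->
      ln (u x ^+ 2) <= ln (u y ^+ 2) /\
      ln (u y ^+ 2) <= ln (u x ^+ 2) + 4 * lambda * x `^ (- gamma) * (y - x).
Proof.
move=> l0 su; have [A A1 HA] := log_derivative_bounds l0 su.
case: su => [[d1 _] _ _].
exists A => //; split; first by move=> x /HA[].
move=> x y Ax xy.
have dl z : x <= z <= y -> is_derive z 1 (fun y => ln (u y ^+ 2)) (2 * (u1 z / u z)).
  by move=> /andP[xz _]; have [? _ _] := HA z (le_trans Ax xz); exact: der_ln_sqr.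
split.
  apply: (der_ge0_le xy dl) => z /andP[xz _].
  have [_ h _] := HA z (le_trans Ax xz).
  by rewrite mulr_ge0// (le_trans _ h)// mulr_ge0 ?powR_ge0// ltW.
have [c /andP[xc cy]] := mvt xy dl.
rewrite -lerBlDl => ->; rewrite ler_wpM2r ?subr_ge0//.
have [_ _ h] := HA c (le_trans Ax xc).
rewrite (_ : 4 * _ * _ = 2 * (2 * lambda * x `^ (- gamma))); last by ring.
rewrite ler_pM2l//; apply: (le_trans h); rewrite ler_wpM2l//.
  by rewrite mulr_ge0// ltW.
have x0 : 0 < x by lra.
rewrite !powRN lef_pV2 ?posrE; last 2 first.
- by rewrite powR_gt0//; lra.
- exact: powR_gt0.
by apply: ge0_ler_powR; rewrite ?nnegrE// ltW//; lra.
Qed.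

(** Since u'/u is at least of order x^(-gamma) and gamma < 1, it exceeds 1/x far
    out, so that |u| / x is nondecreasing there. *)
Lemma superlinear lambda u u1 : 0 < lambda -> slow_solution lambda u u1 ->
  exists k A : R, [/\ 0 < k, 1 <= A & forall x, A <= x -> k * x ^+ 2 <= u x ^+ 2].
Proof.
move=> l0 su; have [A A1 HA] := log_derivative_bounds l0 su.
case: su => [[d1 _] _ _].
have [B B1 HB] := @powR_large R (1 - gamma) lambda^-1 (eq_rect _ is_true gamma1 _
  (esym (subr_gt0 gamma 1))).
pose D := Num.max A B; have D1 : 1 <= D by rewrite le_max A1.
have D0 : 0 < D by lra.
have [AD BD] : A <= D /\ B <= D by rewrite !le_max !lexx orbT.
have [uD _ _] := HA D AD.
exists (u D ^+ 2 / D ^+ 2), D; split=> //.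
  rewrite divr_gt0 ?(exprn_gt0 2 D0)//.
  by rewrite lt0r sqr_ge0 sqrf_eq0 uD.
move=> x Dx; have x0 : 0 < x by lra.
rewrite -ler_pdivlMr ?exprn_gt0//.
pose df (y : R) := (2 * u y * u1 y * y - 2 * u y ^+ 2) / y ^+ 3.
apply: (@der_ge0_le _ (fun y => u y ^+ 2 / y ^+ 2) df) => // y /andP[Dy _].
  have y0 : 0 < y by lra.
  have ? := d1 y; der; first by rewrite expf_neq0// gt_eqF.
  by rewrite /df; field; rewrite gt_eqF.
have y0 : 0 < y by lra.
rewrite /df divr_ge0 ?exprn_ge0 ?(ltW y0)//.
have [uy h _] := HA y (le_trans AD Dy).
have u2 : 0 < u y ^+ 2 by rewrite lt0r sqr_ge0 sqrf_eq0 uy.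
have h1 : 1 <= lambda * y `^ (- gamma) * y.
  have := HB y (le_trans BD Dy).
  rewrite -[leLHS]mul1r ler_pdivrMr// mulrC powR_Dgt0// powRr1 ?(ltW y0)//.
  by rewrite (mulrC y) mulrA.
have h2 : 1 <= u1 y / u y * y by rewrite (le_trans h1)// ler_pM2r.
have : u y ^+ 2 <= u y * u1 y * y.
  rewrite (_ : u y * u1 y * y = u1 y / u y * y * u y ^+ 2); last by field.
  by rewrite ler_peMl// ltW.
lra.
Qed.

(** The key comparison.  If v solves the equation for mu > lambda, then
    |v|^(lambda/mu) is a strict subsolution for lambda; its logarithmic
    derivative, lowered by c / x, is still an upper barrier because
    (v'/v)^2 is at least of order x^(-2 gamma), which dominates x^(gamma - 1)
    exactly when gamma <= 1/3. *)
Lemma ln_sqr_ratio lambda mu u u1 v v1 : 3 * gamma <= 1 ->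
  0 < lambda -> lambda < mu ->
  slow_solution lambda u u1 -> slow_solution mu v v1 ->
  exists c C A : R, [/\ 0 < c, 1 <= A & forall x, A <= x ->
    ln (u x ^+ 2) - lambda / mu * ln (v x ^+ 2) <= C - c * ln x].
Proof.
move=> g3 l0 lm su sv; have m0 : 0 < mu by lra.
have [A A1 HA] := log_derivative_bounds m0 sv.
have [B B1 HB] := log_derivative_bounds l0 su.
case: su => [s nt sl]; case: sv => [s' _ _].
pose k := lambda / mu.
have k0 : 0 < k by rewrite divr_gt0.
have k1 : k < 1 by rewrite ltr_pdivrMr// mul1r.
pose c := k * (1 - k) * mu ^+ 2 / 2.
have k1' : 0 < 1 - k by rewrite subr_gt0.
have c0 : 0 < c by rewrite /c divr_gt0// (mulr_gt0 (mulr_gt0 k0 k1'))// exprn_gt0.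
have g1p : 0 < 1 - gamma by rewrite subr_gt0.
have gp1 : 0 < gamma + 1 by rewrite addr_gt0.
have [D D1 HD] := @powR_large R (gamma + 1) (c + 1) gp1.
have [E E1 HE] := @powR_large R (1 - gamma) (c / lambda) g1p.
pose F := Num.max (Num.max A B) (Num.max D E).
have [AF BF DF EF] : [/\ A <= F, B <= F, D <= F & E <= F].
  by rewrite /F !le_max !lexx !orbT.
have F1 : 1 <= F by rewrite (le_trans A1).
pose phi x := v1 x / v x.
pose be x := k * phi x - c / x.
pose dbe x := k * (x `^ gamma * phi x - mu - phi x ^+ 2) + c / x ^+ 2.
have barrier x : F <= x -> u x * u1 x <= be x * u x ^+ 2.
  apply: (upper_barrier gamma0 s sl (beta := be) (dbeta := dbe)) => // {}x Fx.
  - have [vx _ _] := HA x (le_trans AF Fx).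
    have x0 : 0 < x by lra.
    have dv := s'.1 x; have dv1 := s'.2 x.
    rewrite invr1 mul1r (force_gt0 _ x0) in dv1.
    rewrite /be /phi; der => //; first by rewrite gt_eqF.
    by rewrite /dbe /phi; field; rewrite vx gt_eqF.
  - have [vx h _] := HA x (le_trans AF Fx).
    have x0 : 0 < x by lra.
    rewrite /be subr_ge0; apply: (@le_trans _ _ (k * (mu * x `^ (- gamma)))).
      rewrite mulrA /k divfK ?gt_eqF// ler_pdivrMr// -mulrA.
      have := HE x (le_trans EF Fx); rewrite ler_pdivrMr// mulrC.
      by rewrite powR_Dgt0// powRr1 ?(ltW x0)// (mulrC x).
    by rewrite ler_wpM2l// ltW.
  - have [vx h _] := HA x (le_trans AF Fx).
    have x0 : 0 < x by lra.
    have hD := HD x (le_trans DF Fx).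
    set p := phi x in h *.
    set X := x `^ (gamma - 1).
    have p0 : 0 < p by apply: lt_le_trans h; rewrite mulr_gt0// powR_gt0.
    have eX : x `^ gamma * (c / x) = c * X.
      by rewrite /X powR_Dgt0// powR_inv1 ?(ltW x0)//; ring.
    have hX : mu ^+ 2 * X <= p ^+ 2.
      apply: (@le_trans _ _ ((mu * x `^ (- gamma)) ^+ 2)).
        rewrite exprMn ler_pM2l ?exprn_gt0// expr2 -powR_Dgt0// /X.
        by apply: ler_powR; lra.
      by rewrite ler_pXn2r ?nnegrE ?(ltW p0) ?(mulr_ge0 (ltW m0)) ?powR_ge0.
    have hX2 : (c ^+ 2 + c) / x ^+ 2 <= c * X.
      rewrite (_ : X = x `^ (gamma + 1) / x ^+ 2); last first.
        rewrite /X !powR_Dgt0// powRr1 ?(ltW x0)// powR_inv1 ?(ltW x0)//.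
        by field; rewrite gt_eqF.
      rewrite mulrA ler_pM2r ?invr_gt0 ?exprn_gt0//.
      by rewrite (_ : c ^+ 2 + c = c * (c + 1)) ?ler_pM2l//; ring.
    have hX3 : k * (1 - k) * (mu ^+ 2 * X) <= k * (1 - k) * p ^+ 2.
      by rewrite ler_wpM2l// (mulr_ge0 (ltW k0) (ltW k1')).
    have hc : k * (1 - k) * (mu ^+ 2 * X) = 2 * (c * X) by rewrite /c; field.
    have pc : 0 <= 2 * k * p * c / x by rewrite ltW// divr_gt0// (mulr_gt0 (mulr_gt0 _ p0) c0)// mulr_gt0.
    have km : k * mu = lambda by rewrite /k divfK ?gt_eqF.
    have -> : x `^ gamma * be x = k * (x `^ gamma * p) - c * X.
      by rewrite /be -/p mulrBr eX; ring.
    have -> : dbe x + be x ^+ 2 = k * (x `^ gamma * p) - k * mu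
        - k * (1 - k) * p ^+ 2 - 2 * k * p * c / x + (c ^+ 2 + c) / x ^+ 2.
      by rewrite /dbe /be -/p; field; rewrite gt_eqF.
    by rewrite km; lra.
exists (2 * c), (ln (u F ^+ 2) - k * ln (v F ^+ 2) + 2 * c * ln F), F.
split=> //; first by rewrite mulr_gt0.
move=> x Fx; rewrite lerBrDr.
apply: (@der_le0_ge _ (fun y => ln (u y ^+ 2) - k * ln (v y ^+ 2) + 2 * c * ln y)
  (fun y => 2 * (u1 y / u y) - k * (2 * (v1 y / v y)) + 2 * c / y))
    => // y /andP[Fy _]; have y0 : 0 < y by lra.
  have [vy _ _] := HA y (le_trans AF Fy); have [uy _ _] := HB y (le_trans BF Fy).
  have ? := der_ln_sqr uy (s.1 y); have ? := der_ln_sqr vy (s'.1 y).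
  by der => //; ring.
have [uy _ _] := HB y (le_trans BF Fy).
have u2 : 0 < u y ^+ 2 by rewrite lt0r sqr_ge0 sqrf_eq0 uy.
have := barrier y Fy; rewrite -ler_pdivrMr//.
rewrite (_ : u y * u1 y / u y ^+ 2 = u1 y / u y); last by field.
by rewrite /be /phi; lra.
Qed.

Lemma slow_solutionN lambda u u1 : slow_solution lambda u u1 ->
  slow_solution lambda (fun x => - u x) (fun x => - u1 x).
Proof.
move=> [[d1 d2] [x ux] sl]; split.
- split=> y; first exact: derN (d1 y).
  by apply: (is_derive_eq (derN (d2 y))); ring.
- by exists x; rewrite oppr_eq0.
- by move=> c a c0 a1 h; apply: (sl c a c0 a1) => y ay; rewrite -sqrrN h.
Qed.

(** Integrating u amounts to multiplying it by x^gamma, up to constants, since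
    (x^gamma u)' / u stays between lambda and 2 lambda + 1. *)
Lemma primitive_bounds_pos lambda u u1 U A0 : 0 < lambda ->
  slow_solution lambda u u1 -> (forall x, is_derive x 1 U (u x)) ->
  (forall x, A0 <= x -> 0 < u x) ->
  exists a b A : R, [/\ 0 < a, 1 <= A & forall x, A <= x ->
    a * (x `^ gamma * u x) <= U x - U 0 /\ U x - U 0 <= b * (x `^ gamma * u x)].
Proof.
move=> l0 su dU up; have [k [B [k0 B1 HB]]] := superlinear l0 su.
have [A A1 HA] := log_derivative_bounds l0 su.
case: su => [[d1 _] _ _].
pose D := Num.max A0 (Num.max A B).
have [A0D AD BD] : [/\ A0 <= D, A <= D & B <= D].
  by rewrite /D !le_max !lexx !orbT.
have D1 : 1 <= D by rewrite (le_trans A1).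
pose h x := x `^ gamma * u x.
pose dh x := gamma * x `^ (gamma - 1) * u x + x `^ gamma * u1 x.
have d_h x : D <= x -> is_derive x 1 h (dh x).
  move=> Dx; have x0 : 0 < x by lra.
  by have ? := d1 x; rewrite /h /dh; der.
have dhlo x : D <= x -> lambda * u x <= dh x.
  move=> Dx; have x0 : 0 < x by lra.
  have [ux h1 _] := HA x (le_trans AD Dx); have u0 := up x (le_trans A0D Dx).
  have e : x `^ gamma * x `^ (- gamma) = 1 by rewrite -powR_Dgt0// addrN powRr0.
  have : lambda * u x <= x `^ gamma * u1 x.
    move: h1; rewrite ler_pdivlMr// => /(ler_wpM2l (powR_ge0 x gamma)).
    apply: le_trans; apply: eq_ler; rewrite -[LHS]mul1r -e; ring.
  have : 0 <= gamma * x `^ (gamma - 1) * u x.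
    by rewrite !mulr_ge0 ?powR_ge0// ltW.
  by rewrite /dh; lra.
have dhhi x : D <= x -> dh x <= (2 * lambda + 1) * u x.
  move=> Dx; have x0 : 0 < x by lra.
  have [ux _ h1] := HA x (le_trans AD Dx); have u0 := up x (le_trans A0D Dx).
  have e : x `^ gamma * x `^ (- gamma) = 1 by rewrite -powR_Dgt0// addrN powRr0.
  have : x `^ gamma * u1 x <= 2 * lambda * u x.
    move: h1; rewrite ler_pdivrMr// => /(ler_wpM2l (powR_ge0 x gamma)) /le_trans; apply.
    by apply: eq_ler; rewrite -[RHS]mul1r -e; ring.
  have : gamma * x `^ (gamma - 1) * u x <= u x.
    rewrite ler_piMl ?(ltW u0)//.
    have x1 : 1 <= x by lra.
    have := @powR_le1 R (gamma - 1) x x1; rewrite subr_le0 => /(_ (ltW gamma1)) p1.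
    by rewrite -[leRHS]mulr1 ler_pM ?powR_ge0 ?(ltW gamma0) ?(ltW gamma1)//.
  by rewrite /dh; lra.
pose a := (2 * lambda + 1)^-1.
have l1 : 0 < 2 * lambda + 1 by lra.
have a0 : 0 < a by rewrite invr_gt0.
pose K := `|U D - U 0| + h D / lambda.
have hD0 : 0 < h D.
  by rewrite mulr_gt0 ?up// powR_gt0; lra.
have K0 : 0 <= K by rewrite addr_ge0// divr_ge0 ?ltW.
pose T := Num.max D (2 * (K + h D) * (1 + a^-1) / Num.sqrt k + 1).
exists (a / 2), (lambda^-1 + 1), T; split.
- by rewrite divr_gt0.
- by rewrite le_max D1.
move=> x; rewrite ge_max => /andP[Dx Tx].
have x0 : 0 < x by lra.
have hbig : 2 * (K + h D) * (1 + a^-1) <= h x.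
  have sk : 0 < Num.sqrt k by rewrite sqrtr_gt0.
  have : 2 * (K + h D) * (1 + a^-1) <= Num.sqrt k * x.
    rewrite -ler_pdivrMl// mulrC; by apply: le_trans Tx; rewrite lerDl.
  move=> /le_trans; apply.
  have u0 := up x (le_trans A0D Dx).
  apply: (@le_trans _ _ (u x)).
    rewrite -(@ler_pXn2r _ 2)// ?nnegrE ?(ltW u0)//; last by rewrite mulr_ge0 ?ltW.
    by rewrite exprMn sqr_sqrtr ?(ltW k0)// HB// (le_trans BD).
  rewrite ler_peMl ?(ltW u0)// -(powRr0 x); apply: ler_powR; [lra|exact: ltW].
have ia : 0 < a^-1 by rewrite invr_gt0.
have KhD : K + h D <= a / 2 * h x.
  have KK : 0 <= K + h D by lra.
  have : 2 * (K + h D) * a^-1 <= h x.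
    apply: le_trans hbig; rewrite ler_wpM2l//; [exact: mulr_ge0|lra].
  by rewrite ler_pdivrMr//; lra.
have Kh : K <= h x.
  apply: le_trans hbig; have : 0 <= (K + h D) * a^-1.
    by rewrite mulr_ge0 ?ltW//; lra.
  lra.
rewrite -/(h x); split.
- have : U D - U 0 - a * h D <= U x - U 0 - a * h x.
    apply: (@der_ge0_le _ (fun y => U y - U 0 - a * h y) (fun y => u y - a * dh y)
      D x Dx) => y /andP[Dy _].
      by have ? := dU y; have ? := d_h y Dy; der; ring.
    by rewrite subr_ge0 /a ler_pdivrMl// dhhi.
  have : - (U D - U 0) <= K.
    rewrite (le_trans (ler_norm _))// normrN lerDl divr_ge0 ?ltW//.
  have : a * h D <= h D.
    by rewrite ler_piMl ?(ltW hD0)// invf_le1//; lra.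
  lra.
- have : lambda^-1 * h D - (U D - U 0) <= lambda^-1 * h x - (U x - U 0).
    apply: (@der_ge0_le _ (fun y => lambda^-1 * h y - (U y - U 0))
      (fun y => lambda^-1 * dh y - u y) D x Dx) => y /andP[Dy _].
      by have ? := dU y; have ? := d_h y Dy; der; ring.
    by rewrite subr_ge0 ler_pdivlMl// dhlo.
  have : U D - U 0 <= K.
    by rewrite (le_trans (ler_norm _))// lerDl divr_ge0 ?ltW.
  have : 0 <= lambda^-1 * h D by rewrite mulr_ge0 ?invr_ge0 ?ltW.
  rewrite mulrDl; lra.
Qed.

Lemma primitive_bounds lambda u u1 U : 0 < lambda ->
  slow_solution lambda u u1 -> (forall x, is_derive x 1 U (u x)) ->
  exists a b A : R, [/\ 0 < a, 1 <= A & forall x, A <= x ->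
    a * (x `^ gamma * u x) ^+ 2 <= (U x - U 0) ^+ 2 /\
    (U x - U 0) ^+ 2 <= b * (x `^ gamma * u x) ^+ 2].
Proof.
move=> l0 su dU.
have [A A1 HA] := log_derivative_bounds l0 su.
have cu : continuous u by have [s _ _] := su; exact: (solves_cont s).1.
(* beyond A there is no zero, hence a constant sign, taken positive *)
have pos (w w1 W : R -> R) : slow_solution lambda w w1 -> continuous w ->
    (forall x, is_derive x 1 W (w x)) ->
    (forall x, A <= x -> w x != 0) -> 0 < w A ->
  exists a b B : R, [/\ 0 < a, 1 <= B & forall x, B <= x ->
    a * (x `^ gamma * w x) ^+ 2 <= (W x - W 0) ^+ 2 /\
    (W x - W 0) ^+ 2 <= b * (x `^ gamma * w x) ^+ 2].
  move=> sw cw dW nz wA.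
  have wp x : A <= x -> 0 < w x.
    move=> Ax; rewrite ltNge; apply/negP => wx.
    have [] := @IVT R w A x 0 Ax.
    - exact: continuous_subspaceT.
    - by rewrite ge_min wx orbT le_max (ltW wA).
    - move=> z; rewrite in_itv/= => /andP[Az _] /eqP.
      by rewrite (negPf (nz z Az)).
  have [a [b [B [a0 B1 HB]]]] := primitive_bounds_pos l0 sw dW wp.
  exists (a ^+ 2), (b ^+ 2), (Num.max A B); split.
  - by rewrite exprn_gt0.
  - by rewrite le_max A1.
  move=> x; rewrite ge_max => /andP[Ax Bx]; have [h1 h2] := HB x Bx.
  have w0 : 0 <= x `^ gamma * w x by rewrite mulr_ge0 ?powR_ge0// ltW// wp.
  have aw : 0 <= a * (x `^ gamma * w x) := mulr_ge0 (ltW a0) w0.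
  have W0 := le_trans aw h1.
  split; first by rewrite -exprMn ler_pXn2r ?nnegrE.
  by rewrite -exprMn ler_pXn2r ?nnegrE// (le_trans W0).
have nz x : A <= x -> u x != 0 by move=> /HA[].
have [uA|uA] := ltP 0 (u A); first exact: pos su cu dU nz uA.
have uA' : 0 < - u A by rewrite oppr_gt0 lt_neqAle nz.
have cN : continuous (fun x => - u x) by move=> x; apply: cvgN; exact: cu.
have dN x : is_derive x 1 (fun x => - U x) (- u x) by exact: derN (dU x).
have nzN x : A <= x -> - u x != 0 by move=> /nz; rewrite oppr_eq0.
have [a [b [B [a0 B1 HB]]]] := pos _ _ _ (slow_solutionN su) cN dN nzN uA'.
exists a, b, B; split=> // x Bx; have := HB x Bx.
by rewrite mulrN sqrrN -opprD sqrrN.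
Qed.

End slow_solutions.

(** * Primitives and dilations of integrals *)

Section primitives.
Context {R : realType}.
Notation mu := (@lebesgue_measure R).
Implicit Types (f F : R -> R) (a b x y : R).

Lemma integrable_segment f a b : continuous f ->
  mu.-integrable `[a, b] (EFin \o f).
Proof.
move=> cf; apply: continuous_compact_integrable; first exact: segment_compact.
exact: continuous_subspaceT.
Qed.

Lemma ftc_segment F f a b : a <= b ->
  (forall x, a <= x <= b -> is_derive x 1 F (f x)) -> continuous f ->
  \int[mu]_(x in `[a, b]) f x = F b - F a.
Proof.
rewrite le_eqVlt => /predU1P[-> d _|ab d cf].
  by rewrite set_itv1 Rintegral_set1 subrr.
rewrite /Rintegral (@continuous_FTC2 _ _ F)//.
- exact: continuous_subspaceT.
- split.
  + move=> x; rewrite in_itv/= => /andP[/ltW ax /ltW xb].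
    by apply: der_derivable (d _ _); rewrite ax.
  + apply: cvg_at_right_filter; apply: der_cont (d _ _).
    by rewrite lexx ltW.
  + apply: cvg_at_left_filter; apply: der_cont (d _ _).
    by rewrite lexx ltW.
- move=> x; rewrite in_itv/= => /andP[/ltW ax /ltW xb].
  by rewrite derive1E; have [|_ ->] := d x; rewrite // ax.
Qed.

(** The integral is started at a point to the left of both x and the origin, so
    that the fundamental theorem applies on either side of the origin; the
    choice of that point is immaterial. *)
Lemma ex_primitive f : continuous f ->
  exists F, forall x, is_derive x 1 F (f x).
Proof.
move=> cf; pose I a b := \int[mu]_(x in `[a, b]) f x.
pose F x := I (- (`|x| + 1)) x - I (- (`|x| + 1)) 0.
have FE M x : `|x| + 1 <= M -> F x = I (- M) x - I (- M) 0.
  move=> xM; set N := `|x| + 1 in xM *.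
  have split z : `|z| <= N -> I (- M) z - I (- M) (- N) = I (- N) z.
    move=> zN; rewrite /I Rintegral_itvB.
    - rewrite Rintegral_itv_obnd_cbnd//.
      apply: integrableS (integrable_segment (- N) z cf) => //.
      exact: subset_itv_oc_cc.
    - exact: integrable_segment.
    - by rewrite bnd_simp lerN2.
    - by rewrite bnd_simp lerNl (le_trans (ler_norm _))// normrN.
  have := split x; rewrite -/N => h; rewrite /F -h; last by rewrite lerDl.
  rewrite -(split 0); last by rewrite normr0 addr_ge0.
  by ring.
exists F => x; pose M := `|x| + 3.
apply: (@near_eq_is_derive _ _ _ (fun y => I (- M) y - I (- M) 0)).
  near=> y; rewrite (FE M)// /M (_ : 3 = 2 + 1); last by ring.
  rewrite addrA lerD2r.
  have : `|x - y| < 1 by near: y; exact: cvgr_dist_lt.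
  have := ler_distD 0 y x; rewrite distrC subr0.
  have : `|y| <= `|x| + `|x - y|.
    by rewrite -[in leLHS](subrK x y) addrC (le_trans (ler_normD _ _))// (distrC x).
  lra.
have [] := @continuous_FTC1_closed R f (- M) x (x + 1).
- by rewrite ltrDl.
- exact: integrable_segment.
- have := ler_norm (- x); rewrite normrN /M; lra.
- exact: cf.
move=> d e; rewrite -[f x]subr0; notypeclasses refine (derB _ (derC _ _)).
by apply: DeriveDef; [exact: d|rewrite -derive1E].
Unshelve. all: by end_near. Qed.

End primitives.

Section scaling.
Context {R : realType}.
Notation mu := (@lebesgue_measure R).

Lemma lebesgue_measure_scale (a : R) (A : set R) : a != 0 -> measurable A ->
  (`|a|%:E * pushforward mu (fun x : R => (a * x)%R : measurableTypeR R) A = mu A)%E.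
Proof.
move=> a0 mA.
have ma : measurable_fun setT (fun x : R => (a * x)%R : measurableTypeR R).
  exact: (@mulrl_measurable R setT a).
pose m : {measure set (measurableTypeR R) -> \bar R} :=
  mscale (NngNum (normr_ge0 a)) (pushforward mu (fun x : R => (a * x)%R : measurableTypeR R)).
rewrite -[LHS]/(m ma A).
apply/esym/lebesgue_measure_unique => //= _ [[p q]] _ <-.
rewrite /mscale/= /pushforward/=.
have [a_gt0|a_lt0] : 0 < a \/ a < 0.
  by apply/orP; rewrite orbC -neq_lt.
- rewrite (_ : _ @^-1` _ = `]a^-1 * p, a^-1 * q]%classic); last first.
    by apply/seteqP; split=> x /=; rewrite !in_itv/= ltr_pdivrMl// ler_pdivlMl.
  rewrite !lebesgue_measure_itv/= !lte_fin ltr_pM2l ?invr_gt0//.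
  case: ifPn => pq; last by rewrite mule0.
  rewrite -!EFinB -EFinM; congr EFin.
  by rewrite -mulrBr gtr0_norm// mulrA mulfV// mul1r.
- rewrite (_ : _ @^-1` _ = `[a^-1 * q, a^-1 * p[%classic); last first.
    apply/seteqP; split=> x /=; rewrite !in_itv/=.
      by move=> /andP[h1 h2]; rewrite ler_ndivrMl// ltr_ndivlMl// h1 h2.
    by rewrite ler_ndivrMl// ltr_ndivlMl// => /andP[h1 h2]; rewrite h1 h2.
  rewrite !lebesgue_measure_itv/= !lte_fin ltr_nM2l ?invr_lt0//.
  case: ifPn => pq; last by rewrite mule0.
  rewrite -!EFinB -EFinM; congr EFin.
  by rewrite -mulrBr ltr0_norm// mulrA mulNr mulfV// mulN1r opprB.
Qed.

Lemma ge0_integral_scale (a : R) (f : R -> \bar R) : a != 0 ->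
  measurable_fun [set: R] f -> (forall x, 0 <= f x)%E ->
  (\int[mu]_x f x = `|a|%:E * \int[mu]_x f (a * x)%R)%E.
Proof.
move=> a0 mf f0.
have ma : measurable_fun setT (fun x : R => (a * x)%R : measurableTypeR R).
  exact: (@mulrl_measurable R setT a).
pose m : {measure set (measurableTypeR R) -> \bar R} :=
  pushforward mu (fun x : R => (a * x)%R : measurableTypeR R).
transitivity (\int[mscale (NngNum (normr_ge0 a)) (m ma)]_x f x)%E.
  apply: eq_measure_integral => A mA _.
  exact: (esym (lebesgue_measure_scale a0 mA)).
rewrite ge0_integral_mscale//=; congr (_ * _)%E.
by rewrite /m ge0_integral_pushforward.
Qed.

Lemma integral_scale (a : R) (f : R -> \bar R) : a != 0 ->
  measurable_fun [set: R] f ->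
  (\int[mu]_x f x = `|a|%:E * \int[mu]_x f (a * x)%R)%E.
Proof.
move=> a0 mf; rewrite integralE.
rewrite (ge0_integral_scale a0 (measurable_funepos mf))//.
rewrite (ge0_integral_scale a0 (measurable_funeneg mf))//.
have na : (0 < `|a|%:E)%E by rewrite lte_fin normr_gt0.
set p := (\int[mu]_x f^\+ (a * x)%R)%E; set q := (\int[mu]_x f^\- (a * x)%R)%E.
transitivity (`|a|%:E * (p - q))%E; last first.
  rewrite [in RHS]integralE; congr (_ * (_ - _))%E; apply: eq_integral => x _;
    by rewrite ?funeposE ?funenegE.
case: p => [p||]; case: q => [q||] //=;
  do 2 rewrite ?(gt0_muley na) ?(gt0_muleNy na) ?addeNy ?addNye ?addye ?addey//=.
by rewrite -EFinM -!EFinD -EFinM mulrBr.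
Qed.

Lemma Rintegral_scale (a : R) (f : R -> R) : a != 0 ->
  measurable_fun [set: R] f ->
  \int[mu]_x f x = `|a| * \int[mu]_x f (a * x).
Proof.
move=> a0 mf; rewrite /Rintegral (integral_scale a0)/=; last exact/measurable_EFinP.
have na : (0 < `|a|%:E)%E by rewrite lte_fin normr_gt0.
case: (\int[mu]_x (f (a * x))%:E)%E => [r||]//=.
- by rewrite (gt0_muley na) mulr0.
- by rewrite (gt0_muleNy na) mulr0.
Qed.

Lemma integrable_scale (a : R) (f : R -> R) : a != 0 ->
  mu.-integrable [set: R] (EFin \o f) ->
  mu.-integrable [set: R] (EFin \o (fun x => f (a * x))).
Proof.
move=> a0 /integrableP[/measurable_EFinP mf fi]; apply/integrableP; split.
  apply/measurable_EFinP; apply: (measurableT_comp mf).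
  exact: (@mulrl_measurable R setT a).
have na : (0 < `|a|%:E)%E by rewrite lte_fin normr_gt0.
move: fi; rewrite (integral_scale a0); last first.
  by apply/measurable_EFinP; exact: measurableT_comp.
have : (0 <= \int[mu]_x `|(EFin \o f) (a * x)%R|)%E by apply: integral_ge0.
rewrite /=; case: (\int[mu]_x _)%E => [r _ _||]//=; first exact: ltry.
by rewrite (gt0_muley na).
Qed.

End scaling.

(** * The weighted L2 space *)

Section weighted_L2.
Context {R : realType}.
Notation mu := (@lebesgue_measure R).
Variables (gamma eps : R).
Hypothesis gamma0 : 0 < gamma.
Hypothesis eps0 : 0 < eps.
Hypothesis Z0 : 0 < partition_constant gamma eps.
Implicit Types (f g h : R -> R) (x : R).

Local Notation rho := (rho_inf gamma eps).
Local Notation L2 := (in_L2 gamma eps).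
Local Notation ip := (inner gamma eps).
Local Notation intg f := (mu.-integrable setT (EFin \o (f : R -> R))).

Lemma le_intg D f g : measurable D -> measurable_fun D f ->
  (forall x, D x -> `|f x| <= g x) -> mu.-integrable D (EFin \o g) ->
  mu.-integrable D (EFin \o f).
Proof.
move=> mD mf fg; apply: le_integrable => //; first exact/measurable_EFinP.
move=> x Dx /=; rewrite lee_fin (le_trans (fg x Dx))// ler_norm//.
Qed.

Lemma intgD D f g : measurable D -> mu.-integrable D (EFin \o f) ->
  mu.-integrable D (EFin \o g) -> mu.-integrable D (EFin \o (fun x => f x + g x)).
Proof. by move=> mD jf jg; exact: integrableD jf jg. Qed.

Lemma intgZ D c f : measurable D -> mu.-integrable D (EFin \o f) ->
  mu.-integrable D (EFin \o (fun x => c * f x)).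
Proof. by move=> mD jf; exact: (integrableZl mD c jf). Qed.

Lemma measurable_gibbs :
  measurable_fun setT (fun x => expR (- (potential gamma x / eps))).
Proof.
apply: continuous_measurable_fun => x; apply: der_cont.
have ? := der_potential gamma0 x; eapply der_expR; eapply derN; eapply derM.
  eassumption.
exact: derC.
Qed.

Lemma rho_gt0 x : 0 < rho x.
Proof. by rewrite mulr_gt0 ?invr_gt0 ?expR_gt0. Qed.

Lemma der_rho x : is_derive x 1 rho (- (force gamma x / eps) * rho x).
Proof. by have ? := der_potential gamma0 x; rewrite /rho_inf; der; ring. Qed.

Lemma continuous_rho : continuous rho.
Proof. by move=> x; exact: der_cont (der_rho x). Qed.

Lemma measurable_rho D : measurable_fun D rho.
Proof.
by apply: measurable_funTS; apply: continuous_measurable_fun; exact: continuous_rho.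
Qed.

(** The real value of a divergent integral is 0, so that positivity of the
    partition constant already gives integrability. *)
Lemma intg_rho : intg rho.
Proof.
have m := measurable_gibbs.
have i : intg (fun x => expR (- (potential gamma x / eps))).
  apply/integrableP; split; first exact/measurable_EFinP.
  under eq_integral do rewrite /= ger0_norm ?expR_ge0//.
  have : (0 <= \int[mu]_x (expR (- (potential gamma x / eps)))%:E)%E.
    by apply: integral_ge0 => x _; rewrite lee_fin expR_ge0.
  move: Z0; rewrite /partition_constant /Rintegral.
  case: (\int[mu]_x _)%E => [r|/=|/=]; rewrite ?ltry ?ltxx//.
exact: (intgZ (partition_constant gamma eps)^-1 measurableT i).
Qed.

Lemma L2_measurable f D : L2 f -> measurable_fun D f.
Proof. by move=> [mf _]; exact: measurable_funTS. Qed.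

Lemma measurable_mul_rho f D : measurable_fun setT f ->
  measurable_fun D (fun x => f x * rho x).
Proof.
by move=> mf; apply: measurable_funM; [exact: measurable_funTS|exact: measurable_rho].
Qed.

Lemma L2_dominated f g c d : measurable_fun setT f -> L2 g ->
  (forall x, f x ^+ 2 <= c * g x ^+ 2 + d) -> L2 f.
Proof.
move=> mf [mg ig] fg; split=> //.
apply: (@le_intg _ _ (fun x => c * (g x ^+ 2 * rho x) + d * rho x)) => //.
- by apply: measurable_mul_rho; exact: measurable_funX.
- move=> x _; rewrite ger0_norm; last by rewrite mulr_ge0 ?sqr_ge0 ?ltW ?rho_gt0.
  by rewrite mulrA -mulrDl ler_pM2r ?rho_gt0.
- apply: intgD => //; first exact: (intgZ c measurableT ig).
  exact: (intgZ d measurableT intg_rho).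
Qed.

Lemma L2_cst c : L2 (cst c).
Proof.
split; first exact: measurable_cst.
exact: (intgZ (c ^+ 2) measurableT intg_rho).
Qed.

Lemma L2D f g : L2 f -> L2 g -> L2 (fun x => f x + g x).
Proof.
move=> [mf jf] [mg jg]; split; first exact: measurable_funD.
apply: (@le_intg _ _ (fun x => 2 * (f x ^+ 2 * rho x) + 2 * (g x ^+ 2 * rho x))) => //.
- apply: measurable_mul_rho; apply: measurable_funX; exact: measurable_funD.
- move=> x _; rewrite ger0_norm; last by rewrite mulr_ge0 ?sqr_ge0 ?ltW ?rho_gt0.
  rewrite (_ : 2 * _ + _ = (2 * f x ^+ 2 + 2 * g x ^+ 2) * rho x); last by ring.
  by rewrite ler_pM2r ?rho_gt0//; have := sqr_ge0 (f x - g x); lra.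
- apply: intgD => //; first exact: (intgZ 2 measurableT jf).
  exact: (intgZ 2 measurableT jg).
Qed.

Lemma L2Z c f : L2 f -> L2 (fun x => c * f x).
Proof.
move=> Lf; apply: (@L2_dominated _ f (c ^+ 2) 0) => //.
  by apply: measurable_funM; [exact: measurable_cst|exact: L2_measurable Lf].
by move=> x; rewrite exprMn addr0.
Qed.

Lemma L2B f g : L2 f -> L2 g -> L2 (fun x => f x - g x).
Proof.
move=> Lf /(L2Z (- 1)) Lg; have := L2D Lf Lg.
by congr L2; apply/funext => x; rewrite mulN1r.
Qed.

Lemma L2_sum (I : Type) (r : seq I) (f : I -> R -> R) :
  (forall i, L2 (f i)) -> L2 (fun x => \sum_(i <- r) f i x).
Proof.
move=> Lf; elim: r => [|i r ih].
  by under eq_fun do rewrite big_nil; exact: L2_cst.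
by under eq_fun do rewrite big_cons; exact: L2D.
Qed.

Lemma intg_mul f g : L2 f -> L2 g -> intg (fun x => f x * g x * rho x).
Proof.
move=> [mf jf] [mg jg].
apply: (@le_intg _ _ (fun x => f x ^+ 2 * rho x + g x ^+ 2 * rho x)) => //.
- by apply: measurable_mul_rho; exact: measurable_funM.
- move=> x _; rewrite normrM (gtr0_norm (rho_gt0 x)) -mulrDl ler_pM2r ?rho_gt0//.
  rewrite normrM -(real_normK (num_real (f x))) -(real_normK (num_real (g x))).
  have := sqr_ge0 (`|f x| - `|g x|); have := mulr_ge0 (normr_ge0 (f x)) (normr_ge0 (g x)).
  lra.
- exact: intgD.
Qed.

Lemma innerC f g : ip f g = ip g f.
Proof. by rewrite /inner; apply: eq_Rintegral => x _; rewrite (mulrC (f x)). Qed.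

Lemma innerDl f g h : L2 f -> L2 g -> L2 h ->
  ip (fun x => f x + g x) h = ip f h + ip g h.
Proof.
move=> Lf Lg Lh; rewrite /inner -RintegralD//; try exact: intg_mul.
by apply: eq_Rintegral => x _; ring.
Qed.

Lemma innerZl c f h : L2 f -> L2 h -> ip (fun x => c * f x) h = c * ip f h.
Proof.
move=> Lf Lh; rewrite /inner -RintegralZl//; last exact: intg_mul.
by apply: eq_Rintegral => x _; ring.
Qed.

Lemma innerBl f g h : L2 f -> L2 g -> L2 h ->
  ip (fun x => f x - g x) h = ip f h - ip g h.
Proof.
move=> Lf Lg Lh; rewrite /inner -RintegralB//; try exact: intg_mul.
by apply: eq_Rintegral => x _; ring.
Qed.

Lemma inner_suml (I : Type) (r : seq I) (f : I -> R -> R) h :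
  (forall i, L2 (f i)) -> L2 h ->
  ip (fun x => \sum_(i <- r) f i x) h = \sum_(i <- r) ip (f i) h.
Proof.
move=> Lf Lh; elim: r => [|i r ih].
  rewrite big_nil /inner; under eq_Rintegral do rewrite big_nil !mul0r.
  by rewrite Rintegral_cst// mul0r.
rewrite big_cons -ih -innerDl//; last exact: L2_sum.
by congr ip; apply/funext => x; rewrite big_cons.
Qed.

Lemma inner_ge0 f : 0 <= ip f f.
Proof.
by apply: Rintegral_ge0 => x _; rewrite mulr_ge0 ?(ltW (rho_gt0 x))// -expr2 sqr_ge0.
Qed.

Lemma sqr_norm2 f : norm2 gamma eps f ^+ 2 = ip f f.
Proof. by rewrite /norm2 sqr_sqrtr// inner_ge0. Qed.

(** Young's inequality under the integral; the free parameter [d] makes it as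
    useful as the Cauchy-Schwarz inequality. *)
Lemma inner_amgm d f g : 0 < d -> L2 f -> L2 g ->
  `|ip f g| <= d^-1 * ip f f + d * ip g g.
Proof.
move=> d0 Lf Lg; rewrite /inner -!RintegralZl//; try exact: intg_mul.
rewrite -RintegralD//; last 2 first.
- exact: (intgZ d^-1 measurableT (intg_mul Lf Lf)).
- exact: (intgZ d measurableT (intg_mul Lg Lg)).
apply: (le_trans (le_normr_Rintegral _ _)) => //; first exact: intg_mul.
apply: le_Rintegral => //.
- exact: (integrable_norm (intg_mul Lf Lg)).
- apply: intgD => //.
  + exact: (intgZ d^-1 measurableT (intg_mul Lf Lf)).
  + exact: (intgZ d measurableT (intg_mul Lg Lg)).
move=> x _; rewrite normrM (gtr0_norm (rho_gt0 x)).
rewrite (_ : d^-1 * _ + _ = (d^-1 * f x ^+ 2 + d * g x ^+ 2) * rho x); last by ring.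
rewrite ler_pM2r ?rho_gt0// normrM -(real_normK (num_real (f x))) -(real_normK (num_real (g x))).
set a := `|f x|; set b := `|g x|.
have a0 : 0 <= a by exact: normr_ge0.
have b0 : 0 <= b by exact: normr_ge0.
have : 0 <= d^-1 * (a - d * b) ^+ 2 by rewrite mulr_ge0 ?sqr_ge0 ?invr_ge0 ?ltW.
rewrite (_ : d^-1 * (a - d * b) ^+ 2 = d^-1 * a ^+ 2 + d * b ^+ 2 - 2 * (a * b)); last first.
  by field; rewrite gt_eqF.
have := mulr_ge0 a0 b0; lra.
Qed.

Lemma Rintegral_subset (D E : set R) f : measurable D -> measurable E -> D `<=` E ->
  (forall x, E x -> 0 <= f x) -> mu.-integrable E (EFin \o f) ->
  \int[mu]_(x in D) f x <= \int[mu]_(x in E) f x.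
Proof.
move=> mD mE DE f0 jf; rewrite /Rintegral fine_le//.
- by apply: integrable_fin_num => //; exact: integrableS jf.
- exact: integrable_fin_num.
- apply: ge0_subset_integral => //; first exact: measurable_int jf.
Qed.

Lemma le_cst_Rintegral a b c f : a <= b -> continuous f ->
  (forall x, a <= x <= b -> c <= f x) ->
  c * (b - a) <= \int[mu]_(x in `[a, b]) f x.
Proof.
move=> ab cf cl.
have d x : a <= x <= b -> is_derive x 1 (fun x => c * x) c by move=> _; der; ring.
have cc : continuous (fun _ : R => c) by move=> x; exact: cvg_cst.
have := ftc_segment ab d cc; rewrite -mulrBr.
move=> <-; apply: le_Rintegral => //.
- exact: integrable_segment.
- exact: integrable_segment.
Qed.

Lemma inner_eq0 f : L2 f -> continuous f -> ip f f = 0 -> forall x, f x = 0.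
Proof.
move=> Lf cf f0 x; apply/eqP; apply: contraT => fx.
pose g y := f y * f y * rho y.
have cg : continuous g.
  move=> y; apply: cvgM; [apply: cvgM; exact: cf|exact: continuous_rho].
have gx : 0 < g x by rewrite mulr_gt0 ?rho_gt0// -expr2 lt0r sqr_ge0 sqrf_eq0 fx.
have [e /= e0 He] : \forall e \near 0^'+, forall y, x <= y <= x + e -> g x / 2 <= g y.
  have /cvgrPdist_lt/(_ (g x / 2)) := cg x; rewrite divr_gt0// => /(_ isT).
  move=> /nbhs_ballP[e /= e0 He]; near=> d => y /andP[xy yd].
  have : `|g x - g y| < g x / 2.
    apply: He; rewrite /ball/= distrC ger0_norm ?subr_ge0//.
    rewrite ltrBlDl (le_lt_trans yd)// ltrD2l; near: d; exact: nbhs_right_lt.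
  by move=> /(le_lt_trans (ler_norm _)); lra.
pose d := e / 2; have d0 : 0 < d by rewrite divr_gt0.
have {}He y : x <= y <= x + d -> g x / 2 <= g y.
  apply: He => //=; rewrite sub0r normrN gtr0_norm// /d; lra.
have : g x / 2 * (x + d - x) <= \int[mu]_(y in `[x, x + d]) g y.
  by apply: le_cst_Rintegral => //; rewrite lerDl ltW.
have : \int[mu]_(y in `[x, x + d]) g y <= ip f f.
  have mI : measurable (`[x, x + d]%classic : set R) by exact: measurable_itv.
  apply: (Rintegral_subset mI measurableT (@subsetT _ _) _ (intg_mul Lf Lf)) => y _.
  by rewrite mulr_ge0 ?(ltW (rho_gt0 _))// -expr2 sqr_ge0.
rewrite f0 => h1 h2; have := le_trans h2 h1.
by rewrite leNgt (addrC x) addrK mulr_gt0// divr_gt0.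
Unshelve. all: by end_near. Qed.

End weighted_L2.

(** A function above (x^(-gamma) e^V)^(1/2) up to a constant has, on [a, b], a
    squared norm of order b^(1 - gamma), which is unbounded. *)
Lemma slow_growth_L2 {R : realType} (gamma : R) (u : R -> R) :
  0 < gamma -> gamma < 1 -> 0 < partition_constant gamma 1 ->
  continuous u -> in_L2 gamma 1 u -> slow_growth gamma u.
Proof.
move=> g0 g1 Z0 cu Lu c a c0 a1 H.
pose I := inner gamma 1 u u.
pose k := c / partition_constant gamma 1.
have k0 : 0 < k by rewrite divr_gt0.
have g1' : 0 < 1 - gamma by rewrite subr_gt0.
have [B B1 HB] := @powR_large R (1 - gamma) (2 * (I + 1) / k) g1'.
pose b := Num.max (2 * a) B.
have [ab Bb] : 2 * a <= b /\ B <= b by rewrite !le_max !lexx orbT.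
have b0 : 0 < b by lra.
pose g x := u x * u x * rho_inf gamma 1 x.
have cg : continuous g.
  move=> y; apply: cvgM; [apply: cvgM; exact: cu|exact: continuous_rho].
have h1 : k * b `^ (- gamma) * (b - a) <= \int[lebesgue_measure]_(x in `[a, b]) g x.
  apply: le_cst_Rintegral => //; first by lra.
  move=> x /andP[ax xb]; have x0 : 0 < x by lra.
  apply: (@le_trans _ _ (k * x `^ (- gamma))).
    rewrite ler_pM2l// !powRN lef_pV2 ?posrE ?powR_gt0//.
    by apply: ge0_ler_powR; rewrite ?nnegrE ?(ltW g0) ?(ltW x0) ?(ltW b0).
  have -> : g x = (partition_constant gamma 1)^-1 * (u x ^+ 2 / expR (potential gamma x)).
    by rewrite /g /rho_inf divr1 expRN; ring.
  have -> : k * x `^ (- gamma) = (partition_constant gamma 1)^-1 * (c * x `^ (- gamma)).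
    by rewrite /k; ring.
  rewrite ler_pM2l ?invr_gt0// ler_pdivlMr ?expR_gt0//; exact: H.
have h2 : \int[lebesgue_measure]_(x in `[a, b]) g x <= I.
  apply: Rintegral_subset => //; last exact: intg_mul.
  by move=> y _; rewrite /g mulr_ge0 ?(ltW (rho_gt0 _ _))// -expr2 sqr_ge0.
have := le_trans h1 h2; apply/negP; rewrite -ltNge.
have := HB b Bb; rewrite powR_Dgt0// powRr1 ?(ltW b0)// ler_pdivrMr// => h3.
have : k * b `^ (- gamma) * (b / 2) <= k * b `^ (- gamma) * (b - a).
  by rewrite ler_wpM2l ?(mulr_ge0 (ltW k0)) ?powR_ge0//; lra.
lra.
Qed.

(** * Dilation of the noise intensity *)

(** V is homogeneous of degree gamma + 1, so the dilation by a carries the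
    problem with noise intensity |a|^(gamma + 1) eps1 to the one with intensity
    eps1.  The factor a may be negative, which covers reflections. *)
Section scaling.
Context {R : realType}.
Notation mu := (@lebesgue_measure R).
Variables (gamma a eps1 eps2 : R).
Hypothesis gamma0 : 0 < gamma.
Hypothesis a0 : a != 0.
Hypothesis eps10 : 0 < eps1.
Hypothesis eps2E : eps2 = `|a| `^ (gamma + 1) * eps1.
Hypothesis Z20 : 0 < partition_constant gamma eps2.
Implicit Types (f g u : R -> R) (x : R).

Let na0 : 0 < `|a|. Proof. by rewrite normr_gt0. Qed.

Let eps20 : 0 < eps2.
Proof. by rewrite eps2E mulr_gt0// powR_gt0. Qed.

Lemma potential_scale x :
  potential gamma (a * x) / eps2 = potential gamma x / eps1.
Proof.
rewrite potentialZ eps2E; field; rewrite (gt_eqF eps10) gt_eqF//.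
exact: powR_gt0.
Qed.

Lemma partition_scale :
  partition_constant gamma eps2 = `|a| * partition_constant gamma eps1.
Proof.
rewrite /partition_constant (Rintegral_scale a0); last exact: measurable_gibbs.
congr (_ * _).
by apply: eq_Rintegral => x _; rewrite potential_scale.
Qed.

Lemma rho_scale x : rho_inf gamma eps2 (a * x) = `|a|^-1 * rho_inf gamma eps1 x.
Proof. by rewrite /rho_inf potential_scale partition_scale invfM mulrA. Qed.

Let m_comp f : measurable_fun setT f -> measurable_fun setT (fun x => f (a * x)).
Proof. by move=> mf; apply: (measurableT_comp mf); exact: (@mulrl_measurable R setT a). Qed.

Lemma in_L2_scale f : in_L2 gamma eps2 f -> in_L2 gamma eps1 (fun x => f (a * x)).
Proof.
move=> [mf jf]; split; first exact: m_comp.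
have := intgZ `|a| measurableT (integrable_scale a0 jf).
apply: eq_integrable => // x _ /=; congr EFin.
by rewrite rho_scale; field; rewrite normr_eq0.
Qed.

Lemma inner_scale f g : in_L2 gamma eps2 f -> in_L2 gamma eps2 g ->
  inner gamma eps2 f g = inner gamma eps1 (fun x => f (a * x)) (fun x => g (a * x)).
Proof.
move=> Lf Lg; rewrite /inner (Rintegral_scale a0); last first.
  apply: (measurable_mul_rho eps2 gamma0 (f := fun x => f x * g x)).
  by apply: measurable_funM; [exact: (proj1 Lf)|exact: (proj1 Lg)].
rewrite -RintegralZl//; last exact: (integrable_scale a0 (intg_mul gamma0 Z20 Lf Lg)).
apply: eq_Rintegral => x _; rewrite rho_scale; field; by rewrite normr_eq0.
Qed.

Lemma solves_scale lambda u u1 : solves gamma eps2 lambda u u1 ->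
  solves gamma eps1 (`|a| `^ (1 - gamma) * lambda) (fun x => u (a * x))
    (fun x => a * u1 (a * x)).
Proof.
move=> [d1 d2].
have dl x : is_derive x 1 (fun x => a * x) a by der; ring.
split=> x; first by apply: (is_derive_eq (der_comp (d1 (a * x)) (dl x))); ring.
have d := der_comp (d2 (a * x)) (dl x).
der.
rewrite mul0r add0r forceZ eps2E.
have p0 : 0 < `|a| `^ gamma by exact: powR_gt0.
have -> : `|a| `^ (gamma + 1) = `|a| `^ gamma * `|a| by rewrite powR_Dgt0// powRr1.
have -> : `|a| `^ (1 - gamma) = `|a| / `|a| `^ gamma.
  by rewrite powR_Dgt0// powRr1// powRN.
have sa : a = Num.sg a * `|a| by rewrite -numEsg.
have s2 : Num.sg a * Num.sg a = 1.
  by rewrite -expr2 sqr_sg a0.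
have aa : a * a = `|a| * `|a| by rewrite -!expr2 real_normK// num_real.
have as' : a * Num.sg a = `|a| by rewrite {1}sa mulrAC s2 mul1r.
set N := `|a| in aa as' p0 *; set G := N `^ gamma in p0 *.
have N0 : N != 0 by rewrite normr_eq0.
transitivity (eps1^-1 * (a * (a * Num.sg a) * (force gamma x * u1 (a * x)) / N -
   (a * a) * lambda * u (a * x) / (G * N))).
  by field; rewrite N0 !gt_eqF.
by rewrite as' aa; field; rewrite N0 !gt_eqF.
Qed.

Lemma eigenfunction_scale lambda u : eigenfunction gamma eps2 lambda u ->
  eigenfunction gamma eps1 (`|a| `^ (1 - gamma) * lambda) (fun x => u (a * x)).
Proof.
move=> e; have [d1 d2] := solves_scale (eigenfunction_solves gamma0 eps20 e).
case: e => Lu u0 _ _ _.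
have E1 : derive1 (fun x => u (a * x)) = fun x => a * derive1 u (a * x).
  by apply/funext => x; rewrite derive1E; have [_ ->] := d1 x.
split.
- exact: in_L2_scale.
- move=> v0; apply: u0; apply/funext => x.
  by have := congr1 (fun f => f (a^-1 * x)) v0; rewrite /= mulVKf.
- by move=> x; exact: der_derivable (d1 x).
- by move=> x; rewrite E1; exact: der_derivable (d2 x).
- move=> x; rewrite /generator E1 derive1E; have [_ ->] := d2 x.
  by rewrite derive1_potential//; field; rewrite gt_eqF.
Qed.

End scaling.

(** * A cutoff function *)

Section cutoff.
Context {R : realType}.
Notation mu := (@lebesgue_measure R).
Implicit Types (r x : R) (f g : R -> R).

(** A twice differentiable bump on [-r, r], vanishing to second order at the
    end points so that integrations by parts leave no boundary terms. *)
Definition bump r x : R := (1 - (x / r) ^+ 2) ^+ 2.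
Definition bump1 r x : R := - 4 * x / r ^+ 2 * (1 - (x / r) ^+ 2).
Definition bump2 r x : R := (- 4 + 12 * (x / r) ^+ 2) / r ^+ 2.

Lemma der_bump r x : r != 0 -> is_derive x 1 (bump r) (bump1 r x).
Proof. by move=> r0; rewrite /bump; der; rewrite /bump1; field. Qed.

Lemma der_bump1 r x : r != 0 -> is_derive x 1 (bump1 r) (bump2 r x).
Proof. by move=> r0; rewrite /bump1; der; rewrite /bump2; field. Qed.

Lemma bump_itv r x : 0 < r -> - r <= x <= r ->
  [/\ 0 <= bump r x <= 1, `|bump1 r x| <= 4 / r & `|bump2 r x| <= 16 / r ^+ 2].
Proof.
move=> r0 /andP[rx xr].
have h : `|x / r| <= 1.
  by rewrite normrM normfV (gtr0_norm r0) ler_pdivrMr// mul1r ler_norml rx.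
have y0 : 0 <= (x / r) ^+ 2 by exact: sqr_ge0.
have y1 : (x / r) ^+ 2 <= 1.
  by rewrite -(real_normK (num_real (x / r))) expr_le1.
have r20 : 0 < r ^+ 2 by rewrite exprn_gt0.
split.
- rewrite /bump sqr_ge0/= expr_le1//; last by rewrite subr_ge0.
  by rewrite gerBl.
- rewrite (_ : bump1 r x = - (4 / r) * (x / r * (1 - (x / r) ^+ 2))); last first.
    by rewrite /bump1; field; rewrite gt_eqF.
  have r4 : 0 < 4 / r by rewrite divr_gt0.
  rewrite normrM normrN (gtr0_norm r4) ler_piMr ?(ltW r4)// normrM.
  rewrite mulr_ile1// ger0_norm ?subr_ge0//; lra.
- rewrite normrM normfV (gtr0_norm r20) ler_pM2r ?invr_gt0//.
  by rewrite ler_norml; apply/andP; split; lra.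
Qed.

Lemma bump_end r : r != 0 ->
  [/\ bump r r = 0, bump r (- r) = 0, bump1 r r = 0 & bump1 r (- r) = 0].
Proof.
move=> r0; have e : - r / r = - 1 by rewrite mulNr mulfV.
by rewrite /bump /bump1 e mulfV// sqrrN expr1n subrr expr0n/= !mulr0.
Qed.

Lemma cvg_bump x : bump n.+1%:R x @[n --> \oo] --> (1 : R).
Proof.
have h : (n.+1%:R : R)^-1 @[n --> \oo] --> (0 : R) by exact: cvg_harmonic.
have hx : x / n.+1%:R @[n --> \oo] --> x * 0 by apply: cvgM => //; exact: cvg_cst.
have sq (u : nat -> R) (l : R) : u n @[n --> \oo] --> l -> u n ^+ 2 @[n --> \oo] --> l ^+ 2.
  by move=> ul; rewrite expr2; under eq_fun do rewrite expr2; exact: cvgM.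
suff : bump n.+1%:R x @[n --> \oo] --> (1 - (x * 0) ^+ 2) ^+ 2.
  by rewrite mulr0 expr0n/= subr0 expr1n.
rewrite /bump; apply: (sq); apply: cvgB; first exact: cvg_cst.
exact: (sq _ _ hx).
Qed.

Lemma cutoff_cvg f : mu.-integrable setT (EFin \o f) ->
  \int[mu]_(x in `[- n.+1%:R, n.+1%:R]) (bump n.+1%:R x * f x) @[n --> \oo]
    --> \int[mu]_x f x.
Proof.
move=> jf; have /integrableP[/measurable_EFinP mf _] := jf.
pose D n := `[- n.+1%:R, n.+1%:R]%classic : set R.
pose F n x := ((fun x => bump n.+1%:R x * f x) \_ (D n)) x.
have mb n : measurable_fun setT (bump n.+1%:R).
  by apply: continuous_measurable_fun => x; apply: der_cont (der_bump _ _).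
have mF n : measurable_fun setT (F n).
  apply/(measurable_restrictT _ _).1; first exact: measurable_itv.
  apply: measurable_funTS.
  exact: measurable_funM.
have Fb n x : `|F n x| <= `|f x|.
  rewrite /F patchE; case: ifPn; last by rewrite normr0.
  rewrite inE /D/= in_itv/= => xn.
  have [/andP[b0 b1] _ _] := bump_itv (ltr0Sn R n) xn.
  by rewrite normrM (ger0_norm b0) ler_piMl.
have Fcvg x : F n x @[n --> \oo] --> f x.
  have : bump n.+1%:R x * f x @[n --> \oo] --> f x.
    by rewrite -[f x in X in _ --> X]mul1r; apply: cvgM; [exact: cvg_bump|exact: cvg_cst].
  apply: cvg_trans; apply: near_eq_cvg; near=> n.
  rewrite /F patchE ifT// inE /D/= in_itv/= -ler_norml.
  apply: (@le_trans _ _ n%:R); last by rewrite ler_nat.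
  by near: n; exact: nbhs_infty_ger.
have jF n : mu.-integrable setT (EFin \o F n).
  by apply: (le_intg measurableT (mF n) (fun x _ => Fb n x)); exact: (integrable_norm jf).
have c1 : {ae mu, forall x, setT x -> (EFin \o F n) x @[n --> \oo] --> (EFin \o f) x}.
  by apply: aeW => x _; apply: cvg_EFin; [exact: nearW|exact: Fcvg].
have c2 : {ae mu, forall x n, setT x ->
    (`|(EFin \o F n) x| <= (EFin \o (fun x => `|f x|)%R) x)%E}.
  by apply: aeW => x n _; rewrite lee_fin; exact: Fb.
have [_ _] := @dominated_convergence _ _ _ mu setT measurableT
  (fun n => EFin \o F n) (EFin \o f) (EFin \o (fun x => `|f x|))
  (fun n => (measurable_EFinP _ _).2 (mF n)) ((measurable_EFinP _ _).2 mf)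
  c1 (integrable_norm jf) c2.
rewrite /= -[X in _ --> X]fineK; last exact: integrable_fin_num.
move=> /fine_cvg; apply: cvg_trans; apply: near_eq_cvg; apply: nearW => n.
by rewrite /= Rintegral_mkcond.
Unshelve. all: by end_near.
Qed.

End cutoff.

(** * Green's identity with a cutoff *)

Lemma cvg_powR_nat {R : realType} (p : R) : p < 0 ->
  n.+1%:R `^ p @[n --> \oo] --> (0 : R).
Proof.
move=> p0; apply/cvgrPdist_lt => e e0.
have [A A1 HA] := @powR_large R (- p) (e^-1 + 1) (eq_rect _ is_true p0 _
  (esym (oppr_gt0 p))).
near=> n; rewrite sub0r normrN ger0_norm ?powR_ge0//.
have n0 : 0 < n.+1%:R :> R by [].
have An : A <= n.+1%:R.
  apply: (@le_trans _ _ n%:R); last by rewrite ler_nat.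
  by near: n; exact: nbhs_infty_ger.
have := HA _ An; rewrite powRN => h.
rewrite -[ltLHS]invrK -[ltRHS]invrK ltf_pV2 ?posrE ?invr_gt0 ?powR_gt0//; lra.
Unshelve. all: by end_near. Qed.

Section green.
Context {R : realType}.
Notation mu := (@lebesgue_measure R).
Variables (gamma eps : R).
Hypothesis gamma0 : 0 < gamma.
Hypothesis gamma1 : gamma < 1.
Hypothesis eps0 : 0 < eps.
Hypothesis eps1 : eps <= 1.
Hypothesis Z0 : 0 < partition_constant gamma eps.
Implicit Types (nu r x : R) (phi q h : R -> R).

Local Notation F := (force gamma).
Local Notation rho := (rho_inf gamma eps).
Local Notation ip := (inner gamma eps).
Local Notation L2 := (in_L2 gamma eps).

(** Up to sign, the commutator of the generator with the cutoff, applied to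
    [phi]. *)
Definition cutoff_error r phi phi1 x : R :=
  F x * bump1 r x * phi x - 2 * eps * phi1 x * bump1 r x - eps * phi x * bump2 r x.

Lemma continuous_cutoff_error nu phi phi1 r : 0 < r ->
  solves gamma eps nu phi phi1 -> continuous (cutoff_error r phi phi1).
Proof.
move=> r0 s; have [cphi cphi1] := solves_cont s.
have rn0 : r != 0 by rewrite gt_eqF.
have cb1 : continuous (bump1 r) by move=> x; exact: der_cont (der_bump1 _ rn0).
have cb2 : continuous (bump2 r).
  move=> x; have d : is_derive x 1 (bump2 r) (24 * (x / r) / r ^+ 3).
    by rewrite /bump2; der; field.
  exact: der_cont d.
have cF := continuous_force gamma0.
move=> x; apply: cvgB; last by apply: cvgM;
  [apply: cvgM; [exact: cvg_cst|exact: cphi]|exact: cb2].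
apply: cvgB; last by apply: cvgM;
  [apply: cvgM; [exact: cvg_cst|exact: cphi1]|exact: cb1].
by apply: cvgM; [apply: cvgM; [exact: cF|exact: cb1]|exact: cphi].
Qed.

(** Two integrations by parts at once: both integrands together are the
    derivative of chi (J phi - eps q phi') - eps q phi chi', where J is the flux
    of q and chi the cutoff, and this vanishes at the end points. *)
Lemma green_cutoff nu phi phi1 q q1 j r : 0 < r ->
  solves gamma eps nu phi phi1 ->
  (forall x, is_derive x 1 q (q1 x)) ->
  (forall x, is_derive x 1 (fun y => q y * F y + eps * q1 y) (j x)) ->
  continuous j ->
  \int[mu]_(x in `[- r, r]) (bump r x * ((j x + nu * q x) * phi x)) =
  - \int[mu]_(x in `[- r, r]) (q x * cutoff_error r phi phi1 x).
Proof.
move=> r0 s dq dJ cj; have [d1 d2] := s; have [cphi cphi1] := solves_cont s.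
have rn0 : r != 0 by rewrite gt_eqF.
have cq : continuous q by move=> x; exact: der_cont (dq x).
have cb : continuous (bump r) by move=> x; exact: der_cont (der_bump _ rn0).
pose f1 x := bump r x * ((j x + nu * q x) * phi x).
pose f2 x := q x * cutoff_error r phi phi1 x.
have cf1 : continuous f1.
  move=> x; apply: cvgM; first exact: cb.
  apply: cvgM; last exact: cphi.
  by apply: cvgD; [exact: cj|apply: cvgM; [exact: cvg_cst|exact: cq]].
have cf2 : continuous f2.
  move=> x; apply: cvgM; first exact: cq.
  exact: (continuous_cutoff_error r0 s).
pose J x := q x * F x + eps * q1 x.
pose G x := bump r x * (J x * phi x - eps * (q x * phi1 x)) -
  eps * (q x * phi x * bump1 r x).
have dG x : is_derive x 1 G (f1 x + f2 x).
  have ? := dq x; have dJx : is_derive x 1 J (j x) := dJ x.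
  have ? := d1 x; have ? := d2 x.
  have ? := der_bump x rn0; have ? := der_bump1 x rn0.
  rewrite /G; der; rewrite /f1 /f2 /cutoff_error /J; field.
  by rewrite gt_eqF.
apply/eqP; rewrite -addr_eq0 -RintegralD//; last 2 first.
- exact: integrable_segment.
- exact: integrable_segment.
have rr : - r <= r by lra.
have cf : continuous (fun x => f1 x + f2 x) by move=> x; apply: cvgD; [exact: cf1|exact: cf2].
rewrite -/(f1 _) -/(f2 _) (ftc_segment rr (fun x _ => dG x) cf) /G.
by have [-> -> -> ->] := bump_end rn0; rewrite !(mul0r, mulr0) !subrr.
Qed.

(** Since |V'| <= r^gamma on [-r, r] and the derivatives of the cutoff are of
    order 1/r, the error tends to 0 like r^(gamma - 1). *)
Lemma cutoff_bound nu phi phi1 q q1 j h r : 1 <= r ->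
  solves gamma eps nu phi phi1 ->
  (forall x, is_derive x 1 q (q1 x)) ->
  (forall x, is_derive x 1 (fun y => q y * F y + eps * q1 y) (j x)) ->
  continuous j ->
  (forall x, q x = h x * rho x) -> L2 h -> L2 phi -> L2 phi1 ->
  `|\int[mu]_(x in `[- r, r]) (bump r x * ((j x + nu * q x) * phi x))| <=
  20 * r `^ (gamma - 1) * (ip h h + ip phi phi + ip phi1 phi1).
Proof.
move=> r1 s dq dJ cj qh Lh Lphi Lphi1.
have r0 : 0 < r by lra.
rewrite (green_cutoff r0 s dq dJ cj) normrN.
set C := 20 * _.
have C0 : 0 <= C by rewrite mulr_ge0 ?powR_ge0.
pose w x := h x * h x * rho x + phi x * phi x * rho x + phi1 x * phi1 x * rho x.
have jw : mu.-integrable setT (EFin \o w).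
  by apply: intgD => //; [apply: intgD => //|]; exact: intg_mul.
have -> : ip h h + ip phi phi + ip phi1 phi1 = \int[mu]_x w x.
  rewrite /w !RintegralD//; try exact: intg_mul.
  by apply: intgD => //; exact: intg_mul.
have mI : measurable (`[- r, r]%classic : set R) by exact: measurable_itv.
have jf : mu.-integrable `[- r, r] (EFin \o (fun x => q x * cutoff_error r phi phi1 x)).
  apply: integrable_segment => x; apply: cvgM; first exact: der_cont (dq x).
  exact: (continuous_cutoff_error r0 s).
have jwI : mu.-integrable `[- r, r] (EFin \o w).
  exact: integrableS jw.
apply: (le_trans (le_normr_Rintegral _ jf)) => //.
apply: (@le_trans _ _ (\int[mu]_(x in `[- r, r]) (C * w x))).
  apply: le_Rintegral => //.
  - exact: (integrable_norm jf).
  - exact: (intgZ C mI jwI).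
  move=> x; rewrite /= in_itv/= => xr; have [_ B1 B2] := bump_itv r0 xr.
  have rx := rho_gt0 Z0 x.
  rewrite qh normrM normrM (gtr0_norm rx).
  rewrite (_ : C * w x = C * (h x ^+ 2 + phi x ^+ 2 + phi1 x ^+ 2) * rho x); last first.
    by rewrite /w; ring.
  rewrite mulrAC ler_pM2r//.
  have Fx : `|F x| <= r `^ gamma.
    rewrite (norm_force gamma0); apply: ge0_ler_powR; rewrite ?nnegrE ?(ltW gamma0) ?(ltW r0)//.
    by rewrite ler_norml.
  set X := r `^ (gamma - 1) in C C0 *.
  have FB : `|F x * bump1 r x| <= 4 * X.
    rewrite normrM (_ : 4 * X = r `^ gamma * (4 / r)); last first.
      by rewrite /X powR_Dgt0// powR_inv1 ?(ltW r0)//; ring.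
    exact: ler_pM.
  have rX : r^-1 <= X.
    by rewrite -powR_inv1 ?(ltW r0)// /X; apply: ler_powR => //; have := gamma0; lra.
  have ri : 0 < r^-1 by rewrite invr_gt0.
  have ri1 : r^-1 <= 1 by rewrite invf_le1.
  have rX2 : (r ^+ 2)^-1 <= X.
    by apply: le_trans rX; rewrite -exprVn expr2 ler_piMl ?(ltW ri).
  have EB1 : `|2 * eps * bump1 r x| <= 8 * X.
    rewrite normrM (gtr0_norm (_ : 0 < 2 * eps)) ?mulr_gt0//.
    have := ler_pM (ltW eps0) (normr_ge0 _) eps1 B1; lra.
  have EB2 : `|eps * bump2 r x| <= 16 * X.
    rewrite normrM (gtr0_norm eps0).
    have := ler_pM (ltW eps0) (normr_ge0 _) eps1 B2; lra.
  set H := `|h x|; set P := `|phi x|; set P1 := `|phi1 x|.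
  have E : `|cutoff_error r phi phi1 x| <= 20 * X * P + 8 * X * P1.
    rewrite /cutoff_error (_ : _ - _ - _ = (F x * bump1 r x - eps * bump2 r x) * phi x -
      2 * eps * bump1 r x * phi1 x); last by ring.
    apply: (le_trans (ler_normB _ _)); rewrite !(normrM _ (phi x)) (normrM _ (phi1 x)).
    apply: lerD; last by rewrite ler_wpM2r.
    rewrite ler_wpM2r//; apply: (le_trans (ler_normB _ _)); lra.
  have X0 : 0 <= X by exact: powR_ge0.
  have H0 : 0 <= H by exact: normr_ge0.
  have P0 : 0 <= P by exact: normr_ge0.
  have P10 : 0 <= P1 by exact: normr_ge0.
  apply: (le_trans (ler_wpM2l H0 E)).
  rewrite -(real_normK (num_real (h x))) -(real_normK (num_real (phi x))).
  rewrite -(real_normK (num_real (phi1 x))) -/H -/P -/P1 /C.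
  have h1 : H * (P + P1) <= H ^+ 2 + P ^+ 2 + P1 ^+ 2.
    have := sqr_ge0 (H - P); have := sqr_ge0 (H - P1).
    have := sqr_ge0 P; have := sqr_ge0 P1; lra.
  have := ler_wpM2l X0 h1.
  have := mulr_ge0 X0 (mulr_ge0 H0 P10); lra.
rewrite RintegralZl//.
rewrite ler_wpM2l// Rintegral_subset//.
by move=> x _; rewrite /w !addr_ge0// mulr_ge0 ?(ltW (rho_gt0 Z0 _))// -expr2 sqr_ge0.
Qed.

(** For q = u rho, with u an eigenfunction, the bounded integrand is a multiple
    of u phi rho, and letting r tend to infinity gives (nu - m) <u, phi> = 0. *)
Lemma eigen_orthogonal m nu u phi : m != nu ->
  eigenfunction gamma eps m u -> eigenfunction gamma eps nu phi ->
  L2 (derive1 phi) -> ip u phi = 0.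
Proof.
move=> mnu eu ephi Lphi1.
have su := eigenfunction_solves gamma0 eps0 eu.
have sphi := eigenfunction_solves gamma0 eps0 ephi.
have [Lu _ _ _ _] := eu; have [Lphi _ _ _ _] := ephi.
have [cu cu1] := solves_cont su.
have [d1 d2] := su.
pose q x := u x * rho x.
pose q1 x := derive1 u x * rho x - u x * (F x / eps * rho x).
pose j x := - m * (u x * rho x).
have dq x : is_derive x 1 q (q1 x).
  by have ? := d1 x; have ? := der_rho eps gamma0 x; rewrite /q; der; rewrite /q1; ring.
have dJ x : is_derive x 1 (fun y => q y * F y + eps * q1 y) (j x).
  rewrite (_ : (fun _ => _) = fun y => eps * (derive1 u y * rho y)); last first.
    by apply/funext => y; rewrite /q /q1; field; rewrite gt_eqF.
  have ? := d2 x; have ? := der_rho eps gamma0 x; der; rewrite /j; field.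
  by rewrite gt_eqF.
have cj : continuous j.
  move=> x; apply: cvgM; first exact: cvg_cst.
  by apply: cvgM; [exact: cu|exact: continuous_rho].
pose S := ip u u + ip phi phi + ip (derive1 phi) (derive1 phi).
have B n : `|(nu - m) * \int[mu]_(x in `[- n.+1%:R, n.+1%:R])
    (bump n.+1%:R x * (u x * phi x * rho x))| <= 20 * n.+1%:R `^ (gamma - 1) * S.
  have n1 : 1 <= n.+1%:R :> R by rewrite ler1n.
  rewrite -RintegralZl//; last first.
    apply: integrable_segment => x; apply: cvgM.
      by apply: der_cont (der_bump _ _).
    by apply: cvgM; [apply: cvgM; [exact: cu|exact: (solves_cont sphi).1]
                    |exact: continuous_rho].
  have := cutoff_bound n1 sphi dq dJ cj (fun=> erefl) Lu Lphi Lphi1.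
  apply: le_trans; apply: eq_ler; congr (`| _ |).
  by apply: eq_Rintegral => x _; rewrite /j /q; ring.
have c1 : (nu - m) * \int[mu]_(x in `[- n.+1%:R, n.+1%:R])
    (bump n.+1%:R x * (u x * phi x * rho x)) @[n --> \oo] --> (nu - m) * ip u phi.
  by apply: cvgM; [exact: cvg_cst|apply: cutoff_cvg; exact: intg_mul].
have c2 : 20 * n.+1%:R `^ (gamma - 1) * S @[n --> \oo] --> 20 * 0 * S.
  apply: cvgM; last exact: cvg_cst.
  apply: cvgM; first exact: cvg_cst.
  by apply: cvg_powR_nat; rewrite subr_lt0.
have : (nu - m) * ip u phi = 0.
  apply: (cvg_unique (@norm_hausdorff _ _) c1).
  apply: norm_cvg0.
  apply: (@squeeze_cvgr _ _ _ _ (fun=> 0) (fun n => 20 * n.+1%:R `^ (gamma - 1) * S)).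
  - by apply: nearW => n; rewrite normr_ge0 B.
  - exact: cvg_cst.
  - by move: c2; rewrite mulr0 mul0r.
by move/eqP; rewrite mulf_eq0 subr_eq0 eq_sym (negPf mnu) => /eqP.
Qed.

End green.

(** * Uniqueness of the spectral basis *)

Section unit_noise.
Context {R : realType}.
Variable gamma : R.
Hypothesis gamma0 : 0 < gamma.
Hypothesis gamma1 : gamma < 1.
Hypothesis Z0 : 0 < partition_constant gamma 1.
Implicit Types (lambda : R) (u : R -> R).

Lemma eigenfunction_slow lambda u : eigenfunction gamma 1 lambda u ->
  slow_solution gamma lambda u (derive1 u).
Proof.
move=> e; have s := eigenfunction_solves gamma0 ltr01 e.
case: e => Lu u0 _ _ _; split=> //.
- apply: contra_notP u0 => /forallNP h; apply/funext => x.
  by have /negP := h x; rewrite negbK => /eqP.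
- exact: slow_growth_L2 (solves_cont s).1 Lu.
Qed.

Lemma eigenfunction_reflect lambda u : eigenfunction gamma 1 lambda u ->
  eigenfunction gamma 1 lambda (fun x => u (- x)).
Proof.
move=> e; have n1 : (- 1 : R) != 0 by rewrite oppr_eq0 oner_eq0.
have E : (1 : R) = `|- 1| `^ (gamma + 1) * 1 by rewrite normrN1 powR1 mulr1.
have := eigenfunction_scale gamma0 n1 ltr01 E e.
rewrite normrN1 powR1 mul1r; congr eigenfunction; apply/funext => x.
by rewrite mulN1r.
Qed.

Lemma derive1_reflect lambda u : eigenfunction gamma 1 lambda u ->
  derive1 (fun x => u (- x)) = fun x => - derive1 u (- x).
Proof.
move=> e; have [d _] := solves_reflect (eigenfunction_solves gamma0 ltr01 e).
by apply/funext => x; rewrite derive1E; have [_ ->] := d x.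
Qed.

(** Far out u' is bounded by a multiple of u, on both sides. *)
Lemma derive1_in_L2 lambda u : 0 < lambda -> eigenfunction gamma 1 lambda u ->
  in_L2 gamma 1 (derive1 u).
Proof.
move=> l0 e; have s := eigenfunction_solves gamma0 ltr01 e.
have [cu cu1] := solves_cont s.
have half v : eigenfunction gamma 1 lambda v -> exists2 A, 1 <= A &
    forall x, A <= x -> derive1 v x ^+ 2 <= (2 * lambda) ^+ 2 * v x ^+ 2.
  move=> ev; have sv := eigenfunction_slow ev.
  have [A A1 HA] := log_derivative_bounds gamma0 gamma1 l0 sv.
  exists A => // x Ax; have [vx h1 h2] := HA x Ax.
  have p1 : x `^ (- gamma) <= 1.
    by apply: powR_le1; [lra|rewrite oppr_le0 ltW].
  have q0 : 0 <= derive1 v x / v x.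
    by apply: le_trans h1; rewrite mulr_ge0 ?powR_ge0 ?(ltW l0).
  have q1 : derive1 v x / v x <= 2 * lambda.
    by apply: (le_trans h2); rewrite ler_piMr// mulr_ge0// ltW.
  have -> : derive1 v x ^+ 2 = (derive1 v x / v x) ^+ 2 * v x ^+ 2 by field.
  rewrite ler_wpM2r ?sqr_ge0// ler_pXn2r ?nnegrE//.
  exact: le_trans q1.
have [A A1 HA] := half u e.
have [B B1 HB] := half _ (eigenfunction_reflect e).
have cs : continuous (fun x => derive1 u x * derive1 u x).
  by move=> x; apply: cvgM; exact: cu1.
have BA : - B <= A by lra.
have [c _ Hc] := EVT_max BA (continuous_subspaceT cs).
have [Lu _ _ _ _] := e.
apply: (L2_dominated gamma0 Z0 _ Lu (c := (2 * lambda) ^+ 2) (d := derive1 u c * derive1 u c)).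
  exact: continuous_measurable_fun.
move=> x.
have [Ax|xA] := leP A x; first by rewrite (le_trans (HA x Ax))// lerDl -expr2 sqr_ge0.
have [xB|Bx] := leP x (- B).
  have : B <= - x by rewrite lerNr.
  move=> /HB; rewrite (derive1_reflect e) !opprK sqrrN => /le_trans; apply.
  by rewrite lerDl -expr2 sqr_ge0.
rewrite [leLHS]expr2; apply: (le_trans (Hc x _)); first by rewrite in_itv/= !ltW.
by rewrite lerDr mulr_ge0 ?sqr_ge0.
Qed.

End unit_noise.

Section spectral.
Context {R : realType}.
Variables (gamma : R).
Hypothesis gamma0 : 0 < gamma.
Hypothesis gamma1 : gamma < 1.
Implicit Types (lambda : nat -> R) (psi : nat -> R -> R).

(** A divergent integral would give the partition constant, hence the weight, the
    value 0, against the normalization of the constant eigenfunction. *)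
Lemma partition_gt0 eps lambda psi : spectral_basis gamma eps lambda psi ->
  0 < partition_constant gamma eps.
Proof.
move=> sb; rewrite lt_neqAle Rintegral_ge0; last by move=> x _; exact: expR_ge0.
rewrite andbT; apply/eqP => Z.
have := psi_orthonormal sb 0 0; rewrite eqxx /inner.
under eq_Rintegral do rewrite /rho_inf -Z invr0 mul0r mulr0.
by rewrite Rintegral_cst// mul0r => /eqP; rewrite eq_sym oner_eq0.
Qed.

Lemma eigenvalue_gt0 eps lambda psi k : spectral_basis gamma eps lambda psi ->
  (0 < k)%N -> 0 < lambda k.
Proof. by move=> sb k0; rewrite -(eigenvalue0 sb); exact: (eigenvalue_lt sb). Qed.

Lemma eigenvalue_inj eps lambda psi j k : spectral_basis gamma eps lambda psi ->
  lambda j = lambda k -> j = k.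
Proof.
move=> sb jk; apply/eqP; rewrite eqn_leq; apply/andP; split; rewrite leqNgt;
  apply/negP => /(eigenvalue_lt sb); rewrite jk ltxx//.
Qed.

Lemma basis_derive1_in_L2 lambda psi k : spectral_basis gamma 1 lambda psi ->
  in_L2 gamma 1 (derive1 (psi k)).
Proof.
move=> sb; have Z0 := partition_gt0 sb; case: k => [|k].
  rewrite (eigenfunction0 sb) (_ : derive1 _ = cst 0); first exact: L2_cst.
  by apply/funext => x; rewrite derive1_cst.
exact: (derive1_in_L2 gamma0 gamma1 Z0 (eigenvalue_gt0 sb _) (eigenfunctionP sb _)).
Qed.

Lemma projection_eigen lambda psi m u n : spectral_basis gamma 1 lambda psi ->
  eigenfunction gamma 1 m u ->
  projection gamma 1 psi n u =
  fun x => \sum_(0 <= k < n.+1 | lambda k == m) inner gamma 1 u (psi k) * psi k x.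
Proof.
move=> sb e; apply/funext => x; rewrite /projection [RHS]big_mkcond/=.
apply: eq_bigr => k _; case: eqP => // /eqP lm.
rewrite (eigen_orthogonal gamma0 gamma1 ltr01 (lexx 1) (partition_gt0 sb) _ e
  (eigenfunctionP sb k) (basis_derive1_in_L2 k sb)) ?mul0r//.
by rewrite eq_sym.
Qed.

(** The spectrum at unit noise is exhausted by the basis, each eigenvalue being
    simple: an eigenfunction is orthogonal to all basis elements with another
    eigenvalue, and there is nothing else by completeness. *)
Lemma spectral_uniqueness lambda psi m u : spectral_basis gamma 1 lambda psi ->
  eigenfunction gamma 1 m u ->
  exists2 k, m = lambda k & forall x, u x = inner gamma 1 u (psi k) * psi k x.
Proof.
move=> sb e; have Z0 := partition_gt0 sb.
have [Lu u0 _ _ _] := e.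
have Lpsi k : in_L2 gamma 1 (psi k) by have [] := eigenfunctionP sb k.
have cont v mv : eigenfunction gamma 1 mv v -> continuous v.
  by move=> ev; exact: (solves_cont (eigenfunction_solves gamma0 ltr01 ev)).1.
(* the remainder of the expansion is eventually constant, hence null *)
have key (w : R -> R) N : in_L2 gamma 1 w -> continuous w ->
    (forall n, (N <= n)%N -> u \- projection gamma 1 psi n u = w) -> forall x, w x = 0.
  move=> Lw cw H; apply: (inner_eq0 gamma0 Z0 Lw cw).
  have := psi_complete sb Lu => cv.
  have n0 : norm2 gamma 1 w = 0.
    have cw' : norm2 gamma 1 w @[n --> \oo] --> norm2 gamma 1 w by exact: cvg_cst.
    apply: (cvg_unique (@norm_hausdorff _ _) cw').
    apply: cvg_trans cv; apply: near_eq_cvg; near=> n.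
    by rewrite H//; near: n; exact: nbhs_infty_ge.
  by rewrite -(sqr_norm2 Z0) n0 expr0n.
have [[k mk]|nk] := pselect (exists k, m = lambda k).
  exists k => // x; apply/eqP; rewrite -subr_eq0; apply/eqP.
  apply: (key (fun x => u x - inner gamma 1 u (psi k) * psi k x) k).
  - by apply: (L2B gamma0 Z0 Lu); exact: L2Z.
  - move=> y; apply: cvgB; first exact: (cont _ _ e).
    by apply: cvgM; [exact: cvg_cst|exact: (cont _ _ (eigenfunctionP sb k))].
  move=> n kn; apply/funext => y /=; rewrite (projection_eigen n sb e); congr (_ - _).
  rewrite big_mkord (bigD1 (Ordinal (kn : (k < n.+1)%N)))/=; last by rewrite mk eqxx.
  rewrite big1 ?addr0// => i /andP[/eqP h]; rewrite mk in h.
  by move/eqP; case; apply/val_inj => /=; exact: (eigenvalue_inj sb).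
exfalso; apply: u0; apply/funext => x; apply: (key u 0%N Lu (cont _ _ e)).
move=> n _; apply/funext => y /=; rewrite (projection_eigen n sb e) big1 ?subr0//.
by move=> i /eqP h; case: nk; exists i.
Unshelve. all: by end_near. Qed.

(** The reflected function is an eigenfunction for the same simple eigenvalue,
    and reflecting twice is the identity. *)
Lemma basis_parity lambda psi k : spectral_basis gamma 1 lambda psi ->
  exists2 c : R, c ^+ 2 = 1 & forall x, psi k (- x) = c * psi k x.
Proof.
move=> sb; have Z0 := partition_gt0 sb.
have ek := eigenfunctionP sb k.
have [j lj E] := spectral_uniqueness sb (eigenfunction_reflect gamma0 ek).
rewrite -(eigenvalue_inj sb lj) in E; set c := inner _ _ _ _ in E.
exists c => //.
have [x px] : exists x, psi k x != 0.
  by have [_ ? _] := eigenfunction_slow gamma0 gamma1 Z0 ek.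
have := E (- x); rewrite opprK E mulrA -expr2 => h.
by apply: (mulIf px); rewrite mul1r.
Qed.

End spectral.

(** * Comparison of spectral bases at different noise intensities *)

Section sequences.
Context {R : realType}.

(** The index j with f k = g j increases with k, hence is at least k. *)
Lemma incr_range_le (f g : nat -> R) :
  (forall j k, (j < k)%N -> f j < f k) -> (forall j k, (j < k)%N -> g j < g k) ->
  (forall k, exists j, f k = g j) -> forall k, g k <= f k.
Proof.
move=> fi gi fg k; suff [j kj ->] : exists2 j, (k <= j)%N & f k = g j.
  by move: kj; rewrite leq_eqVlt => /predU1P[->//|/gi/ltW].
elim: k => [|k [j kj fk]]; first by have [j] := fg 0%N; exists j.
have [i fi'] := fg k.+1; exists i => //.
apply: (leq_ltn_trans kj); rewrite ltnNge; apply/negP.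
rewrite leq_eqVlt => /predU1P[ij|/gi ij].
  by have := fi k k.+1 (ltnSn k); rewrite fk fi' ij ltxx.
have := fi k k.+1 (ltnSn k); rewrite fk fi' => h.
by have := lt_trans h ij; rewrite ltxx.
Qed.

End sequences.

Section scaled_basis.
Context {R : realType}.
Variables (gamma s : R).
Hypothesis gamma0 : 0 < gamma.
Hypothesis gamma1 : gamma < 1.
Hypothesis s0 : 0 < s.
Implicit Types (lambda : nat -> R) (psi : nat -> R -> R).

Let eps := s `^ (gamma + 1).

Let eps0 : 0 < eps. Proof. exact: powR_gt0. Qed.

Let s_neq0 : s != 0. Proof. by rewrite gt_eqF. Qed.

Let epsE : eps = `|s| `^ (gamma + 1) * 1.
Proof. by rewrite gtr0_norm// mulr1. Qed.

Let oneE : 1 = `|s^-1| `^ (gamma + 1) * eps.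
Proof.
rewrite gtr0_norm ?invr_gt0// -powRM ?invr_ge0 ?(ltW s0)// mulVf// powR1//.
Qed.

Lemma partition_unit_gt0 : 0 < partition_constant gamma eps ->
  0 < partition_constant gamma 1.
Proof. by rewrite (partition_scale gamma0 s_neq0 ltr01 epsE) pmulr_rgt0// normr_gt0. Qed.

Lemma scaled_basis lambda psi : spectral_basis gamma eps lambda psi ->
  spectral_basis gamma 1 (fun k => s `^ (1 - gamma) * lambda k)
    (fun k x => psi k (s * x)).
Proof.
move=> sb; have Z0 := partition_gt0 sb.
have Z1 := partition_unit_gt0 Z0.
have p0 : 0 < s `^ (1 - gamma) by exact: powR_gt0.
have Lpsi k : in_L2 gamma eps (psi k) by have [] := eigenfunctionP sb k.
split.
- by rewrite (eigenvalue0 sb) mulr0.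
- by move=> j k jk; rewrite ltr_pM2l// (eigenvalue_lt sb).
- apply/cvgryPge => A; have /cvgryPge/(_ (A / s `^ (1 - gamma))) := eigenvalue_cvg sb.
  by apply: filterS => k; rewrite ler_pdivrMr// mulrC.
- by rewrite (eigenfunction0 sb).
- move=> k; have := eigenfunction_scale gamma0 s_neq0 ltr01 epsE (eigenfunctionP sb k).
  by rewrite gtr0_norm.
- by move=> j k; rewrite -(inner_scale gamma0 s_neq0 ltr01 epsE Z0)// (psi_orthonormal sb).
- move=> f Lf.
  pose g x := f (s^-1 * x).
  have Lg : in_L2 gamma eps g.
    by apply: (in_L2_scale gamma0 _ eps0 oneE Lf); rewrite invr_eq0.
  have gE x : g (s * x) = f x by rewrite /g mulrA mulVf// mul1r.
  have := psi_complete sb Lg; apply: cvg_trans; apply: near_eq_cvg; apply: nearW => n.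
  have Lp : in_L2 gamma eps (projection gamma eps psi n g).
    by apply: (L2_sum gamma0 Z0) => k; exact: L2Z.
  have L := L2B gamma0 Z0 Lg Lp.
  rewrite /norm2 (inner_scale gamma0 s_neq0 ltr01 epsE Z0 L L).
  suff -> : (f \- projection gamma 1 (fun k x => psi k (s * x)) n f) =
    fun x => g (s * x) - projection gamma eps psi n g (s * x) by [].
  apply/funext => x /=; rewrite gE /projection; congr (_ - _).
  apply: eq_bigr => k _; congr (_ * _).
  rewrite (inner_scale gamma0 s_neq0 ltr01 epsE Z0 Lg (Lpsi k)).
  by congr inner; apply/funext => y; rewrite gE.
Qed.

(** Dilated, a basis at noise s^(gamma + 1) is a basis at unit noise, and the
    latter is unique up to signs. *)
Lemma basis_scaling lambda1 psi1 lambda psi :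
  spectral_basis gamma 1 lambda1 psi1 -> spectral_basis gamma eps lambda psi ->
  (forall k, s `^ (1 - gamma) * lambda k = lambda1 k) /\
  (forall k, exists2 c : R, c ^+ 2 = 1 & forall x, psi k (s * x) = c * psi1 k x).
Proof.
move=> sb1 sb; have sb' := scaled_basis sb.
have inc1 := eigenvalue_lt sb1; have inc' := eigenvalue_lt sb'.
have E k : s `^ (1 - gamma) * lambda k = lambda1 k.
  apply/le_anti/andP; split.
    apply: (incr_range_le inc1 inc') => j.
    have [i ->] := spectral_uniqueness gamma0 gamma1 sb' (eigenfunctionP sb1 j).
    by exists i.
  apply: (incr_range_le inc' inc1) => j.
  have [i ->] := spectral_uniqueness gamma0 gamma1 sb1 (eigenfunctionP sb' j).
  by exists i.
split=> // k.
have [j lj H] := spectral_uniqueness gamma0 gamma1 sb1 (eigenfunctionP sb' k).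
have jk : j = k by apply: (eigenvalue_inj sb1); rewrite -lj /= E.
subst j; set c := inner _ _ _ _ in H; exists c => //.
have Z1 := partition_gt0 sb1.
have Lp : in_L2 gamma 1 (psi1 k) by have [] := eigenfunctionP sb1 k.
have := psi_orthonormal sb' k k; rewrite eqxx (_ : (fun x => psi k (s * x)) = fun x => c * psi1 k x).
  rewrite (innerZl gamma0 Z1)//; last exact: L2Z.
  rewrite innerC (innerZl gamma0 Z1)// (psi_orthonormal sb1) eqxx mulr1 -expr2.
  by [].
by apply/funext => x; rewrite H.
Qed.

Lemma basis_derive1_in_L2_eps lambda psi k : spectral_basis gamma eps lambda psi ->
  in_L2 gamma eps (derive1 (psi k)).
Proof.
move=> sb; have Z0 := partition_gt0 sb; have sb' := scaled_basis sb.
have [d1 _] := eigenfunction_solves gamma0 eps0 (eigenfunctionP sb k).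
have L := basis_derive1_in_L2 gamma0 gamma1 k sb'.
have sV : s^-1 != 0 by rewrite invr_eq0.
have := L2Z gamma0 Z0 s^-1 (in_L2_scale gamma0 sV eps0 oneE L).
congr in_L2; apply/funext => x.
have dl (y : R) : is_derive y 1 (fun z => s * z) s by der; ring.
rewrite derive1E; have [_ ->] := der_comp (d1 (s * (s^-1 * x))) (dl (s^-1 * x)).
by rewrite (mulVKf s_neq0) mulrCA mulVf// mulr1.
Qed.

End scaled_basis.

(** * Evolution of the spectral coefficients *)

Section evolution.
Context {R : realType}.
Notation mu := (@lebesgue_measure R).
Variables (gamma eps nu : R) (rho0 phi : R -> R) (rho : R -> R -> R).
Hypothesis gamma0 : 0 < gamma.
Hypothesis gamma1 : gamma < 1.
Hypothesis eps0 : 0 < eps.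
Hypothesis eps1 : eps <= 1.
Hypothesis Z0 : 0 < partition_constant gamma eps.
Hypothesis nu0 : 0 <= nu.
Hypothesis ephi : eigenfunction gamma eps nu phi.
Hypothesis Lphi1 : in_L2 gamma eps (derive1 phi).
Hypothesis sol : fokker_planck_solution gamma eps rho0 rho.

Local Notation F := (force gamma).
Local Notation ip := (inner gamma eps).
Local Notation L2 := (in_L2 gamma eps).
Implicit Types (s t x a b K : R) (n : nat).

Let h t := density_ratio gamma eps (rho t).
Let j t x := derive1 (rho^~ x) t.

Let Lh t : 0 <= t -> L2 (h t). Proof. exact: (fp_L2 sol). Qed.

Let Lphi : L2 phi. Proof. by case: ephi. Qed.

Let sphi : solves gamma eps nu phi (derive1 phi).
Proof. exact: (eigenfunction_solves gamma0 eps0 ephi). Qed.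

Let cphi : continuous phi. Proof. exact: (solves_cont sphi).1. Qed.

Let rhoE t x : rho t x = h t x * rho_inf gamma eps x.
Proof. by rewrite /h /density_ratio divfK// gt_eqF// rho_gt0. Qed.

Let crho t : 0 < t -> continuous (rho t).
Proof.
move=> t0 x; apply/differentiable_continuous/derivable1_diffP.
exact: (fp_derivable_x sol).
Qed.

Let cj t : 0 < t -> continuous (j t).
Proof.
move=> t0 x; have c := (@fp_continuous_t _ _ _ _ _ sol t x t0).
apply: (@cvg_comp _ _ _ (fun y => (t, y)) (fun p : R * R => derive1 (rho^~ p.2) p.1)
  _ _ _ _ c).
have := @cvg_pair _ _ _ (nbhs x) (nbhs t) (nbhs x) _ _ _ (fun=> t) id.
by apply; [exact: cvg_cst|exact: cvg_id].
Qed.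

Let C n t := \int[mu]_(x in `[- n.+1%:R, n.+1%:R]) (bump n.+1%:R x * (rho t x * phi x)).

Let cbump n : continuous (bump (n.+1%:R : R)).
Proof. by move=> x; apply: der_cont (der_bump _ _). Qed.

Let cCint n t : 0 < t -> continuous (fun x => bump n.+1%:R x * (rho t x * phi x)).
Proof.
move=> t0 x; apply: cvgM; first exact: cbump.
by apply: cvgM; [exact: crho|exact: cphi].
Qed.

(** The time derivative of the density is bounded on compact sets of positive
    times, being jointly continuous, which allows differentiation under the
    integral. *)
Lemma der_cutoff_moment n t : 0 < t -> is_derive t 1 (C n)
  (\int[mu]_(x in `[- n.+1%:R, n.+1%:R]) (bump n.+1%:R x * (j t x * phi x))).
Proof.
move=> t0; set N : R := n.+1%:R.
have N0 : 0 < N by [].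
pose f s x := bump N x * (rho s x * phi x).
have df s x : 0 < s -> is_derive s 1 (fun s => f s x) (bump N x * (j s x * phi x)).
  move=> s0; have ? : is_derive s 1 (rho^~ x) (j s x).
    by rewrite /j derive1E; apply: derivableP; exact: (fp_derivable_t sol).
  by rewrite /f; der; ring.
have [M M0 HM] : exists2 M : R, 0 <= M & forall s x, t / 2 <= s <= t + 1 ->
    - N <= x <= N -> `|j s x| <= M.
  pose A : set (R * R) := `[t / 2, t + 1]%classic `*` `[- N, N]%classic.
  have cA : compact A by apply: compact_setX; exact: segment_compact.
  have [p pA Hp] : exists2 p, p \in A & forall q, q \in A ->
      `|derive1 (rho^~ q.2) q.1| <= `|derive1 (rho^~ p.2) p.1|.
    apply: (@compact_EVT_max _ R (fun q : R * R => `|derive1 (rho^~ q.2) q.1|) A) => //.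
      exists (t, 0); split; rewrite /= in_itv/=; apply/andP; split; lra.
    apply: continuous_in_subspaceT => -[s x] /[!inE] -[/=].
    rewrite !in_itv/= => /andP[sl _] _.
    have s0 : 0 < s by lra.
    by apply: cvg_norm; exact: (@fp_continuous_t _ _ _ _ _ sol s x s0).
  exists `|derive1 (rho^~ p.2) p.1| => // s x ts Nx.
  by apply: (Hp (s, x)); rewrite inE; split; rewrite /= in_itv.
have tI : `]t / 2, (t + 1)[%classic t.
  by rewrite /= in_itv/=; apply/andP; split; lra.
have mB : measurable (`[- N, N]%classic : set R) by exact: measurable_itv.
have sI s : `]t / 2, (t + 1)[%classic s -> 0 < s /\ t / 2 <= s <= t + 1.
  rewrite /= in_itv/= => /andP[s1 s2]; split; first lra.
  by rewrite !ltW.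
have intf s : `]t / 2, (t + 1)[%classic s -> mu.-integrable `[- N, N] (EFin \o f s).
  by move=> /sI[s0 _]; apply: integrable_segment; exact: cCint.
have derf s x : `]t / 2, (t + 1)[%classic s -> `[- N, N]%classic x -> derivable (f^~ x) s 1.
  by move=> /sI[s0 _] _; exact: der_derivable (df s x s0).
pose G x := M * `|phi x|.
have G0 x : 0 <= G x by rewrite mulr_ge0.
have intG : mu.-integrable `[- N, N] (EFin \o G).
  apply: integrable_segment => x; apply: cvgM; first exact: cvg_cst.
  by apply: cvg_norm; exact: cphi.
have Gub s x : `]t / 2, (t + 1)[%classic s -> `[- N, N]%classic x ->
    `|derive1 (f^~ x) s| <= G x.
  move=> /sI[s0 sI'] /=; rewrite in_itv/= => xN.
  rewrite derive1E; have [_ ->] := df s x s0.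
  have [/andP[b0 b1] _ _] := bump_itv N0 xN.
  rewrite normrM (ger0_norm b0) normrM /G.
  rewrite -[leRHS]mul1r; apply: ler_pM => //.
  by rewrite ler_wpM2r// HM.
have d := @derivable_under_integral R _ _ mu f `[- N, N] mB t (t / 2) (t + 1) tI
  intf derf G G0 intG Gub.
have v := @differentiation_under_integral R _ _ mu f `[- N, N] mB t (t / 2) (t + 1) tI
  intf derf G G0 intG Gub.
apply: DeriveDef; first exact: d.
rewrite -derive1E [LHS]v; apply: eq_Rintegral => x _.
by rewrite /partial1of2 derive1E; have [_ ->] := df t x t0.
Qed.

Let E t := expR (nu * t) * ip (h t) phi.

Lemma cvg_cutoff_moment t : 0 < t -> C n t @[n --> \oo] --> ip (h t) phi.
Proof.
move=> t0; have := cutoff_cvg (intg_mul gamma0 Z0 (Lh (ltW t0)) Lphi).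
rewrite -/(inner _ _ _ _); apply: cvg_trans; apply: near_eq_cvg; apply: nearW => n.
by apply: eq_Rintegral => x _; rewrite rhoE; ring.
Qed.

(** By Green's identity the cut off version of e^(nu t) <h_t, phi> has a time
    derivative of order r^(gamma - 1), uniformly while the norm of h_t is
    bounded; in the limit it is constant. *)
Lemma moment_const_bounded a b K : 0 < a -> a <= b ->
  (forall s, a <= s <= b -> ip (h s) (h s) <= K) -> E b = E a.
Proof.
move=> a0 ab HK.
pose S := K + ip phi phi + ip (derive1 phi) (derive1 phi).
pose Q := expR (nu * b) * (20 * S) * (b - a).
have B n : `|expR (nu * b) * C n b - expR (nu * a) * C n a| <= Q * n.+1%:R `^ (gamma - 1).
  pose dC t := \int[mu]_(x in `[- n.+1%:R, n.+1%:R]) (bump n.+1%:R x * (j t x * phi x)).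
  have dEn t : a <= t <= b -> is_derive t 1 (fun t => expR (nu * t) * C n t)
      (expR (nu * t) * (dC t + nu * C n t)).
    move=> /andP[at_ _]; have t0 : 0 < t by lra.
    by have ? := der_cutoff_moment n t0; der; rewrite /dC; ring.
  have [t /andP[at_ tb] ->] := mvt ab dEn.
  have t0 : 0 < t by lra.
  have n1 : 1 <= n.+1%:R :> R by rewrite ler1n.
  have dq x : is_derive x 1 (rho t) (derive1 (rho t) x).
    by rewrite derive1E; apply: derivableP; exact: (fp_derivable_x sol).
  have dJ x : is_derive x 1 (fun y => rho t y * F y + eps * derive1 (rho t) y) (j t x).
    have := @fp_derivable_flux _ _ _ _ _ sol t x t0; have := @fp_equation _ _ _ _ _ sol t x t0.
    rewrite (derive1_potential gamma0) => e d; rewrite /j e derive1E; exact: derivableP.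
  have := cutoff_bound gamma0 eps0 eps1 Z0 n1 sphi dq dJ (cj t0) (rhoE t) (Lh (ltW t0)) Lphi Lphi1.
  have -> : \int[mu]_(x in `[- n.+1%:R, n.+1%:R])
      (bump n.+1%:R x * ((j t x + nu * rho t x) * phi x)) = dC t + nu * C n t.
    rewrite /dC /C -RintegralZl//; last by apply: integrable_segment; exact: cCint.
    rewrite -RintegralD//.
    - by apply: eq_Rintegral => x _; ring.
    - apply: integrable_segment => x; apply: cvgM; first exact: cbump.
      by apply: cvgM; [exact: cj|exact: cphi].
    - by apply: intgZ => //; apply: integrable_segment; exact: cCint.
  move=> H; rewrite normrM (ger0_norm (_ : 0 <= b - a)) ?subr_ge0//.
  rewrite /Q mulrAC ler_wpM2r ?subr_ge0// normrM (gtr0_norm (expR_gt0 _)).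
  rewrite -mulrA; apply: ler_pM; rewrite ?expR_ge0//.
    by rewrite ler_expR ler_wpM2l.
  apply: (le_trans H); rewrite mulrAC ler_wpM2r ?powR_ge0// ler_pM2l//.
  by rewrite /S !lerD2r HK// at_.
have c1 : expR (nu * b) * C n b - expR (nu * a) * C n a @[n --> \oo] --> E b - E a.
  by apply: cvgB; (apply: cvgM; first exact: cvg_cst); apply: cvg_cutoff_moment => //;
    lra.
have c2 : Q * n.+1%:R `^ (gamma - 1) @[n --> \oo] --> Q * 0.
  by apply: cvgM; [exact: cvg_cst|apply: cvg_powR_nat; rewrite subr_lt0].
apply/eqP; rewrite -subr_eq0; apply/eqP.
apply: (cvg_unique (@norm_hausdorff _ _) c1); apply: norm_cvg0.
apply: (@squeeze_cvgr _ _ _ _ (fun=> 0) (fun n => Q * n.+1%:R `^ (gamma - 1))).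
- by apply: nearW => n; rewrite normr_ge0 B.
- exact: cvg_cst.
- by move: c2; rewrite mulr0.
Qed.

Let cont_h t e : 0 <= t -> 0 < e -> \forall s \near t, 0 <= s ->
  ip (fun x => h s x - h t x) (fun x => h s x - h t x) < e.
Proof.
move=> t0 e0; pose r := Num.min 1 e.
have r0 : 0 < r by rewrite lt_min ltr01.
have /cvgrPdist_lt/(_ _ r0) := fp_continuous sol t0.
rewrite near_withinE; apply: filterS => s H s0.
have {}H := H s0; rewrite sub0r normrN in H.
set g := (fun x => h s x - h t x).
have H' : norm2 gamma eps g < r by apply: le_lt_trans H; exact: ler_norm.
rewrite -(sqr_norm2 Z0) expr2.
have n0 : 0 <= norm2 gamma eps g by exact: sqrtr_ge0.
have [r1 re] : r <= 1 /\ r <= e by rewrite !ge_min !lexx orbT.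
have : norm2 gamma eps g * norm2 gamma eps g <= norm2 gamma eps g.
  by rewrite ler_piMl// ltW// (lt_le_trans H').
by move=> /le_lt_trans; apply; apply: (lt_le_trans H').
Qed.

Lemma moment_locally_const t : 0 < t -> \forall s \near t, E s = E t.
Proof.
move=> t0; have bnd : \forall s \near t, 0 < s /\ ip (h s) (h s) <= 2 * ip (h t) (h t) + 2.
  near=> s.
  have s0 : 0 < s by near: s; exact: lt_nbhsr.
  split=> //.
  have Ls := Lh (ltW s0); have Lt := Lh (ltW t0).
  have Ld := L2B gamma0 Z0 Ls Lt.
  have : ip (fun x => h s x - h t x) (fun x => h s x - h t x) < 1.
    have : 0 <= s by exact: ltW.
    by near: s; apply: cont_h => //; exact: ltW.
  suff : ip (h s) (h s) <= 2 * ip (fun x => h s x - h t x) (fun x => h s x - h t x) +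
      2 * ip (h t) (h t) by lra.
  rewrite /inner -!RintegralZl//; try exact: (intg_mul gamma0 Z0).
  rewrite -RintegralD//; last 2 first.
  - by apply: intgZ => //; exact: (intg_mul gamma0 Z0).
  - by apply: intgZ => //; exact: (intg_mul gamma0 Z0).
  apply: le_Rintegral => //.
  - exact: (intg_mul gamma0 Z0).
  - by apply: intgD => //; apply: intgZ => //; exact: (intg_mul gamma0 Z0).
  move=> x _; have rx := rho_gt0 Z0 x.
  rewrite (_ : 2 * _ + _ = (2 * (h s x - h t x) ^+ 2 + 2 * h t x ^+ 2) *
    rho_inf gamma eps x); last by ring.
  by rewrite ler_pM2r//; have := sqr_ge0 (h s x - 2 * h t x); lra.
have /nbhs_ballP[d /= d0 Hd] := bnd.
apply/nbhs_ballP; exists d => // s ts.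
have in_ball u : Num.min s t <= u <= Num.max s t -> ball t d u.
  move=> /andP[u1 u2]; move: ts; rewrite /ball/= !ltr_distlC => /andP[s1 s2].
  by apply/andP; split; move: u1 u2; rewrite ge_min le_max;
    case/orP => ?; case/orP => ?; lra.
have [st|/ltW ts'] := leP s t.
  apply/esym; apply: (@moment_const_bounded _ _ (2 * ip (h t) (h t) + 2)) => //.
    by have [] := Hd _ ts.
  move=> u ust; have [] := Hd u _ => //.
  by apply: in_ball; rewrite (min_l st) (max_r st).
apply: (@moment_const_bounded _ _ (2 * ip (h t) (h t) + 2)) => //.
move=> u ust; have [] := Hd u _ => //.
by apply: in_ball; rewrite (min_r ts') (max_l ts').
Unshelve. all: by end_near. Qed.

Lemma moment_const a b : 0 < a -> a <= b -> E b = E a.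
Proof.
move=> a0 ab.
have d t : a <= t <= b -> is_derive t 1 E 0.
  move=> /andP[at_ _]; have t0 : 0 < t by lra.
  apply: (near_eq_is_derive _ (derC (E t) t)).
  by have := moment_locally_const t0; apply: filterS.
by apply/le_anti/andP; split; [exact: der_le0_ge d _|exact: der_ge0_le d _].
Qed.

(** Each spectral coefficient of the solution decays exponentially.  The
    regularity hypotheses being local, the coefficient is first computed with a
    cutoff, and the initial value is reached by continuity in L^2. *)
Lemma moment_evolution t : 0 <= t -> ip (h t) phi = expR (- nu * t) * ip (h 0) phi.
Proof.
move=> t0; suff e : E t = ip (h 0) phi.
  by rewrite -e /E mulrA -expRD mulNr addNr expR0 mul1r.
move: t0; rewrite le_eqVlt => /predU1P[<-|t0].
  by rewrite /E mulr0 expR0 mul1r.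
have c1 : E t * expR (- nu * s) - ip (h 0) phi @[s --> 0^'+] --> E t - ip (h 0) phi.
  apply: cvgB; last exact: cvg_cst.
  rewrite -[X in _ --> X]mulr1; apply: cvgM; first exact: cvg_cst.
  have d := der_expR (derM (derC (- nu) 0) (derX 0)).
  have := cvg_at_right_filter (der_cont d).
  by rewrite mulr0 expR0.
apply/eqP; rewrite -subr_eq0; apply/eqP; apply: (cvg_unique (@norm_hausdorff _ _) c1).
apply/cvgrPdist_le => e e0.
pose d := e / (2 * (1 + ip phi phi)).
have p0 : 0 <= ip phi phi by exact: inner_ge0.
have p1 : 0 < 2 * (1 + ip phi phi) by lra.
have d0 : 0 < d by rewrite divr_gt0.
near=> s.
have s0 : 0 < s by near: s; exact: nbhs_right_gt.
have st : s <= t by near: s; exact: nbhs_right_le.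
have H : ip (fun x => h s x - h 0 x) (fun x => h s x - h 0 x) < d * (e / 2).
  have : 0 <= s by exact: ltW.
  near: s; apply: cvg_within; apply: cont_h => //.
  by rewrite mulr_gt0// divr_gt0.
have Ls := Lh (ltW s0); have L0 := Lh (lexx 0).
have Ld := L2B gamma0 Z0 Ls L0.
rewrite (moment_const s0 st) sub0r normrN /E mulrAC -expRD mulNr addrN expR0 mul1r.
rewrite -(innerBl gamma0 Z0 Ls L0 Lphi).
apply: (le_trans (inner_amgm gamma0 Z0 d0 Ld Lphi)).
have h1 : d^-1 * ip (fun x => h s x - h 0 x) (fun x => h s x - h 0 x) <= e / 2.
  by rewrite ler_pdivrMl// ltW.
have h2 : d * ip phi phi <= e / 2.
  rewrite /d mulrAC ler_pdivrMr//; lra.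
lra.
Unshelve. all: by end_near. Qed.

End evolution.

(** * The truncated chi-square distance *)

Section initial_moment.
Context {R : realType}.
Notation mu := (@lebesgue_measure R).
Implicit Types (delta x : R) (u U : R -> R).

Lemma initial_moment_primitive delta x0 u U : 0 < delta -> continuous u ->
  (forall x, is_derive x 1 U (u x)) ->
  initial_moment delta x0 u = (2 * delta)^-1 * (U (x0 + delta) - U (x0 - delta)).
Proof.
move=> d0 cu dU; pose a := x0 - delta; pose b := x0 + delta.
have ab : a <= b by rewrite /a /b; lra.
have jf := integrable_segment a b cu.
have joc : mu.-integrable `]a, b] (EFin \o u).
  by apply: integrableS jf => //; exact: subset_itv_oc_cc.
have joo : mu.-integrable `]a, b[ (EFin \o u).
  by apply: integrableS jf => //; exact: subset_itv_oo_cc.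
rewrite -(ftc_segment ab (fun x _ => dU x) cu).
rewrite -(Rintegral_itv_obnd_cbnd joc) -(Rintegral_itv_bndo_bndc joo).
rewrite -RintegralZl//; rewrite /initial_moment [RHS]Rintegral_mkcond.
apply: eq_Rintegral => x _; rewrite /initial_density patchE indicE -/a -/b.
by case: ifPn => _; rewrite ?mulr1// !mulr0 mul0r.
Qed.

End initial_moment.

Section chi2.
Context {R : realType}.
Notation mu := (@lebesgue_measure R).
Variables (gamma eps delta x0 : R).
Variables (lambda : nat -> R) (psi : nat -> R -> R) (rho : R -> R -> R).
Hypothesis gamma0 : 0 < gamma.
Hypothesis gamma1 : gamma < 1.
Hypothesis eps0 : 0 < eps.
Hypothesis eps1 : eps <= 1.
Hypothesis delta0 : 0 < delta.
Hypothesis sb : spectral_basis gamma eps lambda psi.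
Hypothesis sol : fokker_planck_solution gamma eps (initial_density delta x0) rho.

Local Notation ip := (inner gamma eps).
Local Notation L2 := (in_L2 gamma eps).

Let Z0 : 0 < partition_constant gamma eps. Proof. exact: partition_gt0 sb. Qed.

Let Lpsi k : L2 (psi k). Proof. by have [] := eigenfunctionP sb k. Qed.

Lemma spectral_coefficient t k : 0 <= t ->
  ip (density_ratio gamma eps (rho t)) (psi k) =
  expR (- lambda k * t) * initial_moment delta x0 (psi k).
Proof.
move=> t0; pose s := eps `^ (gamma + 1)^-1.
have s0 : 0 < s by exact: powR_gt0.
have sE : s `^ (gamma + 1) = eps.
  have g1 : 0 < gamma + 1 by rewrite addr_gt0.
  by rewrite /s -powRrM mulVf ?gt_eqF// powRr1// ltW.
have l0 : 0 <= lambda k.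
  by case: k => [|k]; [rewrite (eigenvalue0 sb)|rewrite ltW// (eigenvalue_gt0 sb)].
have L1 : L2 (derive1 (psi k)).
  by move: sb; rewrite -sE => sb'; exact: (basis_derive1_in_L2_eps gamma0 gamma1 s0 k sb').
rewrite (moment_evolution gamma0 gamma1 eps0 eps1 Z0 l0 (eigenfunctionP sb k) L1 sol t0).
congr (_ * _); rewrite /inner /initial_moment; apply: eq_Rintegral => x _.
by rewrite /density_ratio (fp_initial sol) mulrAC divfK// gt_eqF// rho_gt0.
Qed.

Lemma initial_mass : initial_moment delta x0 (cst 1) = 1.
Proof.
have c1 : continuous (cst 1 : R -> R) by move=> x; exact: cvg_cst.
rewrite (@initial_moment_primitive R delta x0 (cst 1) id)//.
by field; rewrite gt_eqF.
Qed.

(** Parseval for the truncated expansion: the constant mode is removed by the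
    subtraction of 1, the other coefficients have decayed exponentially. *)
Lemma chi2_formula n t : 0 <= t ->
  truncated_chi2 gamma eps psi n rho t =
  Num.sqrt (\sum_(1 <= k < n.+1)
    (expR (- lambda k * t) * initial_moment delta x0 (psi k)) ^+ 2).
Proof.
move=> t0; congr Num.sqrt.
pose c k := expR (- lambda k * t) * initial_moment delta x0 (psi k).
pose S x := \sum_(1 <= k < n.+1) c k * psi k x.
have cE k : ip (density_ratio gamma eps (rho t)) (psi k) = c k.
  exact: spectral_coefficient.
have LS : L2 S by apply: (L2_sum gamma0 Z0) => k; exact: L2Z.
transitivity (ip S S).
  rewrite /inner; apply: eq_Rintegral => x _; rewrite real_normK ?num_real// -expr2.
  congr (_ ^+ 2 * _); rewrite /projection big_nat_recl//= cE /c.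
  rewrite (eigenvalue0 sb) oppr0 mul0r expR0 mul1r (eigenfunction0 sb) initial_mass.
  rewrite mulr1 addrAC subrr add0r /S big_add1/=.
  by apply: eq_bigr => k _; rewrite cE.
rewrite (inner_suml gamma0 Z0 _ (f := fun k x => c k * psi k x))//; last first.
  by move=> k; exact: L2Z.
rewrite !big_nat; apply: eq_bigr => k /andP[k1 kn].
rewrite (innerZl gamma0 Z0)// innerC.
rewrite (inner_suml gamma0 Z0 _ (f := fun k x => c k * psi k x))//; last first.
  by move=> i; exact: L2Z.
rewrite (bigD1_seq k)/= ?mem_index_iota ?k1// ?iota_uniq//.
rewrite big1 ?addr0; last first.
  move=> i ik; rewrite (innerZl gamma0 Z0)// (psi_orthonormal sb) (negPf ik).
  by rewrite mulr0.
by rewrite (innerZl gamma0 Z0)// (psi_orthonormal sb) eqxx mulr1 -expr2.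
Qed.

End chi2.

(** * From moment asymptotics to cut-off *)

Section core.
Context {R : realType}.

Lemma cvg_sum_seq (F : set_system R) {FF : Filter F} (r : seq nat)
    (f : nat -> R -> R) (l : nat -> R) :
  (forall k, k \in r -> f k x @[x --> F] --> l k) ->
  \sum_(k <- r) f k x @[x --> F] --> \sum_(k <- r) l k.
Proof.
elim: r => [|i r ih] H.
  by under eq_fun do rewrite big_nil; rewrite big_nil; exact: cvg_cst.
under eq_fun do rewrite big_cons; rewrite big_cons; apply: cvgD.
  by apply: H; rewrite mem_head.
by apply: ih => k kr; apply: H; rewrite in_cons kr orbT.
Qed.

Lemma cvg_expR_ninfty (F : set_system R) {FF : Filter F} (f : R -> R) :
  f x @[x --> F] --> -oo -> expR (f x) @[x --> F] --> (0 : R).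
Proof.
move=> /cvgrNyPle fy; apply/cvgrPdist_lt => e e0.
apply: filterS (fy (ln (e / 2))) => x fx.
rewrite sub0r normrN ger0_norm ?expR_ge0//.
have e2 : 0 < e / 2 by rewrite divr_gt0.
apply: (@le_lt_trans _ _ (e / 2)); last lra.
by rewrite -[leRHS]lnK ?posrE// ler_expR.
Qed.

Variables (ell : nat -> R) (n m : nat).
Hypothesis m1 : (1 <= m)%N.
Hypothesis mn : (m <= n)%N.
Hypothesis ellm : 0 < ell m.
Variables (w : R -> R) (lam M : R -> nat -> R) (d : R -> R -> R).
Hypothesis w0 : forall e : R, 0 < e -> 0 < w e.
Hypothesis lamE : forall (e : R) k, 0 < e <= 1 -> w e * lam e k = ell k.
Hypothesis dE : forall e t : R, 0 < e <= 1 -> 0 <= t ->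
  d e t = Num.sqrt (\sum_(1 <= k < n.+1) (expR (- lam e k * t) * M e k) ^+ 2).
Hypothesis H1 : ln (M e m ^+ 2) @[e --> 0^'+] --> +oo.
Hypothesis H2 : forall k, (1 <= k <= n)%N -> k != m ->
  M e k ^+ 2 * expR (- (ell k / ell m * ln (M e m ^+ 2))) @[e --> 0^'+] --> (0 : R).

Let tc (e : R) := (lam e m)^-1 * ln `|M e m|.

Let near01 : \forall e \near (0 : R)^'+, 0 < e <= 1.
Proof.
near=> e; apply/andP; split; first by near: e; exact: nbhs_right_gt.
by near: e; exact: nbhs_right_le.
Unshelve. all: by end_near. Qed.

Let bigM (A : R) : \forall e \near (0 : R)^'+,
  [/\ 0 < e <= 1, M e m != 0, ln (M e m ^+ 2) = 2 * ln `|M e m| & A <= ln `|M e m|].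
Proof.
move: H1 => /cvgryPge/(_ (Num.max (2 * A) 1)) h.
near=> e; have e01 : 0 < e <= 1 by near: e; exact: near01.
have : Num.max (2 * A) 1 <= ln (M e m ^+ 2) by near: e; exact: h.
rewrite ge_max => /andP[hA h1].
have M0 : M e m != 0.
  by apply/eqP => M0; move: h1; rewrite M0 expr0n/= ln0// ler10.
have E : ln (M e m ^+ 2) = 2 * ln `|M e m|.
  rewrite -(real_normK (num_real (M e m))) expr2 lnM ?posrE ?normr_gt0//.
  by rewrite mulr_natl mulr2n.
by split => //; move: hA; rewrite E ler_pM2l.
Unshelve. all: by end_near. Qed.

Let lamm (e : R) : 0 < e <= 1 -> lam e m = ell m / w e.
Proof.
move=> e01; have /andP[e0 _] := e01; have := w0 e0 => we.
by rewrite -(lamE m e01) mulrAC mulfV ?gt_eqF// mul1r.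
Qed.

Let tcE (e : R) : 0 < e <= 1 -> tc e = w e / ell m * ln `|M e m|.
Proof. by move=> e01; rewrite /tc lamm// invf_div. Qed.

(** At time t_eps + r w_eps the mode k contributes
    exp (- 2 ell_k r) M_k^2 / |M_m|^(2 ell_k / ell_m), and by hypothesis only the
    mode m survives. *)
Lemma cutoff_core :
  (\forall e \near 0^'+,
     unique (fun t => expR (- 2 * lam e m * t) * M e m ^+ 2 = 1) (tc e)) /\
  profile_cutoff d tc w (fun r => expR (- ell m * r)).
Proof.
split.
  near=> e.
  have [e01 M0 _ _] : [/\ 0 < e <= 1, M e m != 0,
      ln (M e m ^+ 2) = 2 * ln `|M e m| & 0 <= ln `|M e m|] by near: e; exact: bigM.
  have /andP[e0 _] := e01; have we := w0 e0.
  have l0 : 0 < lam e m by rewrite lamm// divr_gt0.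
  have MM : M e m ^+ 2 = expR (2 * ln `|M e m|).
    rewrite -(real_normK (num_real (M e m))) mulr_natl mulr2n expRD.
    by rewrite lnK ?posrE ?normr_gt0// expr2.
  split.
    rewrite MM -expRD /tc -[RHS]expR0; congr expR; field.
    by rewrite gt_eqF.
  move=> t; rewrite MM -expRD => H.
  have E : - 2 * lam e m * t + 2 * ln `|M e m| = 0 by apply: expR_inj; rewrite H expR0.
  rewrite /tc; apply: (mulfI (lt0r_neq0 l0)).
  rewrite mulVKf ?gt_eqF//; lra.
split.
- near=> e.
  have [e01 M0 _ lM] : [/\ 0 < e <= 1, M e m != 0,
      ln (M e m ^+ 2) = 2 * ln `|M e m| & 1 <= ln `|M e m|] by near: e; exact: bigM.
  have /andP[e0 _] := e01; have we := w0 e0; split=> //.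
  by rewrite tcE// mulr_gt0// ?divr_gt0//; lra.
- apply/cvgrPdist_lt => z z0; near=> e.
  have [e01 M0 _ lM] : [/\ 0 < e <= 1, M e m != 0,
      ln (M e m ^+ 2) = 2 * ln `|M e m| & (ell m / z + 1) <= ln `|M e m|].
    by near: e; exact: bigM.
  have /andP[e0 _] := e01; have we := w0 e0.
  have lz : 0 < ell m / z by rewrite divr_gt0.
  have l0 : 0 < ln `|M e m| by lra.
  rewrite sub0r normrN tcE// (_ : _ / _ = ell m / ln `|M e m|); last first.
    by field; rewrite !gt_eqF.
  rewrite gtr0_norm ?divr_gt0// ltr_pdivrMr// mulrC -ltr_pdivrMr//; lra.
- move=> r.
  pose f k e := expR (- 2 * ell k * r) *
    (M e k ^+ 2 * expR (- (ell k / ell m * ln (M e m ^+ 2)))).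
  pose l k := if k == m then expR (- 2 * ell m * r) else 0.
  have fl k : k \in index_iota 1 n.+1 -> f k e @[e --> 0^'+] --> l k.
    rewrite mem_index_iota ltnS => kn; rewrite /l; case: eqVneq => [->|km].
      rewrite -[X in _ --> X]mulr1; apply: cvgM; first exact: cvg_cst.
      apply: cvg_near_cst; near=> e.
      have [_ M0 E _] : [/\ 0 < e <= 1, M e m != 0,
        ln (M e m ^+ 2) = 2 * ln `|M e m| & 1 <= ln `|M e m|] by near: e; exact: bigM.
      rewrite mulfV ?gt_eqF// mul1r expRN lnK ?posrE ?mulfV ?expf_neq0//.
      by rewrite lt0r sqr_ge0 sqrf_eq0 M0.
    by rewrite -[X in _ --> X](mulr0 (expR (- 2 * ell k * r))); apply: cvgM;
      [exact: cvg_cst|exact: H2].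
  have suml : \sum_(k <- index_iota 1 n.+1) l k = expR (- 2 * ell m * r).
    rewrite (bigD1_seq m)/= ?mem_index_iota ?m1 ?ltnS ?mn ?iota_uniq//.
    rewrite big1 ?addr0; first by rewrite /l eqxx.
    by move=> k km; rewrite /l (negPf km).
  have sf : \sum_(k <- index_iota 1 n.+1) f k e @[e --> 0^'+] --> expR (- 2 * ell m * r).
    by rewrite -suml; exact: cvg_sum_seq.
  have -> : expR (- ell m * r) = Num.sqrt (expR (- 2 * ell m * r)).
    rewrite (_ : - 2 * ell m * r = - ell m * r + - ell m * r); last by ring.
    by rewrite expRD -expr2 sqrtr_sqr ger0_norm ?expR_ge0.
  have c : Num.sqrt (\sum_(k <- index_iota 1 n.+1) f k e) @[e --> 0^'+] -->
      Num.sqrt (expR (- 2 * ell m * r)) by exact: (continuous_cvg _ (@sqrt_continuous R _) sf).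
  apply: cvg_trans c; apply: near_eq_cvg; near=> e.
  have [e01 M0 E lM] : [/\ 0 < e <= 1, M e m != 0,
      ln (M e m ^+ 2) = 2 * ln `|M e m| & - r * ell m <= ln `|M e m|].
    by near: e; exact: bigM.
  have /andP[e0 _] := e01; have we := w0 e0.
  have t0 : 0 <= tc e + r * w e.
    rewrite tcE// (_ : _ + _ = w e / ell m * (ln `|M e m| + r * ell m)); last first.
      by field; rewrite gt_eqF.
    by rewrite mulr_ge0 ?(divr_ge0 (ltW we) (ltW ellm))//; lra.
  rewrite dE//; congr Num.sqrt; apply: eq_bigr => k _.
  rewrite /f E exprMn (mulrC (M e k ^+ 2)) [LHS]mulrA; congr (_ * _).
  rewrite expr2 -!expRD; congr expR.
  have -> : lam e k = ell k / w e.
    by rewrite -(lamE k e01); field; rewrite gt_eqF.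
  by rewrite tcE//; field; rewrite !gt_eqF.
- apply/cvgryPge => A.
  near=> r; have rA : r <= - (ln (Num.max A 1) / ell m).
    by near: r; apply: nbhs_ninfty_le; exact: num_real.
  have m10 : 0 < Num.max A 1 by rewrite lt_max ltr01 orbT.
  apply: (@le_trans _ _ (Num.max A 1)); first by rewrite le_max lexx.
  rewrite -[leLHS]lnK ?posrE// ler_expR.
  have := ler_wpM2l (ltW ellm) rA.
  rewrite mulrN mulrCA mulfV ?gt_eqF// mulr1; lra.
- apply: cvg_expR_ninfty; apply/cvgrNyPle => A; near=> r.
  have rA : - A / ell m <= r by near: r; apply: nbhs_pinfty_ge; exact: num_real.
  by rewrite mulNr lerNl mulrC -ler_pdivrMr.
Unshelve. all: by end_near. Qed.

End core.

(** * Asymptotics of the initial moments *)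

Section asymptotics.
Context {R : realType}.
Variables (gamma : R) (ell : nat -> R) (psi : nat -> R -> R).
Hypothesis gamma0 : 0 < gamma.
Hypothesis gamma3 : 3 * gamma <= 1.
Hypothesis sb : spectral_basis gamma 1 ell psi.
Implicit Types (k n : nat) (U : R -> R).

Let gamma1 : gamma < 1. Proof. by have := gamma3; have := gamma0; lra. Qed.

Let Z0 : 0 < partition_constant gamma 1. Proof. exact: partition_gt0 sb. Qed.

Let ell0 k : (0 < k)%N -> 0 < ell k.
Proof. exact: (eigenvalue_gt0 sb). Qed.

Let slow k : slow_solution gamma (ell k) (psi k) (derive1 (psi k)).
Proof. exact: (eigenfunction_slow gamma0 gamma1 Z0 (eigenfunctionP sb k)). Qed.

Let dpsi k (x : R) : is_derive x 1 (psi k) (derive1 (psi k) x).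
Proof. by have [[d _] _ _] := slow k; exact: d. Qed.

(** The square of the mean of the function with primitive U over the interval
    centred at x0 / s, of half-length s^(-gamma): the squared initial moment in
    the variable rescaled by s. *)
Definition sqr_mean U (x0 s : R) : R :=
  ((U (x0 / s + s `^ (- gamma)) - U (x0 / s - s `^ (- gamma))) /
   (2 * s `^ (- gamma))) ^+ 2.

Lemma cvg0_of_log (f a : R -> R) (c C : R) : 0 < c ->
  (\forall s \near 0^'+, 0 <= f s <= expR (C - c * ln (a s))) ->
  (forall A : R, \forall s \near (0 : R)^'+, A <= a s) ->
  f s @[s --> 0^'+] --> (0 : R).
Proof.
move=> c0 fb ay; apply: (@squeeze_cvgr _ _ _ _ (fun=> 0) (fun s => expR (C - c * ln (a s)))) => //.
  exact: cvg_cst.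
apply: cvg_expR_ninfty; apply/cvgrNyPle => B.
apply: filterS (ay (expR ((C - B) / c))) => s As.
have a0 : 0 < a s by apply: lt_le_trans As; exact: expR_gt0.
have : (C - B) / c <= ln (a s) by rewrite -ler_expR lnK.
rewrite ler_pdivrMr//; lra.
Qed.

Lemma gt0_powRN_infty (p : R) : 0 < p ->
  forall A : R, \forall s \near (0 : R)^'+, A <= s `^ (- p).
Proof.
move=> p0 A; have [B B1 HB] := powR_large A p0.
have B0 : 0 < B by lra.
near=> s; have s0 : 0 < s by near: s; exact: nbhs_right_gt.
have sB : s <= B^-1 by near: s; apply: nbhs_right_le; rewrite invr_gt0.
have : B <= s^-1 by rewrite -[leLHS]invrK lef_pV2 ?posrE ?invr_gt0.
move=> /HB; rewrite -(powR_inv1 (ltW s0)) -powRrM.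
by rewrite mulN1r.
Unshelve. all: by end_near. Qed.

(** ** Away from the origin *)

(* the mean is attained, and parity brings the point to the positive side *)
Lemma sqr_mean_value k U (x0 s : R) : 0 < s -> (forall x : R, is_derive x 1 U (psi k x)) ->
  exists2 z, `|x0| / s - s `^ (- gamma) <= z <= `|x0| / s + s `^ (- gamma) &
    sqr_mean U x0 s = psi k z ^+ 2.
Proof.
move=> s0 dU; have h0 : 0 < s `^ (- gamma) by exact: powR_gt0.
have [|z /andP[z1 z2] E] := @mvt R U (psi k) (x0 / s - s `^ (- gamma))
  (x0 / s + s `^ (- gamma)) _ (fun x _ => dU x); first lra.
have EQ : sqr_mean U x0 s = psi k z ^+ 2.
  by rewrite /sqr_mean E; congr (_ ^+ 2); field; rewrite !gt_eqF.
have [x00|x00] := leP 0 x0; first by exists z => //; rewrite ger0_norm// z1.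
exists (- z); last first.
  have [c c1 Hc] := basis_parity gamma0 gamma1 k sb.
  by rewrite EQ Hc exprMn c1 mul1r.
by rewrite ltr0_norm// mulNr; apply/andP; split; lra.
Qed.

Let edge (x0 s : R) : R := `|x0| / s - s `^ (- gamma).

Lemma edge_infty (x0 : R) : x0 != 0 -> forall A : R, \forall s \near (0 : R)^'+, A <= edge x0 s.
Proof.
move=> x00 A; have nx : 0 < `|x0| by rewrite normr_gt0.
have [|B B1 HB] := @powR_large R (1 - gamma) (2 / `|x0|); first by rewrite subr_gt0.
have B0 : 0 < B by lra.
pose D := Num.max B (2 * `|A| / `|x0|).
have D0 : 0 < D by rewrite lt_max B0.
near=> s; have s0 : 0 < s by near: s; exact: nbhs_right_gt.
have sD : s <= D^-1 by near: s; apply: nbhs_right_le; rewrite invr_gt0.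
have {}sD : D <= s^-1 by rewrite -[leLHS]invrK lef_pV2 ?posrE ?invr_gt0.
have [sB sA] : B <= s^-1 /\ 2 * `|A| / `|x0| <= s^-1.
  by move: sD; rewrite ge_max => /andP.
have h : s `^ (- gamma) <= `|x0| / s / 2.
  have := HB _ sB; rewrite powR_Dgt0 ?invr_gt0// powRr1 ?invr_ge0 ?(ltW s0)//.
  rewrite -(powR_inv1 (ltW s0)) -powRrM mulN1r opprK (powR_inv1 (ltW s0)) powRN.
  have g0 : 0 < s `^ gamma by exact: powR_gt0.
  rewrite ler_pdivrMr// => h1; rewrite -div1r ler_pdivrMr//.
  rewrite (_ : _ * _ = s^-1 * s `^ gamma * `|x0| / 2); last by ring.
  by rewrite ler_pdivlMr// mul1r.
have h2 : `|A| <= `|x0| / s / 2.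
  by move: sA; rewrite ler_pdivrMr// => h1; rewrite ler_pdivlMr//; lra.
have := ler_norm A; rewrite /edge; lra.
Unshelve. all: by end_near. Qed.

(** The half-length of the interval and the derivative of the logarithm of an
    eigenfunction balance: averaging only costs a bounded factor. *)
Lemma edge_variation (x0 : R) : x0 != 0 -> \forall s \near (0 : R)^'+,
  0 < s /\ edge x0 s `^ (- gamma) * (2 * s `^ (- gamma)) <= 2 * (`|x0| / 2) `^ (- gamma).
Proof.
move=> x00; have nx : 0 < `|x0| by rewrite normr_gt0.
pose B := (`|x0| / 2) `^ (1 - gamma)^-1.
have g1 : 0 < 1 - gamma by rewrite subr_gt0.
have x20 : 0 < `|x0| / 2 by rewrite divr_gt0.
have B0 : 0 < B by exact: powR_gt0.
near=> s; have s0 : 0 < s by near: s; exact: nbhs_right_gt.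
have sB : s <= B by near: s; exact: nbhs_right_le.
split=> //.
have e1 : s `^ (1 - gamma) <= `|x0| / 2.
  have -> : `|x0| / 2 = B `^ (1 - gamma).
    by rewrite /B -powRrM mulVf ?gt_eqF// powRr1// ltW.
  by apply: ge0_ler_powR; rewrite ?nnegrE ?(ltW g1) ?(ltW s0) ?(ltW B0).
have e2 : `|x0| / 2 / s <= edge x0 s.
  rewrite /edge (_ : s `^ (- gamma) = s `^ (1 - gamma) / s); last first.
    by rewrite powR_Dgt0// powRr1 ?(ltW s0)//; field; rewrite gt_eqF.
  by rewrite -mulrBl ler_pM2r ?invr_gt0//; lra.
have e3 : edge x0 s `^ (- gamma) <= (`|x0| / 2 / s) `^ (- gamma).
  have p0 : 0 < `|x0| / 2 / s by rewrite divr_gt0.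
  have p1 : 0 < edge x0 s by exact: lt_le_trans e2.
  rewrite !powRN lef_pV2 ?posrE ?powR_gt0//.
  by apply: ge0_ler_powR; rewrite ?nnegrE ?(ltW gamma0) ?(ltW p0) ?(ltW p1).
rewrite mulrCA ler_pM2l//.
apply: (le_trans (ler_wpM2r (powR_ge0 _ _) e3)).
rewrite -powRM ?divr_ge0 ?(ltW s0)//; apply: eq_ler; congr (_ `^ _).
by field; rewrite gt_eqF.
Unshelve. all: by end_near. Qed.

Lemma sqr_mean_infty_away k U (x0 : R) : (0 < k)%N -> x0 != 0 ->
  (forall x : R, is_derive x 1 U (psi k x)) ->
  ln (sqr_mean U x0 s) @[s --> 0^'+] --> +oo.
Proof.
move=> k0 x00 dU; apply/cvgryPge => A.
have [c [B [c0 B1 HB]]] := superlinear gamma0 gamma1 (ell0 k0) (slow k).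
near=> s; have s0 : 0 < s by near: s; exact: nbhs_right_gt.
have : Num.max B (expR A / c) <= edge x0 s by near: s; exact: edge_infty.
rewrite ge_max => /andP[Ba Aa].
have [z /andP[z1 _] ->] := sqr_mean_value x0 s0 dU; rewrite -/(edge _ _) in z1.
have Bz := le_trans Ba z1.
have z1' : 1 <= z by lra.
have h : expR A <= psi k z ^+ 2.
  apply: le_trans (HB z Bz).
  apply: (@le_trans _ _ (c * z)); last first.
    by rewrite ler_pM2l// expr2 ler_peMl//; lra.
  by rewrite -ler_pdivrMl// mulrC (le_trans Aa).
have p0 : 0 < psi k z ^+ 2 by apply: lt_le_trans h; exact: expR_gt0.
by rewrite -ler_expR lnK.
Unshelve. all: by end_near. Qed.

Lemma sqr_mean_ratio_away k n U V (x0 : R) : (0 < k)%N -> (k < n)%N -> x0 != 0 ->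
  (forall x : R, is_derive x 1 U (psi k x)) -> (forall x : R, is_derive x 1 V (psi n x)) ->
  sqr_mean U x0 s * expR (- (ell k / ell n * ln (sqr_mean V x0 s))) @[s --> 0^'+]
    --> (0 : R).
Proof.
move=> k0 kn x00 dU dV.
have lkn := eigenvalue_lt sb kn.
have n0 : (0 < n)%N by exact: leq_trans kn.
have [c [C [A [c0 A1 HA]]]] :=
  ln_sqr_ratio gamma0 gamma1 gamma3 (ell0 k0) lkn (slow k) (slow n).
have [B B1 [nzB HB]] := ln_sqr_variation gamma0 gamma1 (ell0 k0) (slow k).
have [D D1 [nzD HD]] := ln_sqr_variation gamma0 gamma1 (ell0 n0) (slow n).
pose K := 2 * (`|x0| / 2) `^ (- gamma).
apply: (@cvg0_of_log _ (edge x0) c (C + 4 * ell k * K)) => //; last exact: edge_infty.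
near=> s.
have : Num.max A (Num.max B D) <= edge x0 s by near: s; exact: edge_infty.
rewrite !ge_max => /and3P[Aa Ba Da].
have [s0 hK] : 0 < s /\ edge x0 s `^ (- gamma) * (2 * s `^ (- gamma)) <= K.
  by near: s; exact: edge_variation.
have [z /andP[z1 z2] ->] := sqr_mean_value x0 s0 dU.
have [y /andP[y1 y2] ->] := sqr_mean_value x0 s0 dV.
rewrite -/(edge _ _) in z1 y1.
rewrite mulr_ge0 ?sqr_ge0 ?expR_ge0//=.
have pz : 0 < psi k z ^+ 2 by rewrite lt0r sqr_ge0 sqrf_eq0 nzB// (le_trans Ba).
rewrite -[X in X * _]lnK ?posrE// -expRD ler_expR.
have [_ hz] := HB _ _ Ba z1; have [hy _] := HD _ _ Da y1.
have ha := HA _ Aa.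
have q0 : 0 <= ell k / ell n by rewrite divr_ge0// ltW// ell0.
have hy' := ler_wpM2l q0 hy.
have hz' : 4 * ell k * edge x0 s `^ (- gamma) * (z - edge x0 s) <= 4 * ell k * K.
  have l4 : 0 <= 4 * ell k by rewrite mulr_ge0// ltW// ell0.
  rewrite -mulrA ler_wpM2l//; apply: le_trans hK.
  rewrite ler_wpM2l ?powR_ge0//; rewrite /edge; lra.
lra.
Unshelve. all: by end_near. Qed.

(** ** At the origin *)

Lemma vanishing_odd k : psi k 0 = 0 -> forall x, psi k (- x) = - psi k x.
Proof.
move=> p0; have [c c1 Hc] := basis_parity gamma0 gamma1 k sb.
have [cE|cE] : c = 1 \/ c = - 1.
- by move/eqP: c1; rewrite sqrf_eq1 => /orP[/eqP ->|/eqP ->]; [left|right].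
- have d1 := dpsi k 0; have d2 := der_comp (dpsi k (- 0)) (derN (derX 0)).
  have : derive1 (psi k) 0 = derive1 (psi k) (- 0) * - 1.
    apply: (der_unique d1); apply: (near_eq_is_derive _ d2).
    by near=> x; rewrite Hc cE mul1r.
  rewrite oppr0 mulrN1 => d0.
  have {}d0 : derive1 (psi k) 0 = 0 by lra.
  have [s [x nz] _] := slow k.
  by move: nz; rewrite (solves_unique gamma0 s p0 d0) eqxx.
- by move=> x; rewrite Hc cE mulN1r.
Unshelve. all: by end_near. Qed.

Lemma nonvanishing_even k : psi k 0 != 0 -> forall x, psi k (- x) = psi k x.
Proof.
move=> p0 x; have [c c1 Hc] := basis_parity gamma0 gamma1 k sb.
have := Hc 0; rewrite oppr0 -[LHS]mul1r => /(mulIf p0) c1'.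
by rewrite Hc -c1' mul1r.
Qed.

Let cst_of_der0 (f : R -> R) : (forall x : R, is_derive x 1 f 0) -> forall x, f x = f 0.
Proof. by move=> d x; exact: is_derive_0_is_cst. Qed.

Lemma sqr_mean_odd k U (s : R) : (forall x : R, is_derive x 1 U (psi k x)) ->
  psi k 0 = 0 -> sqr_mean U 0 s = 0.
Proof.
move=> dU p0; have odd := vanishing_odd p0.
have d (x : R) : is_derive x 1 (fun x => U x - U (- x)) 0.
  have d' := der_comp (dU (- x)) (derN (derX x)); have ? := dU x.
  by der; rewrite odd; ring.
have := cst_of_der0 d (s `^ (- gamma)); rewrite oppr0 subrr => E.
by rewrite /sqr_mean mul0r add0r sub0r E mul0r expr0n.
Qed.

Lemma sqr_mean_even k U (s : R) : 0 < s -> (forall x : R, is_derive x 1 U (psi k x)) ->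
  psi k 0 != 0 ->
  sqr_mean U 0 s = (U (s `^ (- gamma)) - U 0) ^+ 2 / (s `^ (- gamma)) ^+ 2.
Proof.
move=> s0 dU p0; have even := nonvanishing_even p0.
have d (x : R) : is_derive x 1 (fun x => U x + U (- x)) 0.
  have d' := der_comp (dU (- x)) (derN (derX x)); have ? := dU x.
  by der; rewrite even; ring.
have := cst_of_der0 d (s `^ (- gamma)); rewrite oppr0 => E.
rewrite /sqr_mean mul0r add0r sub0r.
have -> : U (- s `^ (- gamma)) = 2 * U 0 - U (s `^ (- gamma)) by lra.
by field; rewrite gt_eqF// powR_gt0.
Qed.

Let width (s : R) : R := s `^ (- gamma).

(** Up to constants the squared mean is (x^(gamma - 1) psi_k(x))^2 at the
    half-length x of the interval. *)
Lemma sqr_mean_bounds k U : (0 < k)%N -> (forall x : R, is_derive x 1 U (psi k x)) ->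
  psi k 0 != 0 -> exists a b A : R, [/\ 0 < a, 1 <= A &
    forall s, 0 < s -> A <= width s ->
      a * ((width s `^ (gamma - 1)) ^+ 2 * psi k (width s) ^+ 2) <= sqr_mean U 0 s /\
      sqr_mean U 0 s <= b * ((width s `^ (gamma - 1)) ^+ 2 * psi k (width s) ^+ 2)].
Proof.
move=> k0 dU p0.
have [a [b [A [a0 A1 HA]]]] := primitive_bounds gamma0 gamma1 (ell0 k0) (slow k) dU.
exists a, b, A; split=> // s s0 Aw; have [h1 h2] := HA _ Aw.
rewrite (sqr_mean_even s0 dU p0) -/(width s); set x := width s in Aw h1 h2 *.
have x0 : 0 < x by lra.
have E c : c * ((x `^ (gamma - 1)) ^+ 2 * psi k x ^+ 2) =
    c * (x `^ gamma * psi k x) ^+ 2 / x ^+ 2.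
  by rewrite powR_Dgt0// powR_inv1 ?(ltW x0)//; field; rewrite gt_eqF.
have xi : 0 < (x ^+ 2)^-1 by rewrite invr_gt0 exprn_gt0.
by rewrite !E !ler_pM2r.
Qed.

Let width_infty (A : R) : \forall s \near (0 : R)^'+, A <= width s.
Proof. exact: gt0_powRN_infty. Qed.

Lemma sqr_mean_infty_origin k U : (0 < k)%N -> psi k 0 != 0 ->
  (forall x : R, is_derive x 1 U (psi k x)) ->
  ln (sqr_mean U 0 s) @[s --> 0^'+] --> +oo.
Proof.
move=> k0 p0 dU; apply/cvgryPge => T.
have [a [b [A [a0 A1 HA]]]] := sqr_mean_bounds k0 dU p0.
have [c [B [c0 B1 HB]]] := superlinear gamma0 gamma1 (ell0 k0) (slow k).
have [E E1 HE] := @powR_large R (2 * gamma) (expR T / (a * c)) (mulr_gt0 (ltr0Sn R 1) gamma0).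
near=> s; have s0 : 0 < s by near: s; exact: nbhs_right_gt.
have : Num.max A (Num.max B E) <= width s by near: s; exact: width_infty.
rewrite !ge_max => /and3P[Aw Bw Ew].
have [h _] := HA s s0 Aw; set x := width s in Aw Bw Ew h *.
have x0 : 0 < x by lra.
have h2 : expR T <= sqr_mean U 0 s.
  apply: le_trans h; have := HB x Bw => hB.
  apply: (@le_trans _ _ (a * ((x `^ (gamma - 1)) ^+ 2 * (c * x ^+ 2)))); last first.
    by rewrite ler_pM2l// ler_wpM2l// sqr_ge0.
  rewrite (_ : a * _ = a * c * x `^ (2 * gamma)); last first.
    rewrite mulrDl mul1r !powR_Dgt0// powR_inv1 ?(ltW x0)//.
    by field; rewrite gt_eqF.
  by rewrite mulrC -ler_pdivrMr ?mulr_gt0// HE.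
have q0 : 0 < sqr_mean U 0 s by apply: lt_le_trans h2; exact: expR_gt0.
by rewrite -ler_expR lnK.
Unshelve. all: by end_near. Qed.

Lemma sqr_mean_ratio_origin k n U V : (0 < k)%N -> (k < n)%N ->
  psi k 0 != 0 -> psi n 0 != 0 ->
  (forall x : R, is_derive x 1 U (psi k x)) -> (forall x : R, is_derive x 1 V (psi n x)) ->
  sqr_mean U 0 s * expR (- (ell k / ell n * ln (sqr_mean V 0 s))) @[s --> 0^'+]
    --> (0 : R).
Proof.
move=> k0 kn pk pn dU dV.
have lkn := eigenvalue_lt sb kn.
have n0 : (0 < n)%N by exact: leq_trans kn.
have [a [b [A [a0 A1 HA]]]] := sqr_mean_bounds k0 dU pk.
have [a' [b' [A' [a0' A1' HA']]]] := sqr_mean_bounds n0 dV pn.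
have [c [C [B [c0 B1 HB]]]] :=
  ln_sqr_ratio gamma0 gamma1 gamma3 (ell0 k0) lkn (slow k) (slow n).
have [D D1 [nzD _]] := ln_sqr_variation gamma0 gamma1 (ell0 k0) (slow k).
have [D' D1' [nzD' _]] := ln_sqr_variation gamma0 gamma1 (ell0 n0) (slow n).
pose q := ell k / ell n.
have q0 : 0 < q by rewrite divr_gt0// ell0.
have q1 : q < 1 by rewrite ltr_pdivrMr ?mul1r// ell0.
pose b1 := Num.max b 1.
have b10 : 0 < b1 by rewrite lt_max ltr01 orbT.
apply: (@cvg0_of_log _ width c (ln b1 - q * ln a' + C)) => //.
near=> s; have s0 : 0 < s by near: s; exact: nbhs_right_gt.
have : Num.max (Num.max A A') (Num.max B (Num.max D D')) <= width s.
  by near: s; exact: width_infty.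
rewrite !ge_max => /andP[/andP[Aw Aw'] /and3P[Bw Dw Dw']].
have [_ h] := HA s s0 Aw; have [h' _] := HA' s s0 Aw'.
have hB := HB _ Bw; have nk := nzD _ Dw; have nn := nzD' _ Dw'.
set x := width s in Aw Aw' Bw Dw Dw' h h' hB nk nn *.
have x1 : 1 <= x by lra.
have x0 : 0 < x by lra.
set P := x `^ (gamma - 1) in h h'.
have P0 : 0 < P by exact: powR_gt0.
have P1 : P <= 1 by apply: powR_le1 => //; rewrite subr_le0 ltW.
have P2 : 0 < P ^+ 2 by rewrite exprn_gt0.
have lP : ln (P ^+ 2) <= 0.
  by rewrite ln_le0// expr_le1// ltW.
have pk2 : 0 < psi k x ^+ 2 by rewrite lt0r sqr_ge0 sqrf_eq0 nk.
have pn2 : 0 < psi n x ^+ 2 by rewrite lt0r sqr_ge0 sqrf_eq0 nn.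
have Qk0 : 0 <= sqr_mean U 0 s by exact: sqr_ge0.
rewrite mulr_ge0 ?expR_ge0//=.
have hn : ln a' + ln (P ^+ 2) + ln (psi n x ^+ 2) <= ln (sqr_mean V 0 s).
  have pp : 0 < P ^+ 2 * psi n x ^+ 2 by rewrite mulr_gt0.
  have pp' : 0 < a' * (P ^+ 2 * psi n x ^+ 2) by rewrite mulr_gt0.
  rewrite -addrA -lnM ?posrE// -lnM ?posrE// ler_ln ?posrE//.
  exact: lt_le_trans h'.
have hk : sqr_mean U 0 s <= expR (ln b1 + ln (P ^+ 2) + ln (psi k x ^+ 2)).
  rewrite !expRD !lnK ?posrE// -mulrA; apply: (le_trans h).
  by rewrite ler_wpM2r ?le_max ?lexx// mulr_ge0 ?ltW.
apply: (le_trans (ler_wpM2r (expR_ge0 _) hk)); rewrite -expRD ler_expR -/q.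
have hn' := ler_wpM2l (ltW q0) hn.
have : (1 - q) * ln (P ^+ 2) <= 0 by rewrite mulr_ge0_le0// subr_ge0 ltW.
rewrite -/q in hB; lra.
Unshelve. all: by end_near. Qed.

End asymptotics.

(** * The profile cut-off *)

Lemma powR_cvg_at_right0 {R : realType} (p : R) : 0 < p ->
  e `^ p @[e --> 0^'+] --> (0 : R)^'+.
Proof.
move=> p0 P HP.
have HP' : \forall x \near (0 : R), 0 < x -> P x by exact: HP.
have H : \forall e \near (0 : R)^'+, 0 < e `^ p -> P (e `^ p) by exact: powR_cvg0 p0 _ HP'.
suff : \forall e \near (0 : R)^'+, P (e `^ p) by [].
near=> e; have e0 : 0 < e by near: e; exact: nbhs_right_gt.
have : 0 < e `^ p -> P (e `^ p) by near: e; exact: H.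
by apply; exact: powR_gt0.
Unshelve. all: by end_near. Qed.

Lemma bigmax_mem (r : seq nat) : r <> [::] -> (\max_(j <- r) j)%N \in r.
Proof.
elim: r => // a [|b r] ih _; first by rewrite big_seq1 mem_head.
rewrite big_cons in_cons; case: (leqP a (\max_(j <- b :: r) j)%N) => _.
  by rewrite ih ?orbT.
by rewrite eqxx.
Qed.

Section scaled_moments.
Context {R : realType}.
Variables (gamma : R) (delta w : R -> R) (lambda : R -> nat -> R).
Variable (psi : R -> nat -> R -> R).
Hypothesis gamma0 : 0 < gamma.
Hypothesis gamma1 : gamma < 1.
Hypothesis hdelta : forall eps : R, delta eps = eps `^ ((1 - gamma) / (1 + gamma)).
Hypothesis hw : forall eps : R, w eps = eps `^ ((1 - gamma) / (1 + gamma)).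
Hypothesis hspec : forall eps : R, 0 < eps <= 1 ->
  spectral_basis gamma eps (lambda eps) (psi eps).

Definition length_scale (eps : R) : R := eps `^ (gamma + 1)^-1.

Let g1 : 0 < gamma + 1. Proof. by rewrite addr_gt0. Qed.

Lemma length_scale_gt0 (eps : R) : 0 < eps -> 0 < length_scale eps.
Proof. exact: powR_gt0. Qed.

Lemma length_scaleK (eps : R) : 0 < eps -> length_scale eps `^ (gamma + 1) = eps.
Proof. by move=> e0; rewrite /length_scale -powRrM mulVf ?gt_eqF// powRr1// ltW. Qed.

Lemma delta_scale (eps : R) : delta eps = length_scale eps `^ (1 - gamma).
Proof. by rewrite hdelta /length_scale -powRrM mulrC (addrC 1 gamma). Qed.

Lemma window_scale (eps : R) : w eps = length_scale eps `^ (1 - gamma).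
Proof. by rewrite hw /length_scale -powRrM mulrC (addrC 1 gamma). Qed.

Let sb1 : spectral_basis gamma 1 (lambda 1) (psi 1).
Proof. by apply: hspec; rewrite ltr01 lexx. Qed.

Let sbs (eps : R) : 0 < eps <= 1 ->
  spectral_basis gamma (length_scale eps `^ (gamma + 1)) (lambda eps) (psi eps).
Proof. by move=> e01; have /andP[e0 _] := e01; rewrite length_scaleK//; exact: hspec. Qed.

Lemma eigenvalue_scale (eps : R) k : 0 < eps <= 1 -> w eps * lambda eps k = lambda 1 k.
Proof.
move=> e01; have /andP[/length_scale_gt0 s0 _] := e01.
by rewrite window_scale; have [E _] := basis_scaling gamma0 gamma1 s0 sb1 (sbs e01).
Qed.

Lemma moment_scale (eps x0 : R) k U : 0 < eps <= 1 ->
  (forall x : R, is_derive x 1 U (psi 1 k x)) ->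
  initial_moment (delta eps) x0 (psi eps k) ^+ 2 =
  sqr_mean gamma U x0 (length_scale eps).
Proof.
move=> e01 dU; have /andP[e0 _] := e01; have s0 := length_scale_gt0 e0.
have [_ /(_ k)[c c1 Hc]] := basis_scaling gamma0 gamma1 s0 sb1 (sbs e01).
set s := length_scale eps in s0 Hc *.
have d0 : 0 < delta eps by rewrite delta_scale powR_gt0.
have cpsi : continuous (psi eps k).
  have [_ _ d _ _] := eigenfunctionP (hspec e01) k.
  by move=> x; apply/differentiable_continuous/derivable1_diffP; exact: d.
have sn : s != 0 by rewrite gt_eqF.
have dV (x : R) : is_derive x 1 (fun y => c * s * U (y / s)) (psi eps k x).
  have dl : is_derive x 1 (fun y : R => y / s) s^-1 by der; ring.
  have ? := der_comp (g := fun y => y / s) (dU (x / s)) dl; der.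
  have := Hc (x / s); rewrite mulrCA mulfV// mulr1 => ->.
  by field.
rewrite (@initial_moment_primitive R _ x0 _ _ d0 cpsi dV) delta_scale -/s /sqr_mean.
have -> : s `^ (- gamma) = s `^ (1 - gamma) / s.
  by rewrite powR_Dgt0// powRr1 ?(ltW s0)// mulrAC mulfV// mul1r.
have D0 : 0 < s `^ (1 - gamma) by exact: powR_gt0.
rewrite (mulrDl x0 (s `^ (1 - gamma)) s^-1) (mulrBl s^-1 x0 (s `^ (1 - gamma))).
set X := U _; set Y := U _.
rewrite (_ : (2 * _)^-1 * _ = c * ((X - Y) / (2 * (s `^ (1 - gamma) / s)))); last first.
  by field; rewrite sn gt_eqF.
by rewrite exprMn c1 mul1r.
Qed.

Lemma ex_basis_primitive : exists U : nat -> R -> R,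
  forall k (x : R), is_derive x 1 (U k) (psi 1 k x).
Proof.
have H k : {U : R -> R | forall x : R, is_derive x 1 U (psi 1 k x)}.
  apply: cid; apply: ex_primitive.
  have [_ _ d _ _] := eigenfunctionP sb1 k.
  by move=> x; apply/differentiable_continuous/derivable1_diffP; exact: d.
by exists (fun k => sval (H k)) => k; exact: (svalP (H k)).
Qed.

End scaled_moments.

Theorem theorem1p5 (R : realType) (gamma : R) (hgamma : 0 < gamma <= 3^-1)
    (delta w : R -> R)
    (hdelta : forall eps : R, delta eps = eps `^ ((1 - gamma) / (1 + gamma)))
    (hw : forall eps : R, w eps = eps `^ ((1 - gamma) / (1 + gamma)))
    (lambda : R -> nat -> R) (psi : R -> nat -> R -> R)
    (hspec : forall eps : R, 0 < eps <= 1 ->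
       spectral_basis gamma eps (lambda eps) (psi eps))
    (rho : R -> R -> R -> R -> R)
    (hrho : forall x0 eps : R, 0 < eps <= 1 ->
       fokker_planck_solution gamma eps (initial_density (delta eps) x0)
         (rho x0 eps))
    (n : nat) (hn : (1 <= n)%N) :
  (forall x0 : R, x0 <> 0 ->
     exists tc : R -> R,
     [/\ \forall eps \near 0^'+,
           unique (fun t => expR (- 2 * lambda eps n * t) *
                     initial_moment (delta eps) x0 (psi eps n) ^+ 2 = 1)
             (tc eps),
         \forall eps \near 0^'+,
           tc eps = (lambda eps n)^-1 *
             ln `|initial_moment (delta eps) x0 (psi eps n)| &
         profile_cutoff
           (fun eps => truncated_chi2 gamma eps (psi eps) n (rho x0 eps))
           tc w (fun r => expR (- lambda 1 n * r))])
  /\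
  (nonvanishing_at0 (psi 1) n = [::] ->
     forall eps t : R, 0 < eps <= 1 -> 0 <= t ->
       truncated_chi2 gamma eps (psi eps) n (rho 0 eps) t = 0)
  /\
  (nonvanishing_at0 (psi 1) n <> [::] ->
     forall m : nat, m = (\max_(j <- nonvanishing_at0 (psi 1%R) n) j)%N ->
     exists tc : R -> R,
     (\forall eps \near 0^'+,
        unique (fun t => expR (- 2 * lambda eps m * t) *
                  initial_moment (delta eps) 0 (psi eps m) ^+ 2 = 1)
          (tc eps)) /\
     profile_cutoff
       (fun eps => truncated_chi2 gamma eps (psi eps) n (rho 0 eps))
       tc w (fun r => expR (- lambda 1 m * r))).
Proof.
have /andP[gamma0 gamma3'] := hgamma.
have gamma3 : 3 * gamma <= 1 by rewrite -ler_pdivlMl// mulr1.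
have gamma1 : gamma < 1 by lra.
have sb1 : spectral_basis gamma 1 (lambda 1) (psi 1).
  by apply: hspec; rewrite ltr01 lexx.
have [U dU] := ex_basis_primitive hspec.
have g1 : 0 < (gamma + 1)^-1 by rewrite invr_gt0 addr_gt0.
have w0 (e : R) : 0 < e -> 0 < w e by move=> e0; rewrite hw powR_gt0.
have d0 (e : R) : 0 < e -> 0 < delta e by move=> e0; rewrite hdelta powR_gt0.
have lamE (e : R) k : 0 < e <= 1 -> w e * lambda e k = lambda 1 k.
  exact: (eigenvalue_scale gamma0 gamma1 hw hspec).
have ME (e x0 : R) k : 0 < e <= 1 -> initial_moment (delta e) x0 (psi e k) ^+ 2 =
    sqr_mean gamma (U k) x0 (length_scale gamma e).
  by move=> e01; apply: (moment_scale gamma0 gamma1 hdelta hspec).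
have dE (x0 e t : R) : 0 < e <= 1 -> 0 <= t ->
    truncated_chi2 gamma e (psi e) n (rho x0 e) t =
    Num.sqrt (\sum_(1 <= k < n.+1) (expR (- lambda e k * t) *
      initial_moment (delta e) x0 (psi e k)) ^+ 2).
  move=> e01 t0; have /andP[e0 e1] := e01.
  exact: (chi2_formula gamma0 gamma1 e0 e1 (d0 e e0) (hspec e e01) (hrho x0 e e01) n t0).
have near01 : \forall e \near (0 : R)^'+, 0 < e <= 1.
  near=> e; apply/andP; split; first by near: e; exact: nbhs_right_gt.
  by near: e; exact: nbhs_right_le.
(* limits along the length scale are limits in the noise intensity *)
have core x0 m : (1 <= m)%N -> (m <= n)%N ->
    ln (sqr_mean gamma (U m) x0 s) @[s --> 0^'+] --> +oo ->
    (forall k, (1 <= k <= n)%N -> k != m ->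
      sqr_mean gamma (U k) x0 s * expR (- (lambda 1 k / lambda 1 m *
        ln (sqr_mean gamma (U m) x0 s))) @[s --> 0^'+] --> (0 : R)) ->
    (\forall e \near 0^'+,
      unique (fun t => expR (- 2 * lambda e m * t) *
        initial_moment (delta e) x0 (psi e m) ^+ 2 = 1)
        ((lambda e m)^-1 * ln `|initial_moment (delta e) x0 (psi e m)|)) /\
    profile_cutoff (fun eps => truncated_chi2 gamma eps (psi eps) n (rho x0 eps))
      (fun e => (lambda e m)^-1 * ln `|initial_moment (delta e) x0 (psi e m)|)
      w (fun r => expR (- lambda 1 m * r)).
  move=> m1 mn H1 H2; have lm := eigenvalue_gt0 sb1 m1.
  apply: (cutoff_core m1 mn lm w0 lamE (dE x0)
    (M := fun e k => initial_moment (delta e) x0 (psi e k))).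
    have c := cvg_comp _ _ (powR_cvg_at_right0 g1) H1.
    apply: cvg_trans c; apply: near_eq_cvg.
    by apply: filterS near01 => e e01; rewrite /= (ME e x0 m e01).
  move=> k kn km.
  have c := cvg_comp _ _ (powR_cvg_at_right0 g1) (H2 k kn km).
  apply: cvg_trans c; apply: near_eq_cvg.
  by apply: filterS near01 => e e01; rewrite /= !(ME e x0 _ e01).
split; last split.
- move=> x0 /eqP x00; exists (fun e => (lambda e n)^-1 *
    ln `|initial_moment (delta e) x0 (psi e n)|).
  have [] := core x0 n hn (leqnn n).
  + exact: (sqr_mean_infty_away gamma0 gamma3 sb1).
  + move=> k /andP[k1 kn] kn'.
    apply: (sqr_mean_ratio_away gamma0 gamma3 sb1) => //.
    by rewrite ltn_neqAle kn'.
  by move=> h1 h2; split=> //; exact: nearW.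
- move=> E eps t e01 t0; rewrite dE// big_nat big1 ?sqrtr0// => k kn.
  have p0 : psi 1 k 0 = 0.
    apply/eqP/negP => /negP pk.
    have : k \in nonvanishing_at0 (psi 1) n.
      by rewrite mem_filter pk mem_iota add1n.
    by rewrite E.
  by rewrite exprMn (ME eps 0 k e01) (sqr_mean_odd gamma0 gamma3 sb1 _ (dU k) p0) mulr0.
- move=> E m mE.
  have memE k : (k \in nonvanishing_at0 (psi 1) n) = (psi 1 k 0 != 0) && (1 <= k <= n)%N.
    by rewrite mem_filter mem_iota add1n ltnS.
  have le_m k : k \in nonvanishing_at0 (psi 1) n -> (k <= m)%N.
    by move=> kE; rewrite mE; apply: (@leq_bigmax_seq _ _ xpredT id).
  have mM : m \in nonvanishing_at0 (psi 1) n.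
    by rewrite mE; exact: bigmax_mem.
  have /andP[pm /andP[m1 mn]] : (psi 1 m 0 != 0) && (1 <= m <= n)%N by rewrite -memE.
  exists (fun e => (lambda e m)^-1 * ln `|initial_moment (delta e) 0 (psi e m)|).
  apply: core => //.
    exact: (sqr_mean_infty_origin gamma0 gamma3 sb1).
  move=> k kn km; have /andP[k1 _] := kn.
  have [p0|pk] := eqVneq (psi 1 k 0) 0.
    under eq_fun do rewrite (sqr_mean_odd gamma0 gamma3 sb1 _ (dU k) p0) mul0r.
    exact: cvg_cst.
  apply: (sqr_mean_ratio_origin gamma0 gamma3 sb1) => //.
  by rewrite ltn_neqAle km le_m// memE pk.
Unshelve. all: by end_near. Qed.
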